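(* Let $d\ge 1$, let $\sigma,\alpha,\nu>0$ and $M\in SL(d,\mathbb R)$, and let $Y$ be a mean zero, geometric anisotropic $d$-dimensional Matérn Gaussian random field with parameters $(\sigma,\alpha,\nu,M)$. Let $\Omega$ be a (nonempty) bounded, open subset of $\mathbb R^d$ and let $\boldsymbol h\in\mathbb R^d$ be a fixed nonzero vector. If $m$ is a positive integer with $m>\nu$, then $$Q_n^m\to a_\nu^m\quad\text{with probability one as } n\to\infty .$$ Moreover, there exists a constant $c>0$ such that $$\operatorname{var} Q_n^m\le \begin{cases} c\,n^{4(\nu-m)}, & \text{if } 4(\nu-m)>-d;\\ c\,n^{-d}\log n, & \text{if } 4(\nu-m)=-d;\\ c\,n^{-d}, & \text{if } 4(\nu-m)<-d\end{cases}$$ for all sufficiently large $n$.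
   Context: Matérn field: $Y$ is a mean zero Gaussian random field on $\mathbb R^d$ with $\operatorname{cov}(Y(\boldsymbol s),Y(\boldsymbol t))=K(|M\boldsymbol s-M\boldsymbol t|)$, where $|\cdot|$ is the Euclidean norm, $K(t)=\frac{\sigma^2(\alpha t)^\nu}{\Gamma(\nu)2^{\nu-1}}\mathcal K_\nu(\alpha t)$ for $t>0$, $K(0)=\sigma^2$, and $\mathcal K_\nu$ is the modified Bessel function of the second kind of order $\nu$. $SL(d,\mathbb R)$ is the group of real $d\times d$ matrices of determinant 1. Increments: $\Delta_{\boldsymbol h}Y(\boldsymbol t)=Y(\boldsymbol t+\boldsymbol h)-Y(\boldsymbol t)$ and $\Delta^m_{\boldsymbol h}Y(\boldsymbol t)=\Delta_{\boldsymbol h}\Delta_{\boldsymbol h}^{m-1}Y(\boldsymbol t)$. Quadratic variation: $\Omega_n=\Omega\cap\{\mathbb Z^d/n\}$, $\#\Omega_n$ is its cardinality, and $$Q_n^m=\frac1{\#\Omega_n}\sum_{\boldsymbol j\in\Omega_n}n^{2\nu}\bigl(\Delta^m_{\boldsymbol h/n}Y(\boldsymbol j)\bigr)^2 .$$ Principal irregular term: for $t>0$, $G_\nu(t)=\frac{(-1)^{\nu+1}}{2^{2\nu-1}\Gamma(\nu)\Gamma(\nu+1)}t^{2\nu}\log t$ if $\nu\in\mathbb Z$, and $G_\nu(t)=\frac{-\pi}{2^{2\nu}\sin(\nu\pi)\Gamma(\nu)\Gamma(\nu+1)}t^{2\nu}$ otherwise; $G_\nu(0)=0$. Limit: $$a_\nu^m=\sigma^2\alpha^{2\nu}|M\boldsymbol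 h|^{2\nu}\sum_{i,j=0}^m(-1)^{i+j}\binom mi\binom mj G_\nu(|i-j|).$$ *)

(* Defs.v *)
From HB Require Import structures.
From mathcomp Require Export all_boot all_order all_algebra.
From mathcomp Require Export finmap.
From mathcomp Require Export all_classical all_reals all_analysis.

Set Implicit Arguments.
Unset Strict Implicit.
Unset Printing Implicit Defensive.

Import Order.TTheory GRing.Theory Num.Theory.
Import numFieldNormedType.Exports.

Local Open Scope classical_set_scope.
Local Open Scope ring_scope.

Definition Gamma (R : realType) (x : R) : R :=
  \int[@lebesgue_measure R]_(t in `]0, +oo[) (t `^ (x - 1) * expR (- t)).

(* Modified Bessel function of the second kind (Macdonald function), through
   its integral representation, valid for all real orders nu (integer or not)
   and all x > 0. *)
Definition besselK (R : realType) (nu x : R) : R :=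
  \int[@lebesgue_measure R]_(t in `[0, +oo[)
    (expR (- x * ((expR t + expR (- t)) / 2))
     * ((expR (nu * t) + expR (- (nu * t))) / 2)).

(* The library norm on matrices is the max norm. *)
Definition enorm (R : realType) (d : nat) (x : 'cV[R]_d) : R :=
  Num.sqrt (\sum_(i < d) x i 0 ^+ 2).

Definition matern (R : realType) (sigma alpha nu t : R) : R :=
  if t == 0 then sigma ^+ 2
  else sigma ^+ 2 * (alpha * t) `^ nu / (Gamma nu * 2 `^ (nu - 1))
       * besselK nu (alpha * t).

(* The case s = 0 is spelled out because normal_prob mu 0 is by convention a
   uniform law, not the point mass at mu. *)
Definition gaussian_law (R : realType) (disp : measure_display)
    (T : measurableType disp) (P : probability T R) (X : T -> R) : Prop :=
  exists mu s : R, 0 <= s /\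
    forall A : set R, measurable A ->
      pushforward P X A = if s == 0 then \d_mu A else normal_prob mu s A.

(* Finite-dimensional distributions are (possibly degenerate) multivariate
   normal, i.e., all their linear combinations are univariate normal. *)
Definition gaussian_field (R : realType) (disp : measure_display)
    (T : measurableType disp) (P : probability T R) (d : nat)
    (Y : 'cV[R]_d -> {RV P >-> R}) : Prop :=
  forall (k : nat) (t : 'I_k -> 'cV[R]_d) (a : 'I_k -> R),
    gaussian_law P (fun w => \sum_(i < k) a i * Y (t i) w).

Definition matern_field (R : realType) (disp : measure_display)
    (T : measurableType disp) (P : probability T R) (d : nat)
    (sigma alpha nu : R) (M : 'M[R]_d) (Y : 'cV[R]_d -> {RV P >-> R}) : Prop :=
  [/\ gaussian_field Y,
      forall s, ('E_P[Y s] = 0)%E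
    & forall s t, covariance P (Y s) (Y t) =
        (matern sigma alpha nu (enorm (M *m s - M *m t)))%:E].

Definition increment (R : realType) (d : nat) (h : 'cV[R]_d)
    (f : 'cV[R]_d -> R) : 'cV[R]_d -> R :=
  fun t => f (t + h) - f t.

Definition grid (R : realType) (d : nat) (Omega : set 'cV[R]_d) (n : nat) :
    set 'cV[R]_d :=
  Omega `&` [set s | exists z : 'cV[int]_d, s = n%:R^-1 *: map_mx intr z].

(* For bounded Omega and n > 0 the grid is finite, so that fset_set (which is
   fset0 on infinite sets) is the grid itself. If the grid is empty, Q is 0. *)
Definition quad_var (R : realType) (disp : measure_display)
    (T : measurableType disp) (P : probability T R) (d : nat)
    (nu : R) (Omega : set 'cV[R]_d) (h : 'cV[R]_d) (m : nat)
    (Y : 'cV[R]_d -> {RV P >-> R}) (n : nat) : T -> R :=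
  fun w => (#|` fset_set (grid Omega n)|)%:R^-1
    * \sum_(j <- fset_set (grid Omega n))
        n%:R `^ (2 * nu)
        * (iter m (increment (n%:R^-1 *: h)) (fun s => Y s w) j) ^+ 2.

Definition irregular_term (R : realType) (nu t : R) : R :=
  if 0 < t then
    if nu \is a Num.int then
      (-1) ^ (Num.floor nu + 1)
      / (2 `^ (2 * nu - 1) * Gamma nu * Gamma (nu + 1))
      * t `^ (2 * nu) * ln t
    else
      - pi / (2 `^ (2 * nu) * sin (nu * pi) * Gamma nu * Gamma (nu + 1))
      * t `^ (2 * nu)
  else 0.

Definition quad_var_limit (R : realType) (d : nat) (sigma alpha nu : R)
    (M : 'M[R]_d) (h : 'cV[R]_d) (m : nat) : R :=
  sigma ^+ 2 * alpha `^ (2 * nu) * enorm (M *m h) `^ (2 * nu)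
  * \sum_(i < m.+1) \sum_(j < m.+1)
      (-1) ^+ (i + j) * 'C(m, i)%:R * 'C(m, j)%:R
      * irregular_term nu `|i%:R - j%:R|.

Definition variance_rate (R : realType) (d : nat) (nu : R) (m n : nat) : R :=
  let e := 4 * (nu - m%:R) in
  if - d%:R < e then n%:R `^ e
  else if e == - d%:R then n%:R ^- d * ln n%:R
  else n%:R ^- d.

(* Main.v *)
From HB Require Import structures.
Require Import Defs.
From mathcomp Require Import ring lra zify.
From mathcomp Require Import measurable_realfun.

(** Write [X j] for the [m]-th increments at the grid points, scaled so that the
    quadratic variation is the sum of their squares. Everything reduces to the
    covariance matrix of the [X j]: its trace is the mean of the quadratic
    variation, and twice its squared Frobenius norm is the variance.

    The covariance is a mixture of Gaussian kernels: for [t >= 0] and [r = (alpha t)^2 / 4],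
    [matern t] is a multiple of the integral over [s] of [e^(-nu s - e^(-s) - r e^s)]
    ([matern_mixture]). Hence a covariance of two [m]-th increments is a mixture of
    double differences of Gaussian kernels, and two estimates follow.

    Mean. For two increments at the same point the double difference is an
    exponential sum [D (w) = \sum_p c_p e^(-k_p w)] whose first [m] derivatives vanish at 0
    (counted from order 0), and after scaling the variance tends to a multiple of the
    integral of [w^(-nu-1) D (w)]. Integrating by parts until the integral converges
    term by term evaluates it. For noninteger [nu] this produces [Gamma (m - nu)],
    which the reflection formula turns into the sine of the limit; for integer [nu] a
    logarithm appears ([irregular_sum], [matern_diff2_cvg]). The reflection formula is
    proved with Wallis integrals ([Gamma_reflection]).

    Decay. For two increments at distance [rho / n], with [rho] large, the double
    difference is bounded by a derivative of order [2 m] of the Gaussian kernel along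
    a line. Integrating over the mixture gives a scaled covariance of order
    [rho^(2 (nu - m))] ([matern_diff2_bound], [incr_cov_decay]). Summing the squares over
    the lattice in dyadic shells gives the Frobenius norm, with the three regimes of
    the rate according to whether the geometric series of ratio [2^(d - 4 (m - nu))]
    grows, is constant or decays ([lattice_sum]).

    Almost sure convergence. When [4 (m - nu)] or [d] is small the variances need not be
    summable, so higher moments are used. Gaussian integration by parts, derived by
    polarization from the moments of one-dimensional normal laws ([gpoly_stein]), gives a
    recursion for the moments of the centred sum of squares, and the moment of order
    [2 q] is bounded by a constant times the [q]-th power of the Frobenius norm
    ([sumsqc_moment_le]). As the latter is at most a negative power of [n], the moments are
    summable for large [q]. *)

Set Implicit Arguments.
Unset Strict Implicit.
Unset Printing Implicit Defensive.

Import Order.TTheory GRing.Theory Num.Theory.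
Import numFieldNormedType.Exports.

Local Open Scope classical_set_scope.
Local Open Scope ring_scope.

(** * Exponentially decaying functions on the line *)

Section line.
Variable R : realType.
Notation mu := (@lebesgue_measure R).
Implicit Types (f g F G : R -> R).

Lemma is_derive_continuous f f' : (forall x : R, is_derive x (1 : R) f (f' x)) -> continuous f.
Proof.
move=> df x; apply/differentiable_continuous/derivable1_diffP.
by have := df x; case.
Qed.

(** In logarithmic coordinates [t = e^s] the Gamma and Bessel integrals have
    integrands in this class. It is closed under the operations used below, so
    one membership proof gives integrability, vanishing boundary terms and
    invariance under translation. *)
Definition edecay f := continuous f /\
  exists c C, [/\ 0 < c, 0 <= C & forall x, `|f x| <= C * expR (- c * `|x|)].

Lemma expNabs_continuous (c : R) : continuous (fun x : R => expR (- c * `|x|)).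
Proof.
move=> x; apply: continuous_comp; last exact: continuous_expR.
apply: continuousM; first exact: cst_continuous.
exact: norm_continuous.
Qed.

Lemma integral_expN (c : R) : 0 < c ->
  (\int[mu]_(x in `[0%R, +oo[) (expR (- c * x))%:E = (c^-1)%:E)%E.
Proof.
move=> c0.
have dE (x : R) : is_derive x 1 (fun x => - c^-1 * expR (- c * x)) (expR (- c * x)).
  by apply: is_derive_eq; rewrite /GRing.scale /=; field; rewrite gt_eqF.
have dE' (x : R) : is_derive x 1 (fun x => expR (- c * x)) (- c * expR (- c * x)).
  by apply: is_derive_eq; rewrite /GRing.scale /=; ring.
rewrite (@ge0_continuous_FTC2y _ _ (fun x => - c^-1 * expR (- c * x)) _ 0)//.
- by rewrite mulr0 expR0 mulr1 -EFinB sub0r opprK.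
- by apply: continuous_subspaceT; exact: is_derive_continuous dE'.
- rewrite -(mulr0 (- c^-1)); apply: cvgM; first exact: cvg_cst.
  rewrite (_ : (fun x => expR (- c * x)) =
               (fun z => expR (- z)) \o (fun z => c * z)); last first.
    by apply: eq_fun => x; rewrite mulNr.
  apply: (@cvg_comp _ _ _ _ _ _ (pinfty_nbhs R)); last exact: cvgr_expR.
  exact: gt0_cvgMry.
- by apply/cvg_at_right_filter; exact: is_derive_continuous dE _.
- by move=> x _; rewrite derive1E; exact: derive_val.
Qed.

Lemma integrable_expNabs (c : R) : 0 < c ->
  mu.-integrable setT (EFin \o (fun x => expR (- c * `|x|))).
Proof.
move=> c0; apply/integrableP; split.
  by apply/measurable_EFinP; apply: continuous_measurable_fun; exact: expNabs_continuous.
under eq_integral do rewrite /= ger0_norm ?expR_ge0//.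
rewrite ge0_symfun_integralT; last 3 first.
- by move=> x; exact: expR_ge0.
- exact: expNabs_continuous.
- by move=> x /=; rewrite normrN.
rewrite -set_itvcy.
rewrite (_ : integral _ _ _ = \int[mu]_(x in `[0%R, +oo[) (expR (- c * x))%:E)%E; last first.
  apply: eq_integral => x; rewrite inE /= in_itv /= andbT => x0.
  by rewrite ger0_norm.
by rewrite integral_expN// -EFinM ltry.
Qed.

Lemma edecay_integrable f : edecay f -> mu.-integrable setT (EFin \o f).
Proof.
move=> [cf [c [C [c0 C0 fC]]]].
apply: (@le_integrable _ _ _ mu setT _ _ (fun x => C%:E * (EFin \o (fun x => expR (- c * `|x|))) x)%E) => //.
- by apply/measurable_EFinP; exact: continuous_measurable_fun.
- move=> x _ /=; rewrite lee_fin (le_trans (fC x))//.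
  exact: ler_norm.
- by apply: integrableZl => //; exact: integrable_expNabs.
Qed.

Lemma edecay_le f g (K : R) : continuous g -> edecay f ->
  (forall x, `|g x| <= K * `|f x|) -> edecay g.
Proof.
move=> cg [cf [c [C [c0 C0 fC]]]] gf; split=> //; exists c, (`|K| * C); split => //.
  by rewrite mulr_ge0.
move=> x; rewrite (le_trans (gf x))// -mulrA.
apply: (le_trans (ler_wpM2r _ (ler_norm K))); first exact: normr_ge0.
by apply: ler_wpM2l; rewrite ?normr_ge0.
Qed.

Lemma edecay_expNabs (c : R) : 0 < c -> edecay (fun x => expR (- c * `|x|)).
Proof.
move=> c0; split; first exact: expNabs_continuous.
exists c, 1; split => // x; rewrite mul1r ger0_norm//; exact: expR_ge0.
Qed.

Lemma edecayD f g : edecay f -> edecay g -> edecay (fun x => f x + g x).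
Proof.
move=> [cf [c [C [c0 C0 fC]]]] [cg [d [D [d0 D0 gD]]]]; split.
  by move=> x; apply: continuousD; [exact: cf|exact: cg].
have m0 : 0 < Num.min c d by rewrite lt_min c0 d0.
exists (Num.min c d), (C + D); split => //; first exact: addr_ge0.
move=> x; rewrite (le_trans (ler_normD _ _))// mulrDl lerD//.
- apply: (le_trans (fC x)); apply: ler_wpM2l => //.
  by rewrite ler_expR !mulNr lerN2 ler_wpM2r// ge_min lexx.
- apply: (le_trans (gD x)); apply: ler_wpM2l => //.
  by rewrite ler_expR !mulNr lerN2 ler_wpM2r// ge_min lexx orbT.
Qed.

Lemma edecayZ f (k : R) : edecay f -> edecay (fun x => k * f x).
Proof.
move=> df; apply: (@edecay_le f _ `|k|) => //; last by move=> x; rewrite normrM.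
by move=> x; apply: continuousM; [exact: cst_continuous|case: df => + _; apply].
Qed.

Lemma edecay0 : edecay (fun=> 0).
Proof.
have := edecayZ 0 (edecay_expNabs ltr01).
by under eq_fun do rewrite mul0r.
Qed.

Lemma edecay_sum (I : Type) (r : seq I) (F : I -> R -> R) :
  (forall i, edecay (F i)) -> edecay (fun x => \sum_(i <- r) F i x).
Proof.
move=> dF; elim: r => [|i r IH].
  by under eq_fun do rewrite big_nil; exact: edecay0.
by under eq_fun do rewrite big_cons; exact: edecayD.
Qed.

Lemma edecay_mulX f : edecay f -> edecay (fun x => x * f x).
Proof.
move=> [cf [c [C [c0 C0 fC]]]]; split.
  by move=> x; apply: continuousM; [exact: cvg_id|exact: cf].
exists (c / 2), (2 / c * C); split; first by rewrite divr_gt0.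
  by rewrite mulr_ge0// divr_ge0 // ltW.
move=> x; rewrite normrM.
have h : `|x| <= 2 / c * expR (c / 2 * `|x|).
  have : c / 2 * `|x| <= expR (c / 2 * `|x|).
    by apply: le_trans (expR_ge1Dx _); rewrite lerDr.
  have c20 : 0 <= 2 / c by rewrite divr_ge0 // ltW.
  move=> /(ler_wpM2l c20); rewrite mulrA.
  by rewrite (_ : 2 / c * (c / 2) = 1) ?mul1r//; field; rewrite gt_eqF.
apply: (le_trans (ler_pM _ _ h (fC x))) => //.
rewrite le_eqVlt; apply/orP; left; apply/eqP.
rewrite (_ : - (c / 2) * `|x| = c / 2 * `|x| + - c * `|x|); last by field.
rewrite expRD; ring.
Qed.

Lemma edecay_cvg f : edecay f -> f n%:R @[n --> \oo] --> (0 : R) /\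
  f (- n%:R) @[n --> \oo] --> (0 : R).
Proof.
move=> [cf [c [C [c0 C0 fC]]]].
have h : C * expR (- c * n%:R) @[n --> \oo] --> (0 : R).
  rewrite -(mulr0 C); apply: cvgMr.
  rewrite (_ : (fun n => expR (- c * n%:R)) =
      (fun z => expR (- z)) \o (fun n => c * n%:R)); last first.
    by apply/funext => n /=; rewrite mulNr.
  apply: (@cvg_comp _ _ _ _ _ _ (pinfty_nbhs R)); last exact: cvgr_expR.
  apply: (@cvg_comp _ _ _ (fun n => n%:R) ( *%R c) _ (pinfty_nbhs R)); last exact: gt0_cvgMry.
  exact: cvgr_idn.
have h' : - (C * expR (- c * n%:R)) @[n --> \oo] --> (0 : R).
  by rewrite -oppr0; apply: cvgN.
split; (apply: squeeze_cvgr; [|exact: h'|exact: h]); apply: nearW => n.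
- by rewrite -ler_norml; have := fC n%:R; rewrite (ger0_norm (ler0n R n)).
- by rewrite -ler_norml; have := fC (- n%:R); rewrite normrN (ger0_norm (ler0n R n)).
Qed.

Lemma integrable_cvg_itv f : continuous f -> mu.-integrable setT (EFin \o f) ->
  (\int[mu]_(x in `[(- n%:R)%R, (n%:R)%R]) (f x)%:E)%E @[n --> \oo] --> (\int[mu]_x (f x)%:E)%E.
Proof.
move=> cf fi.
have mf : measurable_fun setT f by exact: continuous_measurable_fun.
have := @dominated_convergence _ _ _ mu setT measurableT
  (fun n => (EFin \o f) \_ `[- n%:R, n%:R]) (EFin \o f) (abse \o (EFin \o f)).
case.
- move=> n; apply/(measurable_restrictT _ _).1 => //.
  by apply/measurable_EFinP/measurable_funTS.
- exact/measurable_EFinP.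
- apply: aeW => x _ /=; apply: cvg_near_cst.
  exists (Num.truncn `|x|).+1 => // n /= hn.
  rewrite patchE ifT// inE /= in_itv /= -ler_norml.
  apply: ltW; apply: (lt_le_trans (truncnS_gt _)); by rewrite ler_nat.
- exact: integrable_abse.
- apply: aeW => x n _ /=; rewrite patchE; case: ifP => _ //=.
  by rewrite normr0 lee_fin normr_ge0.
move=> _ _ h; under eq_fun do rewrite integral_mkcond; exact: h.
Qed.

(** The boundary terms of the fundamental theorem of calculus vanish at
    infinity. All integrations by parts below have this form. *)
Lemma integral_derivative_edecay F f :
  (forall x : R, is_derive x (1 : R) F (f x)) -> edecay F -> edecay f ->
  \int[mu]_x f x = 0.
Proof.
move=> dF eF ef.
have fi := edecay_integrable ef.
have h1 := integrable_cvg_itv ef.1 fi.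
have h2 : (\int[mu]_(x in `[(- n%:R)%R, (n%:R)%R]) (f x)%:E)%E @[n --> \oo] --> 0%E.
  have -> : 0%E = (0 - 0 : R)%:E by rewrite subr0.
  apply: (@cvg_trans _ ((fun n => (F n%:R - F (- n%:R))%:E) @ \oo)).
    apply: near_eq_cvg; exists 1%N => // n /= n0.
    rewrite (@continuous_FTC2 _ f F) ?EFinB//.
    - by rewrite gt0_cp// ltr0n.
    - by apply: continuous_subspaceT; exact: ef.1.
    - have cF := is_derive_continuous dF; split.
      + by move=> x _; have := dF x; case.
      + by apply/cvg_at_right_filter; exact: cF.
      + by apply/cvg_at_left_filter; exact: cF.
    - by move=> x _; rewrite derive1E; exact: derive_val.
  apply: cvg_EFin; first by apply: nearW.
  by have [h3 h4] := edecay_cvg eF; apply: cvgB.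
by rewrite /Rintegral (cvg_unique _ h1 h2).
Qed.

Lemma ge0_integral_translate (a : R) f : (forall x, 0 <= f x) -> continuous f ->
  (\int[mu]_x (f x)%:E = \int[mu]_x (f (x + a))%:E)%E.
Proof.
move=> f0 cf.
have dF (x : R) : is_derive x (1 : R) (fun x => x + a) (1 : R).
  by apply: is_derive_eq; rewrite addr0.
have F' : (fun x : R => x + a)^`()%classic = cst (1 : R).
  by apply/funext => x; rewrite derive1E; exact: derive_val.
rewrite (@increasing_ge0_integration_by_substitutionT _ (fun x : R => x + a) f).
- by apply: eq_integral => x _; rewrite F' !fctE/= mulr1.
- by move=> x y; rewrite ltrD2r.
- by rewrite F' => ?; exact: cvg_cst.
- by rewrite F'; exact: is_cvg_cst.
- by rewrite F'; exact: is_cvg_cst.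
- by move=> x; have := dF x; case.
- exact: cvg_addrr_Ny.
- exact: cvg_addrr.
- exact: cf.
- exact: f0.
Qed.

Lemma edecay_abs f : edecay f -> edecay (fun x => `|f x|).
Proof.
move=> ef; apply: (@edecay_le f _ 1) => //.
- move=> x; apply: (@continuous_comp _ _ _ f (fun y : R => `|y|)); first exact: ef.1.
  exact: norm_continuous.
- by move=> x; rewrite normr_id mul1r.
Qed.

Lemma edecay_translate (a : R) f : edecay f -> edecay (fun x => f (x + a)).
Proof.
move=> [cf [c [C [c0 C0 fC]]]]; split.
  move=> x; apply: (@continuous_comp _ _ _ (fun x => x + a) f); last exact: cf.
  by apply: continuousD; [exact: cvg_id|exact: cvg_cst].
exists c, (C * expR (c * `|a|)); split => //.
  by rewrite mulr_ge0// expR_ge0.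
move=> x; apply: (le_trans (fC _)); rewrite -mulrA -expRD.
apply: ler_wpM2l => //; rewrite ler_expR.
have : `|x| <= `|x + a| + `|a|.
  by rewrite -[in leLHS](addrK a x) -[in leRHS](normrN a); exact: ler_normD.
move=> /(ler_wpM2l (ltW c0)); lra.
Qed.

Lemma integral_edecayD f g : edecay f -> edecay g ->
  \int[mu]_x (f x + g x) = \int[mu]_x f x + \int[mu]_x g x.
Proof. by move=> ef eg; rewrite RintegralD//; exact: edecay_integrable. Qed.

Lemma integral_edecayZ f (k : R) : edecay f ->
  \int[mu]_x (k * f x) = k * \int[mu]_x f x.
Proof. by move=> ef; rewrite RintegralZl//; exact: edecay_integrable. Qed.

Lemma integral_edecay_sum (I : Type) (r : seq I) (F : I -> R -> R) :
  (forall i, edecay (F i)) ->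
  \int[mu]_x (\sum_(i <- r) F i x) = \sum_(i <- r) \int[mu]_x F i x.
Proof.
move=> eF; elim: r => [|i r IH].
  under eq_Rintegral do rewrite big_nil.
  by rewrite big_nil Rintegral_cst// mul0r.
under eq_Rintegral do rewrite big_cons.
by rewrite big_cons integral_edecayD ?IH//; exact: edecay_sum.
Qed.

(** From the nonnegative case, applied to [|f|] and to [|f| + f]. *)
Lemma integral_translate (a : R) f : edecay f ->
  \int[mu]_x f (x + a) = \int[mu]_x f x.
Proof.
move=> ef.
have ea := edecay_abs ef.
have eaf := edecayD ea ef.
have h g : edecay g -> (forall x, 0 <= g x) -> \int[mu]_x g (x + a) = \int[mu]_x g x.
  by move=> eg g0; rewrite /Rintegral (ge0_integral_translate a g0)//; exact: eg.1.
have := h _ eaf _; rewrite integral_edecayD; last 2 first.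
- exact: edecay_translate ea.
- exact: edecay_translate ef.
rewrite (h _ ea)// integral_edecayD// => /(_ _)/addrI; apply => x.
by rewrite -lerBlDr sub0r ler_normr lexx orbT.
Qed.

(** A zero integral would force [f = 0] almost everywhere, hence a full null set. *)
Lemma integral_gt0 f : edecay f -> (forall x, 0 < f x) -> 0 < \int[mu]_x f x.
Proof.
move=> ef f0; rewrite lt_neqAle Rintegral_ge0 ?andbT; last by move=> x _; exact: ltW.
apply/eqP => f00.
have fi := edecay_integrable ef.
have h : (\int[mu]_x `|(f x)%:E| = 0)%E.
  under eq_integral do rewrite gee0_abs ?lee_fin ?(ltW (f0 _))//.
  by rewrite -[LHS]fineK ?integrable_fin_num// -/(Rintegral _ _ _) -f00.
have /(ae_eq_integral_abs mu measurableT) := h.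
move=> H.
have {}H : ae_eq mu setT (EFin \o f) (cst 0%E).
  by apply/H; apply/measurable_EFinP; apply: continuous_measurable_fun; exact: ef.1.
case: H => N [mN N0 HN].
have NT : N = setT.
  rewrite -subTset => x _; apply: HN => /= /(_ I) [fx0].
  by have := f0 x; rewrite fx0 ltxx.
have := lebesgue_measure_itv (`[0, 1] : interval R); rewrite /= lte_fin ltr01 oppr0 adde0 => h1.
have : (mu `[0%R, 1%R]%classic <= 0)%E by rewrite -N0 NT; apply: le_measure => //; rewrite inE.
by rewrite h1 lee_fin ler10.
Qed.

Lemma ge0_integral_fold f : (forall x, 0 <= f x) -> continuous f ->
  (\int[mu]_x (f x)%:E = \int[mu]_(x in `[0%R, +oo[) (f x + f (- x))%:E)%E.
Proof.
move=> f0 cf.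
have mf : measurable_fun [set: R] f by exact: continuous_measurable_fun.
have cfN : continuous (fun x => f (- x)).
  by move=> x; apply: (@continuous_comp _ _ _ -%R f); [exact: opp_continuous|exact: cf].
have mfN : measurable_fun [set: R] (fun x => f (- x)) by exact: continuous_measurable_fun.
have mposnums : measurable [set x : R | 0 <= x]%R by rewrite -set_itvcy.
rewrite -(setUv [set x : R | 0 <= x]%R) ge0_integral_setU//= ; last 4 first.
- exact: measurableC.
- by apply/measurable_EFinP; rewrite setUv.
- by move=> x _; rewrite lee_fin.
- exact/disj_setPCl.
rewrite -set_itvcy// setCitvr.
rewrite (integral_itv_bndo_bndc (f := EFin \o f)); last exact/measurable_EFinP/measurable_funTS.
rewrite -{2}oppr0 ge0_integration_by_substitutionNy//; last exact: continuous_subspaceT.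
rewrite -ge0_integralD//.
- by move=> x _; rewrite lee_fin.
- by apply/measurable_EFinP/measurable_funTS.
- by move=> x _; rewrite lee_fin /=.
- by apply/measurable_EFinP/measurable_funTS.
Qed.

Lemma ge0_integral_reflect f : (forall x, 0 <= f x) -> continuous f ->
  \int[mu]_x f (- x) = \int[mu]_x f x.
Proof.
move=> f0 cf; rewrite /Rintegral !ge0_integral_fold//.
  by congr fine; apply: eq_integral => x _; rewrite opprK addrC.
by move=> x; apply: (@continuous_comp _ _ _ -%R f); [exact: opp_continuous|exact: cf].
Qed.

Lemma edecay_dominated_cvg (u : nat -> R -> R) f g :
  (forall n, continuous (u n)) -> continuous f -> edecay g ->
  (forall n x, `|u n x| <= g x) -> (forall x, u n x @[n --> \oo] --> f x) ->
  (\int[mu]_x u n x) @[n --> \oo] --> \int[mu]_x f x.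
Proof.
move=> cu cf eg ug uf.
have gi := edecay_integrable eg.
have [|||||fi _ h] := @dominated_convergence _ _ _ mu setT measurableT
  (fun n => EFin \o u n) (EFin \o f) (EFin \o g).
- by move=> n; apply/measurable_EFinP; exact: continuous_measurable_fun.
- by apply/measurable_EFinP; exact: continuous_measurable_fun.
- by apply: aeW => x _ /=; apply: cvg_EFin; [exact: nearW|exact: uf].
- exact: gi.
- by apply: aeW => x n _ /=; rewrite lee_fin.
by apply: fine_cvg; rewrite fineK//; exact: integrable_fin_num.
Qed.

(** * The Gamma function in logarithmic coordinates *)

(** Integrand of [Gamma a] after [t = e^s], with rate [k] in the exponential. *)
Definition gumbel (a k s : R) := expR (a * s - k * expR s).

Lemma gumbel_derive a k (s : R) :
  is_derive s (1 : R) (gumbel a k) (a * gumbel a k s - k * gumbel (a + 1) k s).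
Proof.
rewrite /gumbel; apply: is_derive_eq; rewrite /GRing.scale /=.
rewrite (_ : (a + 1) * s - k * expR s = s + (a * s - k * expR s)); last by ring.
rewrite [expR (s + _)]expRD; ring.
Qed.

Lemma gumbel_ge0 a k s : 0 <= gumbel a k s. Proof. exact: expR_ge0. Qed.

Lemma expR_ge_sqr (s : R) : 0 <= s -> s ^+ 2 / 4 <= expR s.
Proof.
move=> s0; rewrite (_ : expR s = expR (s / 2) ^+ 2); last first.
  by rewrite expr2 -expRD -splitr.
have := expR_ge1Dx (s / 2) => h.
rewrite (_ : s ^+ 2 / 4 = (s / 2) ^+ 2); last by field.
apply: lerXn2r; rewrite ?nnegrE ?expR_ge0 ?divr_ge0//; lra.
Qed.

(** To the right, [k e^s] beats every linear term because [e^s >= s^2 / 4]. *)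
Lemma edecay_gumbel a k : 0 < a -> 0 < k -> edecay (gumbel a k).
Proof.
move=> a0 k0; split; first exact: is_derive_continuous (gumbel_derive a k).
exists a, (expR (4 * a ^+ 2 / k)); split => //.
move=> s; rewrite ger0_norm ?gumbel_ge0// -expRD ler_expR.
have ka : 0 <= 4 * a ^+ 2 / k.
  by rewrite divr_ge0// ?mulr_ge0 ?sqr_ge0// ltW.
have [s0|s0] := leP 0 s; last first.
  have : 0 <= k * expR s by rewrite mulr_ge0 ?expR_ge0// ltW.
  by rewrite ltr0_norm//; lra.
rewrite ger0_norm//.
have := expR_ge_sqr s0 => /(ler_wpM2l (ltW k0)) h.
have h2 : 2 * a * s <= 4 * a ^+ 2 / k + k * (s ^+ 2 / 4).
  rewrite -subr_ge0.
  rewrite (_ : _ - _ = (4 * a - k * s) ^+ 2 / (4 * k)); last by field; rewrite gt_eqF.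
  by rewrite divr_ge0 ?sqr_ge0// mulr_ge0// ltW.
lra.
Qed.

(** Substitution [t = e^s] on the intervals [[e^(-n), e^n]], followed by monotone
    convergence. *)
Lemma Gamma_gumbel (x : R) : 0 < x -> Gamma x = \int[mu]_s gumbel x 1 s.
Proof.
move=> x0; rewrite /Gamma /Rintegral; congr fine.
pose f (t : R) := t `^ (x - 1) * expR (- t).
pose I (n : nat) : set R := `[expR (- n%:R), expR n%:R]%classic.
pose J (n : nat) : set R := `[(- n%:R), n%:R]%classic.
have dE (t : R) : 0 < t -> is_derive t (1 : R) (fun t => expR ((x - 1) * ln t) * expR (- t)) (((x - 1) / t - 1) * f t).
  move=> t0; have ? := is_derive1_ln t0; apply: is_derive_eq; rewrite /GRing.scale /=.
  by rewrite /f /powR gt_eqF//; ring.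
have cf (t : R) : 0 < t -> {for t, continuous f}.
  move=> t0.
  have h : {for t, continuous (fun t => expR ((x - 1) * ln t) * expR (- t))}.
    by apply/differentiable_continuous/derivable1_diffP; have := dE _ t0; case.
  rewrite /prop_for /continuous_at {2}/f /powR gt_eqF//.
  apply: cvg_trans h; apply: near_eq_cvg; near=> y; rewrite /f /powR gt_eqF//.
  by near: y; exact: lt_nbhsr.
have eU : `]0%R, +oo[%classic = \bigcup_n I n.
  apply/seteqP; split => t /=; rewrite in_itv/= ?andbT.
    move=> t0; exists (Num.truncn `|ln t|).+1 => //=; rewrite /I/= in_itv/=.
    have h : `|ln t| <= (Num.truncn `|ln t|).+1%:R by exact/ltW/truncnS_gt.
    move: h; rewrite ler_norml => /andP[h1 h2].
    by rewrite -ler_ln ?posrE ?expR_gt0// expRK h1 -ler_ln ?posrE ?expR_gt0// expRK.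
  move=> [n _]; rewrite /I/= in_itv/= => /andP[h _].
  by apply: lt_le_trans h; exact: expR_gt0.
have eT : [set: R] = \bigcup_n J n.
  apply/seteqP; split => t //= _.
  exists (Num.truncn `|t|).+1 => //=; rewrite /J/= in_itv/=.
  have h : `|t| <= (Num.truncn `|t|).+1%:R by exact/ltW/truncnS_gt.
  by rewrite -ler_norml.
have cI n : {within I n, continuous f}.
  apply: continuous_in_subspaceT => t; rewrite inE /I /= in_itv/= => /andP[h _].
  by apply: cf; apply: lt_le_trans h; exact: expR_gt0.
have dexp : (@expR R)^`()%classic = expR.
  by apply/funext => s; rewrite derive1E; exact: derive_val.
have IJ n : (\int[mu]_(t in I n) (f t)%:E = \int[mu]_(s in J n) (gumbel x 1 s)%:E)%E.
  rewrite /I (@integration_by_substitution_increasing _ (@expR R) f).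
  - apply: eq_integral => s _; rewrite dexp !fctE /f /= /gumbel.
    rewrite /powR gt_eqF ?expR_gt0// expRK -!expRD; congr (expR _)%:E; ring.
  - by rewrite ge0_cp .
  - by move=> u v _ _ uv; rewrite ltr_expR.
  - by move=> u _; rewrite dexp; exact: continuous_expR.
  - by rewrite dexp; apply/cvg_ex; eexists; apply/cvg_at_right_filter; exact: continuous_expR.
  - by rewrite dexp; apply/cvg_ex; eexists; apply/cvg_at_left_filter; exact: continuous_expR.
  - split.
    + by move=> u _; exact: derivable_expR.
    + by apply/cvg_at_right_filter; exact: continuous_expR.
    + by apply/cvg_at_left_filter; exact: continuous_expR.
  - exact: cI.
have hI : (\int[mu]_(t in I n) (f t)%:E)%E @[n --> \oo] --> (\int[mu]_(t in \bigcup_n I n) (f t)%:E)%E.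
  apply: ge0_nondecreasing_set_cvg_integral => //.
  - apply/nondecreasing_seqP => n; rewrite subsetEset => t; rewrite /I/= !in_itv/= => /andP[h1 h2].
    by rewrite (le_trans _ h1) ?(le_trans h2)// ler_expR ?lerN2 ler_nat.
  - by move=> n; exact: measurable_itv.
  - move=> n; apply/measurable_EFinP.
    by apply: subspace_continuous_measurable_fun; [exact: measurable_itv|exact: cI].
  - by move=> n t _; rewrite lee_fin mulr_ge0 ?powR_ge0 ?expR_ge0.
have hJ : (\int[mu]_(t in J n) (gumbel x 1 t)%:E)%E @[n --> \oo] --> (\int[mu]_(t in \bigcup_n J n) (gumbel x 1 t)%:E)%E.
  apply: ge0_nondecreasing_set_cvg_integral => //.
  - apply/nondecreasing_seqP => n; rewrite subsetEset => t; rewrite /J/= !in_itv/= => /andP[h1 h2].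
    by rewrite (le_trans _ h1) ?(le_trans h2)// ?lerN2 ler_nat.
  - by move=> n; exact: measurable_itv.
  - move=> n; apply/measurable_EFinP; apply: measurable_funTS.
    by apply: continuous_measurable_fun; exact: is_derive_continuous (gumbel_derive x 1).
  - by move=> n t _; rewrite lee_fin gumbel_ge0.
rewrite eT eU; apply: (cvg_unique _ hI); first exact: ereal_hausdorff.
by rewrite /=; under eq_fun do rewrite IJ; exact: hJ.
Unshelve. all: by end_near. Qed.

Lemma Gamma_gt0 (x : R) : 0 < x -> 0 < Gamma x.
Proof.
move=> x0; rewrite Gamma_gumbel//; apply: integral_gt0; first exact: edecay_gumbel.
by move=> s; exact: expR_gt0.
Qed.

(** Translate by [ln k]. *)
Lemma integral_gumbel (a k : R) : 0 < a -> 0 < k ->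
  \int[mu]_s gumbel a k s = k `^ (- a) * Gamma a.
Proof.
move=> a0 k0; rewrite Gamma_gumbel// -integral_edecayZ; last exact: edecay_gumbel.
rewrite -(integral_translate (- ln k)); last exact: edecay_gumbel.
apply: eq_Rintegral => s _; rewrite /gumbel /powR gt_eqF// -expRD.
rewrite [expR (s - _)]expRD expRN lnK// mulrCA divff ?gt_eqF// mulr1.
congr expR; ring.
Qed.

(** The derivative of [e^(x s - e^s)] integrates to zero. *)
Lemma GammaS (x : R) : 0 < x -> Gamma (x + 1) = x * Gamma x.
Proof.
move=> x0; have x10 : 0 < x + 1 by rewrite addr_gt0.
rewrite !Gamma_gumbel//.
have e1 := edecay_gumbel x0 ltr01.
have e2 := edecay_gumbel x10 ltr01.
have := @integral_derivative_edecay _ _ (gumbel_derive x 1) e1.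
have e3 := edecayZ x e1.
have -> : (fun s => x * gumbel x 1 s - 1 * gumbel (x + 1) 1 s) =
  (fun s => x * gumbel x 1 s + (-1) * gumbel (x + 1) 1 s).
  by apply/funext => s; ring.
have e4 := edecayZ (-1) e2.
move=> /(_ (edecayD e3 e4)).
rewrite integral_edecayD// !integral_edecayZ//; lra.
Qed.

Lemma Gamma1 : Gamma (1 : R) = 1.
Proof.
rewrite /Gamma /Rintegral integral_itv_obnd_cbnd; last first.
  apply/measurable_EFinP/measurable_funM; last first.
    by apply: measurable_funTS; apply: continuous_measurable_fun => x;
       apply: continuous_comp; [exact: opp_continuous|exact: continuous_expR].
  by apply: measurable_funTS; exact: measurable_powR.
rewrite (_ : integral _ _ _ = \int[mu]_(x in `[0%R, +oo[) (expR (- 1 * x))%:E)%E; last first.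
  by apply: eq_integral => t _; rewrite subrr powRr0 mul1r mulN1r.
by rewrite integral_expN// invr1.
Qed.

Lemma Gamma_nat n : Gamma (n.+1%:R : R) = n`!%:R.
Proof.
elim: n => [|n IH]; first by rewrite Gamma1.
by rewrite -natr1 GammaS// IH factS natrM.
Qed.
End line.

(** * The reflection formula for Gamma *)

Section reflection.
Variable R : realType.
Notation mu := (@lebesgue_measure R).

Lemma Rintegral_FTC (F f : R -> R) (a b : R) : a < b ->
  (forall x : R, is_derive x (1 : R) F (f x)) -> continuous f ->
  \int[mu]_(x in `[a, b]) f x = F b - F a.
Proof.
move=> ab dF cf; rewrite /Rintegral (@continuous_FTC2 _ f F) ?EFinB//.
- exact: continuous_subspaceT.
- have cF := is_derive_continuous dF; split.
  + by move=> x _; have := dF x; case.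
  + by apply/cvg_at_right_filter; exact: cF.
  + by apply/cvg_at_left_filter; exact: cF.
- by move=> x _; rewrite derive1E; exact: derive_val.
Qed.

Lemma continuous_integrable_itv (f : R -> R) (a b : R) : continuous f ->
  mu.-integrable `[a, b] (EFin \o f).
Proof.
move=> cf; apply: continuous_compact_integrable; first exact: segment_compact.
exact: continuous_subspaceT.
Qed.

Lemma le_Rintegral_itv (f g : R -> R) (a b : R) : continuous f -> continuous g ->
  (forall x, a <= x <= b -> f x <= g x) ->
  \int[mu]_(x in `[a, b]) f x <= \int[mu]_(x in `[a, b]) g x.
Proof.
by move=> cf cg fg; apply: le_Rintegral => //; exact: continuous_integrable_itv.
Qed.

Lemma expR_convex (b t : R) : 0 <= b <= 1 -> expR (b * t) <= (1 - b) + b * expR t.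
Proof.
move=> /andP[b0 b1].
have h1 := ler_wpM2l (expR_ge0 (b * t)) (expR_ge1Dx (t - b * t)).
have h2 := ler_wpM2l (expR_ge0 (b * t)) (expR_ge1Dx (- (b * t))).
have e1 : expR (b * t) * expR (t - b * t) = expR t by rewrite -expRD addrC subrK.
have e2 : expR (b * t) * expR (- (b * t)) = 1 by rewrite -expRD subrr expR0.
rewrite e1 in h1; rewrite e2 in h2.
have := ler_wpM2l b0 h1; have : 0 <= 1 - b by lra.
move=> /ler_wpM2l /(_ _ _ h2); lra.
Qed.

(** Jensen's inequality for [u |-> u^b] under the Gamma density: a form of
    log-convexity. *)
Lemma Gamma_le_powR (x b : R) : 0 < x -> 0 <= b <= 1 ->
  Gamma (x + b) <= x `^ b * Gamma x.
Proof.
move=> x0 /[dup] b01 /andP[b0 b1].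
have xb0 : 0 < x + b by rewrite ltr_wpDr.
have x10 : 0 < x + 1 by rewrite addr_gt0.
have e0 := edecay_gumbel x0 ltr01.
have e1 := edecay_gumbel x10 ltr01.
have eb := edecay_gumbel xb0 ltr01.
rewrite [leLHS]Gamma_gumbel//.
apply: (@le_trans _ _ (\int[mu]_s (x `^ b * (1 - b) * gumbel x 1 s + x `^ b * b / x * gumbel (x + 1) 1 s))).
  apply: le_Rintegral => //.
  - exact: edecay_integrable.
  - by apply: edecay_integrable; apply: edecayD; apply: edecayZ.
  move=> s _; have := expR_convex (s - ln x) b01.
  rewrite expRD expRN lnK// => h.
  have p0 : 0 <= x `^ b * gumbel x 1 s by rewrite mulr_ge0 ?powR_ge0 ?gumbel_ge0.
  have := ler_wpM2l p0 h.
  rewrite (_ : x `^ b * gumbel x 1 s * expR (b * (s - ln x)) = gumbel (x + b) 1 s); last first.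
    by rewrite /gumbel /powR gt_eqF// -!expRD; congr expR; ring.
  move=> /le_trans; apply; rewrite le_eqVlt; apply/orP; left; apply/eqP.
  rewrite (_ : gumbel (x + 1) 1 s = expR s * gumbel x 1 s); last first.
    by rewrite /gumbel -!expRD; congr expR; ring.
  by field; rewrite gt_eqF.
rewrite integral_edecayD ?integral_edecayZ//; try exact: edecayZ.
rewrite -!Gamma_gumbel// GammaS//.
by rewrite le_eqVlt; apply/orP; left; apply/eqP; field; rewrite gt_eqF.
Qed.

(** As a function of [b] these integrals satisfy the two-step recursion in [n]
    that also governs [Gamma (n + 1 + b) * Gamma (n + 1 - b) / n!^2], and at [n = 0]
    they contain [sin (pi b)]. *)
Definition wallis (b : R) n := \int[mu]_(x in `[0, pi / 2]) (cos (2 * b * x) * cos x ^+ n).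

Lemma is_derive_pow (f : R -> R) (x df : R) n : is_derive x (1 : R) f df ->
  is_derive x (1 : R) (fun y => f y ^+ n) (n%:R * f x ^+ n.-1 * df).
Proof.
move=> h; elim: n => [|n IH].
  by under eq_fun do rewrite expr0; apply: is_derive_eq; rewrite !mul0r.
under eq_fun do rewrite exprS.
apply: is_derive_eq; rewrite /GRing.scale /= -natr1.
case: n {IH} => [|n] /=; first by rewrite expr0; ring.
by rewrite exprS; ring.
Qed.

Lemma wallis_derive (b x : R) n :
  is_derive x (1 : R) (fun x => cos (2 * b * x) * cos x ^+ n)
    (- (2 * b * sin (2 * b * x) * cos x ^+ n) - n%:R * cos (2 * b * x) * cos x ^+ n.-1 * sin x).
Proof.
case: n => [|n].
  under eq_fun do rewrite expr0.
  by apply: is_derive_eq; rewrite /GRing.scale /=; ring.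
have h := is_derive_pow n.+1 (is_derive_cos x).
apply: is_derive_eq; rewrite /GRing.scale /=; ring.
Qed.

Lemma wallis_continuous (b : R) n : continuous (fun x : R => cos (2 * b * x) * cos x ^+ n).
Proof. exact: is_derive_continuous (fun x => wallis_derive b x n). Qed.

Lemma pihalf_gt0 : 0 < pi / 2 :> R.
Proof. by rewrite divr_gt0 ?pi_gt0. Qed.

(** The difference of the two sides is the integral of the derivative of
    [(n+2) cos(2bx) cos(x)^(n+1) sin(x) - 2b sin(2bx) cos(x)^(n+2)], which vanishes
    at both ends. *)
Lemma wallis_rec (b : R) n :
  ((n.+2)%:R ^+ 2 - 4 * b ^+ 2) * wallis b n.+2 = (n.+2)%:R * (n.+1)%:R * wallis b n.
Proof.
apply/eqP; rewrite -subr_eq0; apply/eqP.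
pose F (x : R) := (n.+2)%:R * (cos (2 * b * x) * cos x ^+ n.+1 * sin x) -
   2 * b * (sin (2 * b * x) * cos x ^+ n.+2).
pose f (x : R) := ((n.+2)%:R ^+ 2 - 4 * b ^+ 2) * (cos (2 * b * x) * cos x ^+ n.+2) -
   (n.+2)%:R * (n.+1)%:R * (cos (2 * b * x) * cos x ^+ n).
have dF (x : R) : is_derive x (1 : R) F (f x).
  have h1 := is_derive_pow n.+1 (is_derive_cos x).
  have h2 := is_derive_pow n.+2 (is_derive_cos x).
  apply: is_derive_eq; rewrite /GRing.scale /= /f.
  have := cos2Dsin2 x; move: (sin x) (cos x) => s c h.
  have -> : c ^+ n.+2 = c ^+ n * c ^+ 2 by rewrite -exprD addn2.
  have -> : c ^+ n.+1 = c ^+ n * c by rewrite exprSr.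
  rewrite -[n.+2]addn2 -[n.+1]addn1 !natrD.
  have e : s * s = 1 - c ^+ 2 by rewrite -h; ring.
  set C := cos _; set S := sin _; set p := c ^+ n; clearbody p C S; move: (n%:R : R) => N.
  pose E := C * p * (N + 2) * (N + 1).
  transitivity (C * p * (N + 2) * c ^+ 2 - E * (s * s) - 4 * b ^+ 2 * C * p * c ^+ 2); first by rewrite /E; ring.
  by rewrite e /E; ring.
have cf : continuous f.
  by move=> x; rewrite /f; apply: cvgB; (apply: cvgM; first exact: cvg_cst); exact: wallis_continuous.
transitivity (\int[mu]_(x in `[0, pi / 2]) f x).
  have ci (k : R) m : mu.-integrable `[0, pi / 2] (EFin \o (fun x => k * (cos (2 * b * x) * cos x ^+ m))).
    apply: continuous_integrable_itv => x; apply: cvgM; first exact: cvg_cst.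
    exact: wallis_continuous.
  have ci1 m : mu.-integrable `[0, pi / 2] (EFin \o (fun x => (cos (2 * b * x) * cos x ^+ m))).
    by apply: continuous_integrable_itv; exact: wallis_continuous.
  by rewrite /f RintegralB// !RintegralZl.
by rewrite (Rintegral_FTC pihalf_gt0 dF cf) /F cos_pihalf !expr0n /= !(mulr0, sin0, mul0r) !subr0.
Qed.

Lemma wallis0 (b : R) : b != 0 -> wallis b 0 = sin (pi * b) / (2 * b).
Proof.
move=> b0; rewrite /wallis.
have dF (x : R) : is_derive x (1 : R) (fun x => sin (2 * b * x) / (2 * b)) (cos (2 * b * x) * cos x ^+ 0).
  apply: is_derive_eq; rewrite /GRing.scale /= expr0; field.
  by rewrite b0.
rewrite (Rintegral_FTC pihalf_gt0 dF (@wallis_continuous b 0)).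
by rewrite !mulr0 sin0 mul0r subr0; congr (sin _ / _); field.
Qed.

Lemma wallis00 : wallis 0 0 = pi / 2.
Proof.
rewrite /wallis.
have dF (x : R) : is_derive x (1 : R) id (cos (2 * 0 * x) * cos x ^+ 0).
  by rewrite mulr0 mul0r cos0 expr0 mulr1; exact: is_derive_id.
by rewrite (Rintegral_FTC pihalf_gt0 dF (@wallis_continuous 0 0)) subr0.
Qed.

Lemma abs_sin_le (x : R) : `|sin x| <= `|x|.
Proof.
have h (y : R) : 0 <= y -> `|sin y| <= y.
  move=> y0.
  have [c _] := @MVT_segment R sin cos 0 y y0 (fun x _ => is_derive_sin x)
    (continuous_subspaceT (@continuous_sin R)).
  rewrite sin0 !subr0 => ->; rewrite normrM (ger0_norm y0).
  by rewrite ler_piMl// cos_max.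
have [x0|x0] := leP 0 x; first exact: le_trans (h _ x0) (ler_norm _).
by have := h (- x); rewrite sinN normrN (ltr0_norm x0); apply; rewrite oppr_ge0 ltW.
Qed.

Lemma cos_ge_sqr (x : R) : 1 - cos x <= x ^+ 2 / 2.
Proof.
have -> : cos x = 1 - 2 * sin (x / 2) ^+ 2.
  rewrite [in LHS](splitr x) cosD; have := cos2Dsin2 (x / 2); rewrite -!expr2; lra.
have : sin (x / 2) ^+ 2 <= (x / 2) ^+ 2.
  by rewrite -[leLHS]real_normK ?num_real// -[leRHS]real_normK ?num_real// lerXn2r ?nnegrE// abs_sin_le.
lra.
Qed.

Lemma mul_cos_le_sin (x : R) : 0 <= x <= pi / 2 -> x * cos x <= sin x.
Proof.
move=> /andP[x0 x1].
have dF (y : R) : is_derive y (1 : R) (fun y => sin y - y * cos y) (y * sin y).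
  apply: is_derive_eq; rewrite /GRing.scale /=; ring.
have [c] := @MVT_segment R _ _ 0 x x0 (fun x _ => dF x)
    (continuous_subspaceT (is_derive_continuous dF)).
rewrite in_itv /= => /andP[c0 cx].
rewrite sin0 mul0r subrr !subr0 => h; rewrite -subr_ge0 h.
rewrite !mulr_ge0// sin_ge0_pi// c0 (le_trans cx)// (le_trans x1)//.
by rewrite ler_pdivrMr// ler_peMr ?pi_ge0// (ler_nat _ 1 2).
Qed.

Lemma wallis_even_gt0 n : 0 < wallis 0 n.*2.
Proof.
elim: n => [|n IH]; first by rewrite wallis00 pihalf_gt0.
have := wallis_rec 0 n.*2; rewrite expr0n /= mulr0 subr0 => h.
have : 0 < (n.*2.+2)%:R ^+ 2 * wallis 0 n.*2.+2 by rewrite h !mulr_gt0.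
by rewrite pmulr_rgt0 // exprn_gt0.
Qed.

(** The mass of [cos^n] concentrates at 0, where [cos (2 b x)] is close to 1: the
    defect [1 - cos (2 b x)] is at most [2 b^2 x^2], and [x^2 cos(x)^2 <= sin(x)^2]
    reduces its integral to the recursion at [b = 0]. *)
Lemma wallis_close (b : R) n : `|wallis b n.+1.*2 / wallis 0 n.+1.*2 - 1| <= 2 * b ^+ 2 / n.+1%:R.
Proof.
set w0 := wallis 0 _.
have w0p : 0 < w0 by exact: wallis_even_gt0.
have c1 := @wallis_continuous b n.+1.*2.
have c0 := @wallis_continuous 0 n.+1.*2.
have c2 := @wallis_continuous 0 n.*2.
have ub : wallis b n.+1.*2 <= w0.
  apply: le_Rintegral_itv => // x _.
  rewrite !mulr0 mul0r cos0 ler_wpM2r ?cos_le1//.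
  by rewrite doubleS -[n.*2.+2]/(n.+1.*2) -mul2n exprM exprn_ge0// sqr_ge0.
have lb : w0 - wallis b n.+1.*2 <= 2 * b ^+ 2 * (wallis 0 n.*2 - w0).
  rewrite /w0 /wallis -RintegralB//; [|exact: continuous_integrable_itv..].
  rewrite -RintegralB//; [|exact: continuous_integrable_itv..].
  rewrite -RintegralZl//; last first.
    by apply: continuous_integrable_itv => x; apply: cvgB; [exact: c2|exact: c0].
  apply: le_Rintegral_itv.
  - by move=> x; apply: cvgB; [exact: c0|exact: c1].
  - move=> x; apply: cvgM; first exact: cvg_cst.
    by apply: cvgB; [exact: c2|exact: c0].
  move=> x xr; rewrite !mulr0 mul0r cos0 !mul1r.
  have p0 : 0 <= cos x ^+ n.*2 by rewrite -mul2n exprM exprn_ge0// sqr_ge0.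
  have h1 : (x * cos x) ^+ 2 <= sin x ^+ 2.
    rewrite lerXn2r ?nnegrE ?mul_cos_le_sin//.
      move: xr => /andP[x0 x1]; rewrite mulr_ge0// cos_ge0_pihalf// x1 andbT.
      by rewrite (le_trans _ x0)// oppr_le0 ltW// pihalf_gt0.
    move: xr => /andP[x0 x1]; rewrite sin_ge0_pi// x0 (le_trans x1)//.
    by rewrite ler_pdivrMr// ler_peMr ?pi_ge0// (ler_nat _ 1 2).
  have h2 := cos_ge_sqr (2 * b * x).
  have e : cos x ^+ n.+1.*2 = cos x ^+ n.*2 * cos x ^+ 2 by rewrite doubleS -addn2 exprD.
  have s2 : sin x ^+ 2 = 1 - cos x ^+ 2 by rewrite -(cos2Dsin2 x); ring.
  rewrite e (_ : _ - _ = cos x ^+ n.*2 * cos x ^+ 2 * (1 - cos (2 * b * x))); last by ring.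
  rewrite (_ : 2 * b ^+ 2 * _ = cos x ^+ n.*2 * (2 * b ^+ 2) * sin x ^+ 2); last by rewrite s2; ring.
  have q0 : 0 <= cos x ^+ n.*2 * cos x ^+ 2 by rewrite mulr_ge0// sqr_ge0.
  apply: (le_trans (ler_wpM2l q0 h2)).
  have r0 : 0 <= cos x ^+ n.*2 * (2 * b ^+ 2) by rewrite mulr_ge0// mulr_ge0// sqr_ge0.
  apply: le_trans (ler_wpM2l r0 h1).
  by rewrite le_eqVlt; apply/orP; left; apply/eqP; field.
have := wallis_rec 0 n.*2; rewrite expr0n /= mulr0 subr0 -doubleS -/w0 => hr.
have n2 : n.+1.*2%:R = 2 * n.+1%:R :> R by rewrite -mul2n natrM.
have n1 : n.*2.+1%:R = 2 * n.+1%:R - 1 :> R.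
  by rewrite -n2 doubleS -[in RHS]natr1 addrK.
have np : 1 <= n.+1%:R :> R by rewrite ler1n.
move: hr; rewrite n1 n2; move: np; move: (n.+1%:R : R) => N N1 hr.
have hr' : (2 * N - 1) * (wallis 0 n.*2 - w0) = w0.
  have N0 : 2 * N != 0 by rewrite mulf_neq0// gt_eqF//; lra.
  apply: (mulfI N0); rewrite mulrA mulrBr -hr; ring.
have hd : N * (wallis 0 n.*2 - w0) <= w0.
  have : 0 <= wallis 0 n.*2 - w0.
    by rewrite -(pmulr_rge0 (x := 2 * N - 1)) ?hr' ?ltW//; lra.
  move=> d0; rewrite -{2}hr' ler_wpM2r//; lra.
rewrite ler0_norm; last first.
  by rewrite subr_le0 ler_pdivrMr// mul1r.
rewrite (_ : - _ = (w0 - wallis b n.+1.*2) / w0); last by field; rewrite gt_eqF.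
rewrite ler_pdivrMr//.
apply: (le_trans lb).
rewrite -[leRHS]mulrA; apply: ler_wpM2l; first by rewrite mulr_ge0// sqr_ge0.
by rewrite mulrC ler_pdivlMr ?[_ * N]mulrC//; lra.
Qed.

End reflection.

Section reflection2.
Variable R : realType.
Local Opaque Gamma wallis.
Notation mu := (@lebesgue_measure R).

Let Q (b : R) n := Gamma (n%:R + 1 + b) * Gamma (n%:R + 1 - b) / n`!%:R ^+ 2 *
  (wallis b n.*2 / wallis (0 : R) n.*2).

(** The product of the Gamma ratio and the Wallis ratio does not depend on [n]: at
    [n = 0] it is the quantity of the reflection formula, and it tends to 1. *)
Let QS (b : R) n : 0 < b < 1 -> Q b n.+1 = Q b n.
Proof.
move=> /andP[b0 b1]; rewrite /Q.
have n0 : 0 <= n%:R :> R by [].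
have h1 : 0 < n%:R + 1 + b :> R by lra.
have h2 : 0 < n%:R + 1 - b :> R by lra.
have -> : n.+1%:R + 1 + b = (n%:R + 1 + b) + 1 :> R by rewrite -natr1; ring.
have -> : n.+1%:R + 1 - b = (n%:R + 1 - b) + 1 :> R by rewrite -natr1; ring.
rewrite !GammaS// factS natrM.
have wb := wallis_rec b n.*2; have w0 := wallis_rec (0 : R) n.*2.
rewrite -!doubleS in wb w0.
have p0 := wallis_even_gt0 R n; have p1 := wallis_even_gt0 R n.+1.
have n2 : n.+1.*2%:R = 2 * n.+1%:R :> R by rewrite -mul2n natrM.
have f0 : n`!%:R != 0 :> R by rewrite pnatr_eq0 -lt0n fact_gt0.
have e1 : wallis b n.+1.*2 = n.+1.*2%:R * n.*2.+1%:R * wallis b n.*2 / (n.+1.*2%:R ^+ 2 - 4 * b ^+ 2).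
  rewrite -wb mulrAC divff ?mul1r// n2 -natr1.
  rewrite (_ : _ - _ = 4 * (n%:R + 1 + b) * (n%:R + 1 - b)); last by ring.
  by rewrite !mulf_neq0// gt_eqF.
have e0 : wallis (0 : R) n.+1.*2 = n.+1.*2%:R * n.*2.+1%:R * wallis (0 : R) n.*2 / (n.+1.*2%:R ^+ 2).
  rewrite -w0 expr0n /= mulr0 subr0 mulrAC divff ?mul1r// n2.
rewrite e1 e0 n2.
rewrite (_ : (_ * n.+1%:R) ^+ 2 - _ = 4 * (n%:R + 1 + b) * (n%:R + 1 - b)); last first.
  by rewrite -natr1; ring.
have m0 : n.*2.+1%:R != 0 :> R by [].
have m1 : n.+1%:R != 0 :> R by [].
by field; rewrite !gt_eqF// m0 m1 f0.
Qed.

Let Q0 (b : R) : 0 < b < 1 -> Q b 0 = Gamma b * Gamma (1 - b) * sin (pi * b) / pi.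
Proof.
move=> /andP[b0 b1]; rewrite /Q add0r fact0 wallis0 ?gt_eqF// wallis00.
rewrite [1 + b]addrC GammaS//.
have := pi_gt0 R; move: (sin (pi * b)) (Gamma b) (Gamma (1 - b)) (@pi R) => S G1 G2 p p0.
by field; rewrite !gt_eqF.
Qed.

(** Both bounds come from [Gamma (x + b) <= x^b Gamma x], applied with the
    exponents [b] and [1 - b]. *)
Lemma GammaS_bounds (b : R) n : 0 < b < 1 ->
  1 - n.+1%:R^-1 <= Gamma (n.+1%:R + 1 + b) * Gamma (n.+1%:R + 1 - b) / n.+1`!%:R ^+ 2 <= 1 + n.+1%:R^-1.
Proof.
move=> /andP[b0 b1].
have b01 : 0 <= b <= 1 by rewrite !ltW.
have b01' : 0 <= 1 - b <= 1 by lra.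
move NE : (n.+1%:R : R) => N.
have N1 : 1 <= N by rewrite -NE ler1n.
have GN : Gamma (N + 1) = n.+1`!%:R by rewrite -NE natr1 Gamma_nat.
have f0 : 0 < n.+1`!%:R :> R by rewrite ltr0n fact_gt0.
have Np : 0 < N by rewrite (lt_le_trans _ N1).
have N0 : N != 0 by rewrite gt_eqF.
have [l1 l2 l3 l4] : [/\ 0 < N + 1, 0 < N + 1 - b, 0 < N + 1 + b & 0 < N + 2] by split; lra.
have [l5 l6 l7 l8] : [/\ 0 <= N + 1, N + 1 + b <= N + 2, N + 1 - b <= N + 2 & N <= N + 1] by split; lra.
have [l9 l10] : 0 <= 1 - b /\ 1 - b + b = 1 by split; lra.
have h2 : 1 - N^-1 <= (N + 1) / (N + 2).
  rewrite -subr_ge0 (_ : _ - _ = 2 / (N * (N + 2))); last by field; rewrite N0 gt_eqF.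
  by rewrite divr_ge0// mulr_ge0// ltW.
have a1 : (N + 1 + b) `^ (1 - b) <= (N + 2) `^ (1 - b).
  by apply: ge0_ler_powR; rewrite ?nnegrE// ltW.
have a2 : (N + 1 - b) `^ b <= (N + 2) `^ b.
  by apply: ge0_ler_powR; rewrite ?nnegrE// ltW.
have a3 : N `^ (1 - b) <= (N + 1) `^ (1 - b).
  by apply: ge0_ler_powR; rewrite ?nnegrE// ltW.
have a4 (x : R) : 0 < x -> x `^ (1 - b) * x `^ b = x.
  move=> x0; rewrite -powRD ?l10 ?powRr1//; first exact: ltW.
  by apply/implyP => _; rewrite gt_eqF.
have GN0 : Gamma N = n.+1`!%:R / N.
  rewrite -GN GammaS; last by rewrite (lt_le_trans _ N1).
  by rewrite mulrAC divff ?mul1r// gt_eqF// (lt_le_trans _ N1).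
move: f0 GN GN0; move: (n.+1`!%:R : R) => f f0 GN GN0.
have g1 : Gamma (N + 1 + b) <= (N + 1) `^ b * f.
  by rewrite -GN; exact: Gamma_le_powR.
have g2 : Gamma (N + 1 - b) <= N `^ (1 - b) * (f / N).
  by rewrite -GN0 -addrA; exact: Gamma_le_powR.
have g3 : f <= (N + 1 - b) `^ b * Gamma (N + 1 - b).
  by rewrite -GN -{1}(subrK b (N + 1)); exact: Gamma_le_powR.
have g4 : (N + 1) * f <= (N + 1 + b) `^ (1 - b) * Gamma (N + 1 + b).
  rewrite -GN -GammaS//.
  rewrite (_ : N + 1 + 1 = N + 1 + b + (1 - b)); first exact: Gamma_le_powR.
  by ring.
have p1 := Gamma_gt0 l3; have p2 := Gamma_gt0 l2.
move: g1 g2 g3 g4 p1 p2; move: (Gamma _) (Gamma _) => G1 G2 g1 g2 g3 g4 p1 p2.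
apply/andP; split.
  apply: (le_trans h2); rewrite ler_pdivlMr ?exprn_gt0// mulrAC ler_pdivrMr//.
  rewrite expr2 mulrA [leRHS]mulrC.
  apply: (le_trans (ler_pM _ _ g4 g3)); [by rewrite mulr_ge0// ltW|exact: ltW|].
  rewrite mulrACA ler_wpM2r ?mulr_ge0 ?(ltW p1) ?(ltW p2)//.
  by apply: (le_trans (ler_pM (powR_ge0 _ _) (powR_ge0 _ _) a1 a2)); rewrite a4.
rewrite ler_pdivrMr ?exprn_gt0//.
apply: (le_trans (ler_pM (ltW p1) (ltW p2) g1 g2)).
apply: (@le_trans _ _ ((N + 1) * (f * (f / N)))).
  rewrite mulrACA ler_wpM2r ?mulr_ge0 ?invr_ge0 ?(ltW f0) ?(ltW Np)//.
  by rewrite mulrC -[leRHS](a4 _ l1) ler_wpM2r ?powR_ge0.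
by rewrite le_eqVlt; apply/orP; left; apply/eqP; field.
Qed.

Lemma Gamma_reflection (b : R) : 0 < b < 1 ->
  Gamma b * Gamma (1 - b) * sin (pi * b) = pi.
Proof.
move=> b01; move: (b01) => /andP[b0 b1].
set q := Gamma b * Gamma (1 - b) * sin (pi * b) / pi.
have pi0 : pi != 0 :> R by rewrite gt_eqF// pi_gt0.
suff q1 : q = 1 by apply: (mulIf (invr_neq0 pi0)); rewrite divff.
have qn n : Q b n = q by elim: n => [|n IH]; rewrite ?Q0// QS.
have bd n : `|q - 1| <= 5 / n.+1%:R.
  rewrite -(qn n.+1) /Q.
  have := GammaS_bounds n b01; have := wallis_close b n.
  set g := _ / _ ^+ 2; set w := _ / wallis (0 : R) _.
  have : 0 < n.+1%:R^-1 :> R by rewrite invr_gt0.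
  have : n.+1%:R^-1 <= 1 :> R by rewrite invf_le1// ler1n.
  move: (n.+1%:R^-1 : R) => N N1 N0 hw /andP[g1 g2].
  have hg : `|g - 1| <= N by rewrite ler_norml; lra.
  have hg2 : `|g| <= 2 by rewrite ler_norml; lra.
  have b2 : b ^+ 2 <= 1 by rewrite expr_le1// ltW.
  have hw2 : `|w - 1| <= 2 * N.
    by apply: (le_trans hw); apply: ler_wpM2r; [exact: ltW|lra].
  rewrite (_ : g * w - 1 = g * (w - 1) + (g - 1)); last by ring.
  apply: (le_trans (ler_normD _ _)); rewrite normrM.
  have := ler_pM (normr_ge0 _) (normr_ge0 _) hg2 hw2; lra.
apply/eqP; rewrite -subr_eq0 -normr_le0; apply/ler_addgt0Pl => e e0; rewrite addr0.
apply: (le_trans (bd (Num.truncn (5 / e)))).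
rewrite ler_pdivrMr// mulrC -ler_pdivrMr//.
exact/ltW/truncnS_gt.
Qed.

Lemma Gamma_addn (x : R) j : 0 < x ->
  Gamma (x + j%:R) = Gamma x * \prod_(i < j) (x + i%:R).
Proof.
move=> x0; elim: j => [|j IH]; first by rewrite addr0 big_ord0 mulr1.
by rewrite big_ord_recr /= mulrA -IH -natr1 addrA GammaS ?ltr_wpDr// mulrC.
Qed.

Lemma sin_addnpi (x : R) r : sin (x + r%:R * pi) = (-1) ^+ r * sin x.
Proof.
elim: r => [|r IH]; first by rewrite mul0r addr0 mul1r.
by rewrite -natr1 mulrDl mul1r addrA sinDpi IH exprS mulN1r mulNr.
Qed.

(** The value at [- nu] of the analytic continuation of the Gamma function is
    [Gamma (m - nu) / \prod_(k < m) (k - nu)]; this is the reflection formula at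
    [- nu]. *)
Lemma Gamma_reflection_shift (nu : R) (m : nat) : 0 < nu < m%:R -> nu \isn't a Num.int ->
  Gamma (m%:R - nu) * sin (nu * pi) * Gamma (nu + 1) = - pi * \prod_(k < m) (k%:R - nu).
Proof.
move=> /andP[nu0 num] nuI.
pose r := Num.truncn nu; pose b := nu - r%:R.
have rb : nu = b + r%:R by rewrite /b subrK.
have [r1 r2] : r%:R <= nu /\ nu < r.+1%:R by have /andP[] := truncn_itv (ltW nu0).
have b0 : 0 < b.
  rewrite lt_neqAle subr_ge0 r1 andbT eq_sym; apply: contra nuI => /eqP h.
  by rewrite rb h add0r rpred_nat.
have b1 : b < 1 by rewrite /b ltrBlDr addrC natr1.
have rm : (r < m)%N by rewrite -(ltr_nat R) (le_lt_trans r1).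
have [j mE] : exists j, m = (r.+1 + j)%N by exists (m - r.+1)%N; rewrite subnKC.
have G1 : Gamma (m%:R - nu) = Gamma (1 - b) * \prod_(i < j) (1 - b + i%:R).
  by rewrite -Gamma_addn ?subr_gt0// mE rb natrD -natr1; congr Gamma; ring.
have G2 : Gamma (nu + 1) = Gamma b * \prod_(i < r.+1) (b + i%:R).
  by rewrite -Gamma_addn// rb -natr1 addrA.
have P1 : \prod_(k < m) (k%:R - nu) = (-1) ^+ r.+1 * \prod_(i < r.+1) (b + i%:R) *
    \prod_(i < j) (1 - b + i%:R).
  rewrite mE big_split_ord /=; congr (_ * _); last first.
    by apply: eq_bigr => i _; rewrite natrD rb -natr1; ring.
  have -> : (-1) ^+ r.+1 = \prod_(i < r.+1) (-1) :> R by rewrite prodr_const card_ord.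
  rewrite -big_split /=.
  rewrite (reindex_inj rev_ord_inj) /=; apply: eq_bigr => i _.
  by rewrite subSS natrB ?rb; [ring|rewrite -ltnS].
have S1 : sin (nu * pi) = (-1) ^+ r * sin (pi * b).
  by rewrite rb mulrDl sin_addnpi mulrC [pi * b]mulrC mulrC.
have h : Gamma b * Gamma (1 - b) * sin (pi * b) = pi by apply: Gamma_reflection; rewrite b0.
rewrite S1 G1 G2 P1 exprS -[X in _ = - X * _]h; clear h S1 G1 G2 P1.
move: (Gamma b) (Gamma (1 - b)) (sin (pi * b)) ((-1) ^+ r) => x1 x2 x3 x4.
move: (\prod_(i < j) _) (\prod_(i < r.+1) _) => x5 x6.
by ring.
Qed.

End reflection2.

(** * Finite differences *)

Section differences.

(** Difference operators on an arbitrary abelian group, so that the same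
    expansion serves for fields on [R^d] and for functions on the line. *)
Definition fdiff (V : zmodType) (R : pzRingType) (h : V) (f : V -> R) : V -> R :=
  fun x => f (x + h) - f x.

Lemma iter_fdiff (V : zmodType) (R : pzRingType) (h : V) m (f : V -> R) x :
  iter m (fdiff h) f x =
  \sum_(i < m.+1) (-1) ^+ (m + i) * 'C(m, i)%:R * f (x + h *+ i).
Proof.
elim: m x => [|m IH] x.
  by rewrite big_ord1 /= expr0 !mul1r mulr0n addr0.
rewrite iterS /fdiff !IH.
pose w i := (-1) ^+ (m.+1 + i) * 'C(m, i)%:R * f (x + h *+ i).
have wE : \sum_(i < m.+1) w i = - \sum_(i < m.+1) (-1) ^+ (m + i) * 'C(m, i)%:R * f (x + h *+ i).
  by rewrite -sumrN; apply: eq_bigr => i _; rewrite /w addSn exprS !mulN1r !mulNr.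
have wS : \sum_(i < m.+1) w i = w 0%N + \sum_(i < m.+1) w i.+1.
  transitivity (\sum_(i < m.+2) w i); last by rewrite big_ord_recl.
  have w0 : w m.+1 = 0 by rewrite /w bin_small// mulr0 mul0r.
  by rewrite [RHS]big_ord_recr /= w0 addr0.
rewrite -wE wS [RHS]big_ord_recl addrCA; congr (_ + _).
  by rewrite /w !bin0.
rewrite -big_split /=; apply: eq_bigr => i _.
rewrite /w /bump /= binS natrD mulrDr mulrDl addrC; congr (_ + _).
by rewrite !addSn addnS !exprS !mulN1r opprK -addrA mulrS.
Qed.

End differences.

Section difference_bounds.
Variable R : realType.

Lemma is_derive_comp_addr (f : R -> R) (t a df : R) : is_derive (t + a) (1 : R) f df ->
  is_derive t (1 : R) (fun y => f (y + a)) df.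
Proof.
move=> d2; have d1 : is_derive t (1 : R) (fun y : R => y + a) (1 : R).
  by apply: is_derive_eq; rewrite addr0.
by have := @is_derive1_comp _ f (fun y => y + a) t _ _ d2 d1; rewrite mulr1.
Qed.

(** Mean value theorem, once per difference. The family [F] lists the successive
    derivatives, and [P] is the interval where the last one is controlled. *)
Lemma fdiff_bound (h B : R) m (F : nat -> R -> R) (P : R -> Prop) x :
  `|h| = 1 ->
  (forall k t, is_derive (t : R) (1 : R) (F k) (F k.+1 t)) ->
  (forall x y z, P x -> P y -> x <= z <= y -> P z) ->
  (forall y, P y -> `|F m y| <= B) -> P x -> P (x + h *+ m) ->
  `|iter m (fdiff h) (F 0%N) x| <= B.
Proof.
move=> h1; elim: m F P => [|m IH] F P dF cP FB Px Pxm; first exact: FB.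
rewrite iterSr.
pose G k := fdiff h (F k).
have dG k t : is_derive (t : R) (1 : R) (G k) (G k.+1 t).
  have d1 := dF k t; have d2 := dF k (t + h).
  have d3 : is_derive t (1 : R) (fun y : R => F k (y + h)) (F k.+1 (t + h)).
    exact: is_derive_comp_addr.
  exact: is_deriveB.
have Pk k : (k <= m.+1)%N -> P (x + h *+ k).
  move=> km; have k0 : 0 <= k%:R :> R by [].
  have [h0|h0] := leP 0 h.
    apply: (cP x (x + h *+ m.+1)) => //; move: h1; rewrite ger0_norm// => ->.
    by rewrite lerDl k0 lerD2l ler_nat.
  apply: (cP (x + h *+ m.+1) x) => //; move: h1; rewrite ltr0_norm// => /eqP.
  rewrite eqr_oppLR => /eqP ->.
  by rewrite gerDl lerD2l !mulNrn lerN2 ler_nat oppr_le0 k0 km.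
apply: (IH G (fun y => P y /\ P (y + h))) => //.
- move=> a b c [Pa Pah] [Pb Pbh] /andP[ac cb]; split; first by apply: (cP a b); rewrite ?ac.
  by apply: (cP _ _ _ Pah Pbh); rewrite !lerD2r ac.
- move=> y [Py Pyh]; rewrite /G /fdiff.
  have cF := is_derive_continuous (dF m).
  have [h0|h0] := leP 0 h.
    have yh : y <= y + h by rewrite lerDl.
    have [c] := @MVT_segment R (F m) (F m.+1) y (y + h) yh (fun x _ => dF m x) (continuous_subspaceT cF).
    rewrite in_itv /= => cr ->; rewrite addrAC subrr add0r normrM h1 mulr1.
    by apply: FB; exact: (cP _ _ _ Py Pyh).
  have yh : y + h <= y by rewrite gerDl ltW.
  have [c] := @MVT_segment R (F m) (F m.+1) (y + h) y yh (fun x _ => dF m x) (continuous_subspaceT cF).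
  rewrite in_itv /= distrC => cr ->; rewrite opprD addrA subrr add0r normrM normrN h1 mulr1.
  by apply: FB; exact: (cP _ _ _ Pyh Py).
- by split; [exact: Px|exact: Pk 1%N isT].
- by split; [exact: Pk|rewrite -addrA -mulrSr].
Qed.

(** Weights of the covariance of two [m]-th differences. *)
Definition diffw m (i j : nat) : R := (-1) ^+ (i + j) * 'C(m, i)%:R * 'C(m, j)%:R.

(** The double sum is an iterated difference of total order [2 m], taken [m] times
    forward and [m] times backward. *)
Lemma fdiff2_bound (B : R) m (F : nat -> R -> R) :
  (forall k t, is_derive (t : R) (1 : R) (F k) (F k.+1 t)) ->
  (forall t, `|t| <= m%:R -> `|F (m + m)%N t| <= B) ->
  `|\sum_(i < m.+1) \sum_(j < m.+1) diffw m i j * F 0%N (i%:R - j%:R)| <= B.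
Proof.
move=> dF FB.
have -> : \sum_(i < m.+1) \sum_(j < m.+1) diffw m i j * F 0%N (i%:R - j%:R) =
  iter m (fdiff (-1)) (iter m (fdiff 1) (F 0%N)) 0.
  rewrite iter_fdiff exchange_big /=; apply: eq_bigr => j _.
  rewrite iter_fdiff mulr_sumr; apply: eq_bigr => i _.
  rewrite !mulrA /diffw; congr (_ * F _ _); last by rewrite mulNrn add0r addrC.
  rewrite !exprD; have : (-1 : R) ^+ m * (-1) ^+ m = 1 by rewrite -exprD addnn -signr_odd odd_double.
  move: ((-1) ^+ m) ((-1) ^+ i) ((-1) ^+ j) => a b c a2.
  by transitivity ((a * a) * (b * c) * 'C(m, i)%:R * 'C(m, j)%:R); [rewrite a2 mul1r|ring].
have m0 : 0 <= m%:R :> R by [].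
pose G k := iter m (fdiff 1) (F k).
have dG k t : is_derive (t : R) (1 : R) (G k) (G k.+1 t).
  rewrite (_ : G k = fun x => \sum_(i < m.+1) (-1) ^+ (m + i) * 'C(m, i)%:R * F k (x + 1 *+ i)); last first.
    by apply/funext => x; rewrite /G iter_fdiff.
  rewrite /G iter_fdiff.
  rewrite (_ : (fun _ => _) = \sum_(i < m.+1) (fun x => (-1) ^+ (m + i) * 'C(m, i)%:R * F k (x + 1 *+ i))); last first.
    by apply/funext => x; rewrite fct_sumE.
  apply: is_derive_sum => i.
  have d2 := dF k (t + 1 *+ i).
  have d3 : is_derive t (1 : R) (fun y : R => F k (y + 1 *+ i)) (F k.+1 (t + 1 *+ i)).
    exact: is_derive_comp_addr.
  apply: is_derive_eq; rewrite /GRing.scale /=; ring.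
apply: (@fdiff_bound (-1) B m G (fun x => - m%:R <= x <= 0)) => //.
- by rewrite normrN1.
- by move=> x y z /andP[a _] /andP[_ b] /andP[c d]; rewrite (le_trans a c) (le_trans d b).
- move=> y /andP[y1 y2].
  apply: (@fdiff_bound 1 B m (fun k => F (k + m)%N) (fun x => - m%:R <= x <= m%:R)) => //.
  + by rewrite normr1.
  + by move=> x z t /andP[a _] /andP[_ b] /andP[c d]; rewrite (le_trans a c) (le_trans d b).
  + by move=> t; rewrite -ler_norml => /FB.
  + by rewrite y1 (le_trans y2).
  + by apply/andP; split; lra.
- by rewrite lexx andbT oppr_le0.
- by rewrite mulNrn add0r lexx oppr_le0 /=.
Qed.

(** The derivative of order [2 m] of the polynomial is zero. *)
Lemma diffw_poly0 m (p : {poly R}) : (size p <= m + m)%N ->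
  \sum_(i < m.+1) \sum_(j < m.+1) diffw m i j * p.[i%:R - j%:R] = 0.
Proof.
move=> pm; apply/eqP; rewrite -normr_le0.
apply: (@fdiff2_bound 0 m (fun k x => (p^`(k)).[x])).
  move=> k t; rewrite derivnS; exact: is_derive_poly.
move=> t _; rewrite (_ : p^`(m + m) = 0) ?horner0 ?normr0//.
exact: derivn_poly0.
Qed.

End difference_bounds.

(** * Differences of Gaussian kernels *)

Section gaussian_kernel.
Variable R : realType.

Lemma expR_ge_pow (x : R) n : 0 <= x -> x ^+ n <= n`!%:R * expR x.
Proof.
case: n => [|n] x0; first by rewrite expr0 mul1r -expR0 ler_expR.
have := expR_ge1Dxn n x0 => h.
have f0 : 0 < n.+1`!%:R :> R by rewrite ltr0n fact_gt0.
rewrite mulrC -ler_pdivrMr//; apply: le_trans h; by rewrite lerDr.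
Qed.

Lemma poly_gauss_bound (p : {poly R}) :
  exists2 C, 0 <= C & forall y, `|p.[y]| * expR (- (y ^+ 2 / 2)) <= C.
Proof.
exists (\sum_(i < size p) `|p`_i| * (i`!%:R * expR (1 / 2))).
  by apply: sumr_ge0 => i _; rewrite !mulr_ge0// expR_ge0.
move=> y; rewrite horner_coef.
apply: (le_trans (ler_wpM2r (expR_ge0 _) (ler_norm_sum _ _ _))).
rewrite mulr_suml; apply: ler_sum => i _.
rewrite normrM normrX -mulrA ler_wpM2l//.
apply: (le_trans (ler_wpM2r (expR_ge0 _) (expR_ge_pow i (normr_ge0 y)))).
rewrite -mulrA ler_wpM2l// -expRD ler_expR.
have : 0 <= (`|y| - 1) ^+ 2 by exact: sqr_ge0.
rewrite -[y ^+ 2]real_normK ?num_real//.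
move: (`|y|) => z; rewrite (_ : (z - 1) ^+ 2 = z ^+ 2 - 2 * z + 1); last by ring.
lra.
Qed.

(** The polynomials with [D^k (e^(-y^2)) = H_k e^(-y^2)]. *)
Fixpoint hermite k : {poly R} :=
  if k is k'.+1 then (hermite k')^`() - 2%:P * 'X * hermite k' else 1.

Definition gauss_deriv k (y : R) := (hermite k).[y] * expR (- y ^+ 2).

Lemma gauss_derivP k (y : R) : is_derive y (1 : R) (gauss_deriv k) (gauss_deriv k.+1 y).
Proof.
have h := is_derive_poly (hermite k) y.
rewrite /gauss_deriv; apply: is_derive_eq; rewrite /GRing.scale /=.
rewrite hornerD hornerN !hornerM hornerC hornerX; ring.
Qed.

Lemma is_derive_comp_affine (f : R -> R) (t c e df : R) : is_derive (c * t + e) (1 : R) f df ->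
  is_derive t (1 : R) (fun y => f (c * y + e)) (c * df).
Proof.
move=> d2; have d1 : is_derive t (1 : R) (fun y : R => c * y + e) c.
  by apply: is_derive_eq; rewrite /GRing.scale /= mulr1 addr0.
by have := @is_derive1_comp _ f (fun y => c * y + e) t _ _ d2 d1; rewrite mulrC.
Qed.

Lemma ler_norm_of_sqr (x y : R) : 0 <= y -> x ^+ 2 <= y ^+ 2 -> `|x| <= y.
Proof.
move=> y0; rewrite -[x ^+ 2]real_normK ?num_real//.
by rewrite ler_pXn2r ?nnegrE.
Qed.

(** Along a line, [|z + t g|^2 = A + 2 B t + G t^2]. The Gaussian kernel
    restricted to the line is a one-dimensional Gaussian, so that a difference of
    order [2 m] is governed by its derivative of order [2 m]. *)
Lemma gauss_diff2_bound m : exists2 C, 0 <= C & forall w A B G : R,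
  0 <= w -> 0 < G -> B ^+ 2 <= A * G -> 4 * m%:R ^+ 2 * G <= A ->
  `|\sum_(i < m.+1) \sum_(j < m.+1) diffw R m i j *
     expR (- (w * (A + 2 * B * (i%:R - j%:R) + G * (i%:R - j%:R) ^+ 2)))| <=
  C * (w * G) ^+ m * expR (- (w * A / 8)).
Proof.
have [C C0 HC] := poly_gauss_bound (hermite (m + m)).
exists C => // w A B G w0 G0 BAG GA.
(* complete the square in [t]: [w (A + 2 B t + G t^2) = rho + (c t + e)^2] *)
pose c := Num.sqrt (w * G); pose e := Num.sqrt w * B / Num.sqrt G.
pose rho := w * (A - B ^+ 2 / G).
have rho0 : 0 <= rho by rewrite mulr_ge0// subr_ge0 ler_pdivrMr.
have c2 : c ^+ 2 = w * G by rewrite sqr_sqrtr// mulr_ge0// ltW.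
have sq t : rho + (c * t + e) ^+ 2 = w * (A + 2 * B * t + G * t ^+ 2).
  rewrite sqrrD exprMn c2 /e expr_div_n exprMn !sqr_sqrtr ?(ltW G0)//.
  rewrite (_ : c * t * _ = w * B * t); last first.
    rewrite /c sqrtrM// -[w in RHS](sqr_sqrtr w0); field.
    by rewrite gt_eqF// sqrtr_gt0.
  by rewrite /rho; field; rewrite gt_eqF.
pose F k t := expR (- rho) * c ^+ k * gauss_deriv k (c * t + e).
have F0 t : F 0%N t = expR (- (w * (A + 2 * B * t + G * t ^+ 2))).
  by rewrite /F expr0 mulr1 /gauss_deriv hornerC mul1r -expRD -opprD sq.
under eq_bigr => i _ do under eq_bigr => j _ do rewrite -F0.
apply: fdiff2_bound.
  move=> k t; rewrite /F.
  have d := is_derive_comp_affine (gauss_derivP k (c * t + e)).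
  apply: is_derive_eq; rewrite /GRing.scale /= exprSr; ring.
move=> t tm; rewrite /F exprD -expr2 exprAC c2 /gauss_deriv.
set y := c * t + e.
(* the difference of two stencil points stays away from 0: this is where the
   hypothesis [4 m^2 G <= A] enters *)
have Q0 : A / 4 <= A + 2 * B * t + G * t ^+ 2.
  have t2 : t ^+ 2 <= m%:R ^+ 2.
    by rewrite -[t ^+ 2]real_normK ?num_real// lerXn2r ?nnegrE.
  have u1 : 4 * (G * t ^+ 2) <= A.
    by apply: le_trans GA; rewrite mulrCA mulrA [leRHS]mulrC [leRHS]mulrA [G * 4]mulrC ler_wpM2l// mulr_ge0// ltW.
  have u0 : 0 <= G * t ^+ 2 by rewrite mulr_ge0 ?sqr_ge0// ltW.
  have : `|2 * B * t| <= A / 2 + 2 * (G * t ^+ 2).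
    apply: ler_norm_of_sqr; first lra.
    rewrite (_ : (2 * B * t) ^+ 2 = 4 * t ^+ 2 * B ^+ 2); last by ring.
    apply: (@le_trans _ _ (4 * t ^+ 2 * (A * G))).
      by rewrite ler_wpM2l// mulr_ge0// sqr_ge0.
    rewrite -subr_ge0 (_ : _ - _ = (A / 2 - 2 * (G * t ^+ 2)) ^+ 2) ?sqr_ge0//.
    by field.
  by rewrite ler_norml => /andP[h _]; lra.
rewrite !normrM [ `|expR (- rho)|]ger0_norm ?expR_ge0//.
rewrite [ `|expR _|]ger0_norm ?expR_ge0// normrX [ `|w * G|]ger0_norm; last by rewrite mulr_ge0// ltW.
have h1 := HC y; have sy := sq t; rewrite -/y in sy.
have e1 : expR (- y ^+ 2) = expR (- (y ^+ 2 / 2)) * expR (- (y ^+ 2 / 2)).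
  by rewrite -expRD; congr expR; field.
rewrite e1 [ `|_.[y]| * _]mulrA.
rewrite (_ : expR (- rho) * _ * _ = (w * G) ^+ m * (`|(hermite (m + m)).[y]| * expR (- (y ^+ 2 / 2)) *
   (expR (- rho) * expR (- (y ^+ 2 / 2))))); last by ring.
rewrite [C * _]mulrC -[leRHS]mulrA; apply: ler_wpM2l.
  by rewrite exprn_ge0// mulr_ge0// ltW.
apply: ler_pM => //; rewrite ?mulr_ge0 ?expR_ge0//.
rewrite -expRD ler_expR.
have := ler_wpM2l w0 Q0; rewrite -sy; lra.
Qed.

End gaussian_kernel.

(** * The covariance as a mixture of Gaussian kernels *)

Section matern_mixture.
Variable R : realType.
Notation mu := (@lebesgue_measure R).
Local Opaque Gamma.

Lemma edecay_reflect (f : R -> R) : edecay f -> edecay (fun x => f (- x)).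
Proof.
move=> [cf [c [C [c0 C0 fC]]]]; split.
  by move=> x; apply: (@continuous_comp _ _ _ -%R f); [exact: opp_continuous|exact: cf].
by exists c, C; split => // x; rewrite -(normrN x).
Qed.

Lemma edecay_of_bound (f g : R -> R) (K : R) : edecay g -> continuous f ->
  (forall x, `|f x| <= K * g x) -> edecay f.
Proof.
move=> eg cf h; apply: (edecay_le cf eg (K := `|K|)) => x.
by apply: (le_trans (h x)); rewrite -normrM ler_norm.
Qed.

(** The mixing density [mixd nu 0], times the Gaussian kernel of scale [e^s], where
    [r] stands for a multiple of the squared distance. *)
Definition mixd (nu r s : R) := expR (- (nu * s) - expR (- s) - r * expR s).

Lemma mixd_derive nu r (s : R) : is_derive s (1 : R) (mixd nu r)
  ((- nu + expR (- s) - r * expR s) * mixd nu r s).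
Proof. by rewrite /mixd; apply: is_derive_eq; rewrite /GRing.scale /=; ring. Qed.

Lemma mixd_continuous nu r : continuous (mixd nu r).
Proof. exact: is_derive_continuous (mixd_derive nu r). Qed.

Lemma mixd_gumbel nu s : mixd nu 0 s = gumbel nu 1 (- s).
Proof. by rewrite /mixd /gumbel; congr expR; ring. Qed.

Lemma edecay_mixd nu r : 0 < nu -> 0 <= r -> edecay (mixd nu r).
Proof.
move=> nu0 r0; apply: (edecay_of_bound (edecay_reflect (edecay_gumbel nu0 ltr01)) (K := 1)).
  exact: mixd_continuous.
move=> s; rewrite mul1r ger0_norm ?expR_ge0// -mixd_gumbel ler_expR mul0r subr0.
by rewrite gerBl mulr_ge0// expR_ge0.
Qed.

(** Substituting [s |-> s + ln (2 / x)] in the Bessel integral makes the Matern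
    covariance a mixture of Gaussian kernels in its argument. *)
Lemma matern_mixture (sigma alpha nu t : R) : 0 < alpha -> 0 < nu -> 0 <= t ->
  matern sigma alpha nu t =
  sigma ^+ 2 / Gamma nu * \int[mu]_s mixd nu ((alpha * t) ^+ 2 / 4) s.
Proof.
move=> a0 nu0 t0; rewrite /matern; case: eqVneq => [->|tn0].
  rewrite mulr0 expr0n /= mul0r.
  under eq_Rintegral do rewrite mixd_gumbel.
  rewrite ge0_integral_reflect; last 2 first.
  - by move=> x; exact: gumbel_ge0.
  - by case: (edecay_gumbel nu0 ltr01).
  by rewrite -Gamma_gumbel// divfK// gt_eqF// Gamma_gt0.
have tp : 0 < t by rewrite lt_neqAle eq_sym tn0.
set x := alpha * t; have xp : 0 < x by rewrite mulr_gt0.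
pose g (s : R) := expR (- x * ((expR s + expR (- s)) / 2) - nu * s) / 2.
have dg (s : R) : is_derive s (1 : R) g ((- x * ((expR s - expR (- s)) / 2) - nu) * g s).
  by rewrite /g; apply: is_derive_eq; rewrite /GRing.scale /=; field.
have gE : besselK nu x = \int[mu]_s g s.
  rewrite /besselK /Rintegral ge0_integral_fold; last 2 first.
  - by move=> s; rewrite divr_ge0// expR_ge0.
  - exact: is_derive_continuous dg.
  congr fine; apply: eq_integral => s _; congr (_%:E).
  rewrite /g opprK [expR (- s) + expR s]addrC (_ : - (nu * - s) = nu * s); last by ring.
  by rewrite !expRD; field.
have gm s : g s = 2 `^ (nu - 1) / x `^ nu * mixd nu (x ^+ 2 / 4) (s + ln (2 / x)).
  have l2 : 0 < 2 / x by rewrite divr_gt0.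
  have h1 : expR (- (s + ln (2 / x))) = expR (- s) * (x / 2).
    by rewrite opprD expRD [expR (- ln _)]expRN lnK ?posrE// invf_div.
  have h2 : expR (s + ln (2 / x)) = expR s * (2 / x) by rewrite expRD lnK.
  have h3 : 2^-1 = expR (- ln 2) :> R by rewrite expRN lnK ?posrE.
  rewrite /g /mixd h1 h2 ln_div ?posrE// h3.
  rewrite /powR !gt_eqF// -!expRN -!expRD; congr expR.
  rewrite (_ : x ^+ 2 / 4 * (expR s * (2 / x)) = x * expR s / 2); last by field; rewrite gt_eqF.
  by rewrite -h3; field.
have em : edecay (mixd nu (x ^+ 2 / 4)).
  by apply: edecay_mixd => //; rewrite divr_ge0// sqr_ge0.
rewrite gE (funext gm) integral_edecayZ; last exact: edecay_translate.
rewrite integral_translate//.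
have := Gamma_gt0 nu0; move: (Gamma nu) (\int[mu]_s _) => G I G0.
by field; rewrite !gt_eqF// powR_gt0.
Qed.

Lemma mixdM nu r (s : R) : mixd nu r s = mixd nu 0 s * expR (- (r * expR s)).
Proof. by rewrite /mixd -expRD; congr expR; ring. Qed.

(** The mixture is linear in the kernel; [q] is the squared distance. *)
Lemma matern_diff2 (sigma alpha nu : R) m (q : nat -> nat -> R) :
  0 < alpha -> 0 < nu -> (forall i j, 0 <= q i j) ->
  \sum_(i < m.+1) \sum_(j < m.+1) diffw R m i j * matern sigma alpha nu (Num.sqrt (q i j)) =
  sigma ^+ 2 / Gamma nu * \int[mu]_s (mixd nu 0 s *
    \sum_(i < m.+1) \sum_(j < m.+1) diffw R m i j * expR (- (alpha ^+ 2 / 4 * expR s * q i j))).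
Proof.
move=> a0 nu0 q0.
have r0 i j : 0 <= alpha ^+ 2 / 4 * q i j by rewrite mulr_ge0// divr_ge0// sqr_ge0.
have eF i j : edecay (fun s => diffw R m i j * mixd nu (alpha ^+ 2 / 4 * q i j) s).
  by apply: edecayZ; exact: edecay_mixd.
transitivity (sigma ^+ 2 / Gamma nu * \int[mu]_s (\sum_(i < m.+1) \sum_(j < m.+1)
    diffw R m i j * mixd nu (alpha ^+ 2 / 4 * q i j) s)); last first.
  congr (_ * _); apply: eq_Rintegral => s _.
  rewrite mulr_sumr; apply: eq_bigr => i _; rewrite mulr_sumr; apply: eq_bigr => j _.
  by rewrite mixdM mulrCA; congr (_ * (_ * expR (- _))); ring.
rewrite integral_edecay_sum; last by move=> i; exact: edecay_sum.
rewrite mulr_sumr; apply: eq_bigr => i _.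
rewrite integral_edecay_sum//.
rewrite mulr_sumr; apply: eq_bigr => j _.
rewrite integral_edecayZ; last exact: edecay_mixd.
rewrite (matern_mixture sigma a0 nu0 (sqrtr_ge0 _)) exprMn (sqr_sqrtr (q0 _ _)) [alpha ^+ 2 * _ / 4]mulrAC.
by rewrite [RHS]mulrCA.
Qed.

(** Far from the diagonal, a covariance of [m]-th increments has the size of a
    derivative of order [2 m] of the kernel [A^nu]. The Gaussian bound at scale
    [w = e^s] integrates to a Gamma integral. *)
Lemma matern_diff2_bound (sigma alpha nu : R) m : 0 < alpha -> 0 < nu < m%:R ->
  exists2 C, 0 <= C & forall A B G : R,
  0 < G -> B ^+ 2 <= A * G -> 4 * m%:R ^+ 2 * G <= A ->
  `|\sum_(i < m.+1) \sum_(j < m.+1) diffw R m i j *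
     matern sigma alpha nu (Num.sqrt (A + 2 * B * (i%:R - j%:R) + G * (i%:R - j%:R) ^+ 2))| <=
  C * G ^+ m * A `^ (nu - m%:R).
Proof.
move=> a0 /andP[nu0 num].
have [C C0 HC] := gauss_diff2_bound R m.
have Gp := Gamma_gt0 nu0.
have mnu0 : 0 < m%:R - nu by rewrite subr_gt0.
have Gm := Gamma_gt0 mnu0.
pose b := alpha ^+ 2 / 4.
have b0 : 0 < b by rewrite divr_gt0// exprn_gt0.
exists (sigma ^+ 2 / Gamma nu * (C * b ^+ m * ((b / 8) `^ (nu - m%:R) * Gamma (m%:R - nu)))).
  have bm : 0 <= b ^+ m by rewrite exprn_ge0// ltW.
  exact: mulr_ge0 (divr_ge0 (sqr_ge0 _) (ltW Gp)) (mulr_ge0 (mulr_ge0 C0 bm) (mulr_ge0 (powR_ge0 _ _) (ltW Gm))).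
move=> A B G G0 BAG GA.
have m0 : 0 < m%:R :> R by rewrite (lt_trans nu0).
have A0 : 0 < A by apply: lt_le_trans GA; rewrite !mulr_gt0 ?exprn_gt0.
have q0 (i j : nat) : 0 <= A + 2 * B * (i%:R - j%:R) + G * (i%:R - j%:R) ^+ 2.
  move: (_ - _) => t.
  rewrite (_ : _ + _ = (A - B ^+ 2 / G) + (B + G * t) ^+ 2 / G); last by field; rewrite gt_eqF.
  by rewrite addr_ge0 ?divr_ge0 ?sqr_ge0 ?(ltW G0)// subr_ge0 ler_pdivrMr.
rewrite (matern_diff2 sigma m a0 nu0 q0).
have s0 : 0 <= sigma ^+ 2 / Gamma nu by exact: divr_ge0 (sqr_ge0 _) (ltW Gp).
rewrite normrM (ger0_norm s0) -[leRHS]mulrA -[leRHS]mulrA.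
apply: ler_wpM2l; first exact: s0.
clear Gp s0.
pose k := b * A / 8.
have k0 : 0 < k by rewrite divr_gt0// mulr_gt0.
pose f (s : R) := mixd nu 0 s *
    \sum_(i < m.+1) \sum_(j < m.+1) diffw R m i j * expR (- (alpha ^+ 2 / 4 * expR s * (A + 2 * B * (i%:R - j%:R) + G * (i%:R - j%:R) ^+ 2))).
have fE s : f s = \sum_(i < m.+1) \sum_(j < m.+1) diffw R m i j * mixd nu (alpha ^+ 2 / 4 * (A + 2 * B * (i%:R - j%:R) + G * (i%:R - j%:R) ^+ 2)) s.
  rewrite /f mulr_sumr; apply: eq_bigr => i _; rewrite mulr_sumr; apply: eq_bigr => j _.
  by rewrite [in RHS]mixdM mulrCA; congr (_ * (_ * expR (- _))); ring.
have ef : edecay f.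
  rewrite (funext fE); apply: edecay_sum => i; apply: edecay_sum => j.
  by apply: edecayZ; apply: edecay_mixd => //; rewrite mulr_ge0// ltW.
have fi := edecay_integrable ef.
rewrite -/f.
apply: (le_trans (le_normr_Rintegral measurableT fi)).
apply: (@le_trans _ _ (\int[mu]_s (C * (b * G) ^+ m * gumbel (m%:R - nu) k s))).
  apply: le_Rintegral => //.
  - exact: edecay_integrable (edecay_abs ef).
  - by apply: edecay_integrable; apply: edecayZ; exact: edecay_gumbel.
  move=> s _; rewrite /f normrM [ `|mixd _ _ _|]ger0_norm ?expR_ge0//.
  have w0 : 0 <= alpha ^+ 2 / 4 * expR s by rewrite mulr_ge0 ?expR_ge0// ltW.
  apply: (le_trans (ler_wpM2l (expR_ge0 _) (HC _ A B G w0 G0 BAG GA))).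
  rewrite -/b.
  rewrite (_ : (b * expR s * G) ^+ m = (b * G) ^+ m * expR (m%:R * s)); last first.
    by rewrite mulrAC exprMn expRM_natl.
  rewrite (_ : mixd nu 0 s * _ = C * (b * G) ^+ m * (mixd nu 0 s * (expR (m%:R * s) * expR (- (b * expR s * A / 8))))); last by ring.
  apply: ler_wpM2l; first by rewrite mulr_ge0// exprn_ge0// mulr_ge0// ltW.
  rewrite /mixd /gumbel -!expRD ler_expR /k.
  have := expR_ge0 (- s); lra.
rewrite integral_edecayZ; last exact: edecay_gumbel.
rewrite integral_gumbel// opprB exprMn /k.
rewrite (_ : b * A / 8 = b / 8 * A); last by rewrite mulrAC.
have b8 : 0 < b / 8 by rewrite divr_gt0.
rewrite (powRM _ (ltW b8) (ltW A0)).
by rewrite le_eqVlt; apply/orP; left; apply/eqP; ring.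
Qed.

End matern_mixture.

(** * Mellin integrals of exponential sums *)

Section exponential_sums.
Variables (R : realType) (I : finType) (c : I -> R) (k : I -> nat).
Notation mu := (@lebesgue_measure R).

(** [expsum l] is the derivative of order [l] of [w |-> \sum_p c p e^(- k p w)]. *)
Definition expsum l (w : R) := \sum_p c p * (- (k p)%:R) ^+ l * expR (- ((k p)%:R * w)).

Lemma expsum_derive l (w : R) : is_derive w (1 : R) (expsum l) (expsum l.+1 w).
Proof.
rewrite /expsum (_ : (fun _ => _) = \sum_p (fun w => c p * (- (k p)%:R) ^+ l * expR (- ((k p)%:R * w)))); last first.
  by apply/funext => x; rewrite fct_sumE.
rewrite -!big_enum /=.
elim: (enum I) => [|p r IH].
  by rewrite !big_nil; exact: is_derive_cst.
rewrite !big_cons; apply: is_deriveD.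
apply: is_derive_eq; rewrite /GRing.scale /= exprSr; ring.
Qed.

(** The vanishing moments, which for the weights of an [m]-th difference express
    that polynomials are annihilated, make the sum of order [w^m] at 0. *)
Variable m : nat.
Hypothesis moment0 : forall l, (l < m)%N -> \sum_p c p * (k p)%:R ^+ l = 0.

Lemma expsum_at0 l : (l < m)%N -> expsum l 0 = 0.
Proof.
move=> lm; transitivity ((-1) ^+ l * \sum_p c p * (k p)%:R ^+ l); last by rewrite moment0// mulr0.
rewrite mulr_sumr /expsum.
by apply: eq_bigr => p _; rewrite mulr0 oppr0 expR0 mulr1 exprNn; ring.
Qed.

Lemma expsum_le l w : 0 <= w -> `|expsum l w| <= \sum_p `|c p| * (k p)%:R ^+ l.
Proof.
move=> w0; apply: (le_trans (ler_norm_sum _ _ _)); apply: ler_sum => p _.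
rewrite !normrM normrX normrN (ger0_norm (expR_ge0 _)) [ `|_%:R|]ger0_norm//.
rewrite ler_piMr//.
by rewrite -expR0 ler_expR oppr_le0 mulr_ge0.
Qed.

(** Integrate the bound on the next derivative, from 0 where all of them vanish. *)
Lemma expsum_small j l : (j + l)%N = m -> exists2 C, 0 <= C & forall w, 0 <= w ->
  `|expsum l w| <= C * w ^+ j.
Proof.
elim: j l => [|j IH] l jl.
  exists (\sum_p `|c p| * (k p)%:R ^+ l).
    by apply: sumr_ge0 => p _; rewrite mulr_ge0// exprn_ge0.
  by move=> w w0; rewrite expr0 mulr1 expsum_le.
have [C C0 HC] := IH l.+1 ltac:(by rewrite -jl addnS).
exists C => // w w0.
have lm : (l < m)%N by rewrite -jl addSn ltnS leq_addl.
have [x] := @MVT_segment R _ _ 0 w w0 (fun x _ => expsum_derive l x)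
    (continuous_subspaceT (is_derive_continuous (expsum_derive l))).
rewrite in_itv /= => /andP[x0 xw]; rewrite expsum_at0// !subr0 => ->.
rewrite normrM (ger0_norm w0) exprSr mulrA ler_wpM2r//.
apply: (le_trans (HC x x0)); rewrite ler_wpM2l//.
by rewrite lerXn2r ?nnegrE.
Qed.

Lemma expsum_large l : (0 < l)%N -> forall w, 0 <= w ->
  `|expsum l w| <= (\sum_p `|c p| * (k p)%:R ^+ l) * expR (- w).
Proof.
move=> l0 w w0; apply: (le_trans (ler_norm_sum _ _ _)).
rewrite mulr_suml; apply: ler_sum => p _.
rewrite !normrM normrX normrN (ger0_norm (expR_ge0 _)) [ `|_%:R|]ger0_norm//.
have [k0|k0] := posnP (k p).
  by rewrite k0 expr0n gtn_eqF// !mulr0 !mul0r.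
rewrite ler_wpM2l ?mulr_ge0 ?exprn_ge0// ler_expR lerN2.
by rewrite ler_peMl// ler1n.
Qed.

Variable nu : R.
Hypotheses (nu0 : 0 < nu) (num : nu < m%:R).

(** With [w = e^s], its integral over [s] is that of [w^(l - nu - 1)] times the
    derivative of order [l]. *)
Definition mellin_int l (s : R) := expR (- ((nu - l%:R) * s)) * expsum l (expR s).

Lemma mellin_int_derive l (s : R) : is_derive s (1 : R) (mellin_int l)
  (- (nu - l%:R) * mellin_int l s + mellin_int l.+1 s).
Proof.
have d1 := expsum_derive l (expR s).
have d2 := @is_derive1_comp _ (expsum l) expR s _ _ d1 (is_derive_expR s).
rewrite /mellin_int; apply: is_derive_eq; rewrite /GRing.scale /=.
rewrite (_ : - ((nu - l.+1%:R) * s) = - ((nu - l%:R) * s) + s); last first.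
  by rewrite -natr1; ring.
rewrite expRD; ring.
Qed.

Lemma mellin_int_continuous l : continuous (mellin_int l).
Proof. exact: is_derive_continuous (mellin_int_derive l). Qed.

Lemma edecay_mellin_int l : (l <= m)%N -> edecay (mellin_int l).
Proof.
move=> lm; split; first exact: mellin_int_continuous.
pose d := Num.min nu (m%:R - nu).
have d0 : 0 < d by rewrite lt_min nu0 subr_gt0.
have [C C0 HC] := expsum_small (subnK lm).
pose S := \sum_p `|c p| * (k p)%:R ^+ l.
have S0 : 0 <= S by apply: sumr_ge0 => p _; rewrite mulr_ge0// exprn_ge0.
exists d, (C + S * l`!%:R); split => //; first by rewrite addr_ge0// mulr_ge0.
move=> s; rewrite /mellin_int normrM (ger0_norm (expR_ge0 _)).
have [s0|s0] := leP 0 s; last first.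
  apply: (le_trans (ler_wpM2l (expR_ge0 _) (HC _ (expR_ge0 s)))).
  rewrite mulrCA -expRM_natl -expRD; apply: ler_pM => //; rewrite ?expR_ge0//.
    by rewrite lerDl mulr_ge0.
  rewrite ler_expR natrB// ltr0_norm//.
  have : d <= m%:R - nu by rewrite ge_min lexx orbT.
  move=> h; have : 0 <= - s * ((m%:R - nu) - d) by rewrite mulr_ge0 ?subr_ge0// oppr_ge0 ltW.
  lra.
have h : expR (- ((nu - l%:R) * s)) * `|expsum l (expR s)| <= S * l`!%:R * expR (- (nu * s)).
  have -> : - ((nu - l%:R) * s) = - (nu * s) + l%:R * s by ring.
  rewrite expRD [S * _ * _]mulrC -mulrA ler_wpM2l ?expR_ge0//.
  have S1 := expsum_le l (expR_ge0 s).
  have S2 := fun l0 : (0 < l)%N => expsum_large l0 (expR_ge0 s).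
  have [l0|l0] := posnP l.
    by move: S1; rewrite -/S l0 mul0r expR0 mul1r fact0 mulr1.
  apply: (le_trans (ler_wpM2l (expR_ge0 _) (S2 l0))); rewrite -/S.
  rewrite mulrCA ler_wpM2l// expRN expRM_natl ler_pdivrMr ?expR_gt0//.
  exact: expR_ge_pow (expR_ge0 s).
apply: (le_trans h); apply: ler_pM; rewrite ?expR_ge0 ?mulr_ge0//.
  by rewrite lerDr.
rewrite ler_expR ger0_norm// mulNr lerN2 ler_wpM2r//.
by rewrite ge_min lexx.
Qed.

(** Integration by parts. *)
Lemma mellin_int_rec l : (l < m)%N ->
  (nu - l%:R) * \int[mu]_s mellin_int l s = \int[mu]_s mellin_int l.+1 s.
Proof.
move=> lm.
have e1 := edecay_mellin_int (ltnW lm); have e2 := edecay_mellin_int lm.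
have e3 := edecayZ (- (nu - l%:R)) e1.
have := integral_derivative_edecay (mellin_int_derive l) e1 (edecayD e3 e2).
rewrite integral_edecayD// integral_edecayZ//.
by move/eqP; rewrite mulNr addrC subr_eq0 => /eqP ->.
Qed.

Lemma mellin_int_prod l : (l <= m)%N ->
  (\prod_(i < l) (nu - i%:R)) * \int[mu]_s mellin_int 0 s = \int[mu]_s mellin_int l s.
Proof.
elim: l => [|l IH] lm; first by rewrite big_ord0 mul1r.
rewrite big_ord_recr /= mulrAC IH; last exact: ltnW.
by rewrite mulrC mellin_int_rec.
Qed.

(** At order [m] the integral converges term by term. *)
Lemma mellin_int_top : \int[mu]_s mellin_int m s =
  (-1) ^+ m * Gamma (m%:R - nu) * \sum_p c p * (k p)%:R `^ nu.
Proof.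
have m0 : (0 < m)%N by rewrite -(ltr_nat R) (lt_trans nu0).
have mnu : 0 < m%:R - nu by rewrite subr_gt0.
have term p : edecay (fun s => c p * (- (k p)%:R) ^+ m * gumbel (m%:R - nu) (k p)%:R s) /\
  \int[mu]_s (c p * (- (k p)%:R) ^+ m * gumbel (m%:R - nu) (k p)%:R s) =
  (-1) ^+ m * Gamma (m%:R - nu) * (c p * (k p)%:R `^ nu).
  have [k0|k0] := posnP (k p).
    rewrite k0 oppr0 expr0n gtn_eqF//= mulr0; split.
      by under eq_fun do rewrite mul0r; exact: edecay0.
    under eq_Rintegral do rewrite mul0r.
    by rewrite Rintegral_cst// mul0r powR0 ?gt_eqF// !mulr0.
  have kp : 0 < (k p)%:R :> R by rewrite ltr0n.
  split; first by apply: edecayZ; exact: edecay_gumbel.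
  rewrite integral_edecayZ; last exact: edecay_gumbel.
  rewrite integral_gumbel// opprB exprNn -[(k p)%:R ^+ m](powR_mulrn _ (ltW kp)).
  have -> : (k p)%:R `^ nu = (k p)%:R `^ m%:R * (k p)%:R `^ (nu - m%:R).
    by rewrite -powRD; [congr (_ `^ _); ring|rewrite pnatr_eq0 gtn_eqF// implybT].
  by move: (Gamma _) => G; ring.
transitivity (\int[mu]_s (\sum_p c p * (- (k p)%:R) ^+ m * gumbel (m%:R - nu) (k p)%:R s)).
  apply: eq_Rintegral => s _; rewrite /mellin_int /expsum mulr_sumr; apply: eq_bigr => p _.
  rewrite /gumbel mulrCA -expRD; congr (_ * expR _); ring.
rewrite integral_edecay_sum; last by move=> p; have [] := term p.
by rewrite mulr_sumr; apply: eq_bigr => p _; have [_ ->] := term p.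
Qed.

(** Solve [mellin_int_prod] at [l = m] for the integral and use the reflection
    formula; the product on the left is nonzero because [nu] is not an integer. *)
Lemma mellin_noninteger : nu \isn't a Num.int ->
  (\int[mu]_s mellin_int 0 s) * (sin (nu * pi) * Gamma (nu + 1)) =
  - pi * \sum_p c p * (k p)%:R `^ nu.
Proof.
move=> nuI.
have h := mellin_int_prod (leqnn m); rewrite mellin_int_top in h.
have := @Gamma_reflection_shift R nu m; rewrite nu0 num => /(_ isT nuI).
have -> : \prod_(i < m) (i%:R - nu) = (-1) ^+ m * \prod_(i < m) (nu - i%:R).
  rewrite (_ : (-1) ^+ m = \prod_(i < m) (-1)); last by rewrite prodr_const card_ord.
  by rewrite -big_split /=; apply: eq_bigr => i _; rewrite mulN1r opprB.
have p0 : \prod_(i < m) (nu - i%:R) != 0.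
  apply/prodf_neq0 => i _; rewrite subr_eq0; apply: contra nuI => /eqP ->.
  exact: rpred_nat.
move: h p0; move: (Gamma _) (Gamma _) (\prod_(i < m) _) (sin _) (\int[mu]_s _) (\sum_p _) => G1 G2 P S J Q h P0 h2.
apply: (mulfI P0).
rewrite mulrA h.
have := congr1 (fun x => (-1) ^+ m * x * Q) h2.
have s2 : (-1) ^+ m * (-1) ^+ m = 1 :> R by rewrite -exprD addnn -signr_odd odd_double.
move: ((-1) ^+ m) s2 (@pi R) => a a2 q h3.
transitivity (a * (G2 * S * G1) * Q); first by ring.
rewrite h3; transitivity ((a * a) * (P * (- q * Q))); first by ring.
by rewrite a2 mul1r.
Qed.

(** At [l = r] the exponential factor disappears, so that one more integration by
    parts, against the primitive [s], makes the integral converge term by term.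
    The factor [s] produces the logarithm of the rates; the remaining constants
    cancel by the vanishing moment of order [r]. *)
Lemma mellin_integer r : nu = r%:R ->
  (\int[mu]_s mellin_int 0 s) * r`!%:R =
  (-1) ^+ r.+1 * \sum_p c p * (k p)%:R ^+ r * ln (k p)%:R.
Proof.
move=> nur.
have rm : (r < m)%N by rewrite -(ltr_nat R) -nur.
have r0 : (0 < r)%N by rewrite -(ltr_nat R) -nur.
have -> : r`!%:R = \prod_(i < r) (nu - i%:R).
  rewrite nur fact_prod big_add1 /= big_mkord (reindex_inj rev_ord_inj) /= natr_prod.
  apply: eq_bigr => i _; rewrite subnSK// natrB//.
  by rewrite ltnW.
rewrite mulrC mellin_int_prod; last exact: ltnW.
have er := edecay_mellin_int (ltnW rm).
have er1 := edecay_mellin_int rm.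
have dH (s : R) : is_derive s (1 : R) (fun s => s * mellin_int r s)
    (mellin_int r s + s * mellin_int r.+1 s).
  have d := mellin_int_derive r s.
  apply: is_derive_eq; rewrite /GRing.scale /= nur subrr; ring.
have := integral_derivative_edecay dH (edecay_mulX er) (edecayD er (edecay_mulX er1)).
rewrite integral_edecayD//; last exact: edecay_mulX.
move/eqP; rewrite addr_eq0 => /eqP ->.
pose g0 := \int[mu]_s (s * gumbel 1 1 s).
have e11 := edecay_gumbel (@ltr01 R) (@ltr01 R).
have term p : edecay (fun s => c p * (- (k p)%:R) ^+ r.+1 * (s * gumbel 1 (k p)%:R s)) /\
  \int[mu]_s (c p * (- (k p)%:R) ^+ r.+1 * (s * gumbel 1 (k p)%:R s)) =
  - ((-1) ^+ r * (c p * (k p)%:R ^+ r) * g0) + (-1) ^+ r * (c p * (k p)%:R ^+ r * ln (k p)%:R).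
  have [k0|k0] := posnP (k p).
    rewrite k0 oppr0 !expr0n gtn_eqF//= !(mulr0,mul0r); split.
      by under eq_fun do rewrite mul0r; exact: edecay0.
    under eq_Rintegral do rewrite mul0r.
    by rewrite Rintegral_cst// gtn_eqF//= !(mulr0, mul0r) oppr0 addr0.
  have kp : 0 < (k p)%:R :> R by rewrite ltr0n.
  have eg := edecay_mulX (edecay_gumbel ltr01 kp).
  split; first exact: edecayZ.
  rewrite integral_edecayZ// -(integral_translate (- ln (k p)%:R) eg).
  rewrite (_ : \int[mu]_s _ = \int[mu]_s ((k p)%:R^-1 * (s * gumbel 1 1 s) + (- ln (k p)%:R / (k p)%:R) * gumbel 1 1 s)); last first.
    apply: eq_Rintegral => s _.
    have -> : gumbel 1 (k p)%:R (s - ln (k p)%:R) = (k p)%:R^-1 * gumbel 1 1 s.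
      rewrite /gumbel [expR (s - _)]expRD expRN lnK ?posrE// mulrCA divff ?gt_eqF// mulr1.
      by rewrite !mul1r addrAC expRD expRN lnK ?posrE// mulrC.
    by ring.
  rewrite integral_edecayD; [|by apply: edecayZ; exact: edecay_mulX|exact: edecayZ].
  rewrite !integral_edecayZ//; last exact: edecay_mulX.
  rewrite -Gamma_gumbel// Gamma1 -/g0 exprNn !exprS.
  by field; rewrite gt_eqF.
have -> : \int[mu]_s (s * mellin_int r.+1 s) =
    \int[mu]_s (\sum_p c p * (- (k p)%:R) ^+ r.+1 * (s * gumbel 1 (k p)%:R s)).
  apply: eq_Rintegral => s _; rewrite /mellin_int /expsum !mulr_sumr; apply: eq_bigr => p _.
  have -> : gumbel 1 (k p)%:R s = expR (- ((nu - r.+1%:R) * s)) * expR (- ((k p)%:R * expR s)).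
    by rewrite /gumbel -expRD nur -natr1; congr expR; ring.
  ring.
rewrite integral_edecay_sum; last by move=> p; have [] := term p.
under eq_bigr => p _ do rewrite (term p).2.
rewrite big_split /= sumrN -mulr_suml -mulr_sumr moment0// mulr0 mul0r oppr0 add0r.
by rewrite exprS mulN1r mulNr -mulr_sumr.
Qed.

Lemma mellin_int_cvg (kappa : nat -> R) : (forall n, 0 <= kappa n) ->
  kappa n @[n --> \oo] --> (0 : R) ->
  (\int[mu]_s (expR (- (kappa n * expR (- s))) * mellin_int 0 s)) @[n --> \oo] -->
  \int[mu]_s mellin_int 0 s.
Proof.
move=> k0 kc.
have e0 := edecay_mellin_int (leq0n m).
apply: (edecay_dominated_cvg (g := fun s => `|mellin_int 0 s|)).
- move=> n.
  have dE (s : R) : is_derive s (1 : R) (fun s => expR (- (kappa n * expR (- s)))) (kappa n * expR (- s) * expR (- (kappa n * expR (- s)))).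
    by apply: is_derive_eq; rewrite /GRing.scale /=; ring.
  move=> s; apply: cvgM; first exact: (is_derive_continuous dE).
  exact: mellin_int_continuous.
- exact: mellin_int_continuous.
- exact: edecay_abs.
- move=> n s; rewrite normrM ger0_norm ?expR_ge0// ler_piMl//.
  by rewrite -expR0 ler_expR oppr_le0 mulr_ge0// expR_ge0.
move=> s; rewrite -[X in _ --> X]mul1r; apply: cvgM; last exact: cvg_cst.
rewrite -expR0 -oppr0 -(mul0r (expR (- s))).
apply: (cvg_comp (fun n => - (kappa n * expR (- s))) expR); last exact: continuous_expR.
by apply: cvgN; apply: cvgM; [exact: kc|exact: cvg_cst].
Qed.

End exponential_sums.

(** * The limit of the increment variance *)

Section variance_limit.
Variables (R : realType) (m : nat).
Notation mu := (@lebesgue_measure R).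
Local Opaque Gamma.

(** Squared distance as a natural number, so that it can be a rate of an
    exponential sum. *)
Definition sqdist (i j : nat) : nat := (((i - j) + (j - i)) ^ 2)%N.

Lemma distnR (i j : nat) : ((i - j) + (j - i))%N%:R = `|i%:R - j%:R| :> R.
Proof.
have [ij|ij] := leqP i j.
  rewrite (eqP ij) add0n natrB// distrC ger0_norm// subr_ge0 ler_nat//.
have ji := ltnW ij.
by rewrite (eqP ji) addn0 natrB// ger0_norm// subr_ge0 ler_nat.
Qed.

Lemma sqdistE (i j : nat) : (sqdist i j)%:R = (i%:R - j%:R) ^+ 2 :> R.
Proof. by rewrite /sqdist natrX distnR real_normK// num_real. Qed.

Let c (p : 'I_m.+1 * 'I_m.+1) := diffw R m p.1 p.2.
Let k (p : 'I_m.+1 * 'I_m.+1) := sqdist p.1 p.2.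

Let moment0 l : (l < m)%N -> \sum_p c p * (k p)%:R ^+ l = 0.
Proof.
move=> lm.
have sz : (size ('X^(2 * l) : {poly R})%R <= m + m)%N by rewrite size_polyXn addnn mul2n ltn_double.
rewrite -[RHS](diffw_poly0 sz) pair_bigA /=; apply: eq_bigr => p _.
by rewrite hornerXn /c /k sqdistE exprM.
Qed.

Variable nu : R.
Hypotheses (nu0 : 0 < nu) (num : nu < m%:R).

(** The two branches of the principal irregular term are the two evaluations of
    the Mellin integral. *)
Lemma irregular_sum :
  4 `^ (- nu) / Gamma nu * \int[mu]_s mellin_int c k nu 0 s =
  \sum_(i < m.+1) \sum_(j < m.+1)
      (-1) ^+ (i + j) * 'C(m, i)%:R * 'C(m, j)%:R * irregular_term nu `|i%:R - j%:R|.
Proof.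
have Gp := Gamma_gt0 nu0.
have nu10 : 0 < nu + 1 by rewrite addr_gt0.
have G1p := Gamma_gt0 nu10.
have four : 4 `^ nu = 2 `^ (2 * nu) :> R.
  by rewrite powRrM; congr (_ `^ _); rewrite powR_mulrn// -natrX.
rewrite powRN four pair_bigA /=.
have p2 : 0 < 2 `^ (2 * nu) :> R by rewrite powR_gt0.
have sq (i j : nat) : 0 < `|i%:R - j%:R| :> R ->
   (sqdist i j)%:R `^ nu = `|i%:R - j%:R| `^ (2 * nu) :> R.
  by move=> t0; rewrite sqdistE -real_normK ?num_real// -powR_mulrn// -powRrM.
case: (boolP (nu \is a Num.int)) => nuI.
  have nuN : nu \is a Num.nat by rewrite natrEint nuI ltW.
  have [r nur] := natrP nuN.
  have h := mellin_integer moment0 nu0 num nur.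
  have G1r : Gamma (nu + 1) = r`!%:R by rewrite nur natr1 Gamma_nat.
  have -> : \int[mu]_s mellin_int c k nu 0 s = (-1) ^+ r.+1 / Gamma (nu + 1) *
      \sum_p c p * (k p)%:R ^+ r * ln (k p)%:R.
    by rewrite G1r mulrAC -h -mulrA divff ?mulr1// pnatr_eq0 -lt0n fact_gt0.
  rewrite !mulr_sumr; apply: eq_bigr => p _.
  rewrite /irregular_term nuI normr_gt0 /c /diffw.
  case: eqP => [e|/eqP e] /=.
    by rewrite /k sqdistE e expr0n /= ln0// !mulr0.
  have t0 : 0 < `|p.1%:R - p.2%:R| :> R by rewrite normr_gt0.
  rewrite -powR_mulrn// -nur sq//.
  have -> : ln (k p)%:R = 2 * ln `|p.1%:R - p.2%:R| :> R.
    by rewrite /k sqdistE -real_normK ?num_real// expr2 lnM ?posrE// mulr2n mulrDl mul1r.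
  have -> : (-1) ^ (Num.floor nu + 1) = (-1) ^+ r.+1 :> R.
    by rewrite nur (_ : r%:R = r%:~R)// intrKfloor -PoszD addn1.
  have -> : 2 `^ (2 * nu - 1) = 2 `^ (2 * nu) / 2 :> R.
    by rewrite powRB ?powRr1// pnatr_eq0 implybT.
  move: Gp G1p p2; move: (Gamma nu) (Gamma (nu + 1)) (2 `^ (2 * nu)) => g0 g1 b g00 g10 b0.
  by field; rewrite !gt_eqF.
have h := mellin_noninteger moment0 nu0 num nuI.
have s0 : sin (nu * pi) != 0.
  apply/eqP => s0.
  have := @Gamma_reflection_shift R nu m; rewrite nu0 num s0 => /(_ isT nuI).
  rewrite mulr0 mul0r => /esym/eqP; rewrite mulf_eq0 oppr_eq0 gt_eqF ?pi_gt0//=.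
  apply/negP/prodf_neq0 => i _; rewrite subr_eq0; apply: contra nuI => /eqP <-.
  exact: rpred_nat.
have -> : \int[mu]_s mellin_int c k nu 0 s = - pi / (sin (nu * pi) * Gamma (nu + 1)) *
      \sum_p c p * (k p)%:R `^ nu.
  rewrite mulrAC -h -mulrA divff ?mulr1//.
  by rewrite mulf_neq0// gt_eqF.
rewrite !mulr_sumr; apply: eq_bigr => p _.
rewrite /irregular_term (negbTE nuI) normr_gt0 /c /diffw.
case: eqP => [e|/eqP e] /=.
  by rewrite /k sqdistE e expr0n /= powR0 ?gt_eqF// !mulr0.
have t0 : 0 < `|p.1%:R - p.2%:R| :> R by rewrite normr_gt0.
rewrite sq//.
move: Gp G1p p2 s0; move: (Gamma nu) (Gamma (nu + 1)) (2 `^ (2 * nu)) (sin (nu * pi)) => g0 g1 b x g00 g10 b0 x0.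
move: (@pi R) => q.
by field; rewrite x0 !gt_eqF.
Qed.

(** Translating [s] by [ln kappa] pulls the factor [kappa^nu] out of the variance
    of an increment at squared scale [kappa]. *)
Lemma matern_diff2_scaling (sigma alpha G : R) : 0 < alpha -> 0 < G ->
  \sum_(i < m.+1) \sum_(j < m.+1) diffw R m i j *
     matern sigma alpha nu (Num.sqrt (G * (i%:R - j%:R) ^+ 2)) =
  sigma ^+ 2 / Gamma nu * (alpha ^+ 2 / 4 * G) `^ nu *
  \int[mu]_s (expR (- (alpha ^+ 2 / 4 * G * expR (- s))) * mellin_int c k nu 0 s).
Proof.
move=> a0 G0.
rewrite (matern_diff2 sigma m a0 nu0 (q := fun i j => G * (i%:R - j%:R) ^+ 2)); last first.
  by move=> i j; rewrite mulr_ge0 ?sqr_ge0// ltW.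
rewrite -[RHS]mulrA; congr (_ * _).
pose kap := alpha ^+ 2 / 4 * G; rewrite -/kap.
have kap0 : 0 < kap by rewrite !mulr_gt0// ?exprn_gt0// invr_gt0.
have e0 := edecay_mellin_int moment0 nu0 num (leq0n m).
pose g s := expR (- (kap * expR (- s))) * mellin_int c k nu 0 s.
have dE (s : R) : is_derive s (1 : R) (fun s => expR (- (kap * expR (- s)))) (kap * expR (- s) * expR (- (kap * expR (- s)))).
  by apply: is_derive_eq; rewrite /GRing.scale /=; ring.
have eg : edecay g.
  apply: (edecay_le (K := 1) _ e0).
    move=> s; apply: cvgM; first exact: (is_derive_continuous dE).
    exact: mellin_int_continuous.
  move=> s; rewrite /g normrM ger0_norm ?expR_ge0// ler_wpM2r//.
  by rewrite -expR0 ler_expR oppr_le0 mulr_ge0 ?expR_ge0// ltW.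
transitivity (\int[mu]_s (kap `^ nu * g (s + ln kap))); last first.
  rewrite integral_edecayZ; last exact: edecay_translate.
  by rewrite integral_translate.
apply: eq_Rintegral => s _.
have x1 : kap * expR (- (s + ln kap)) = expR (- s).
  by rewrite opprD expRD [expR (- ln _)]expRN lnK ?posrE// mulrCA divff ?gt_eqF// mulr1.
have x2 : expR (s + ln kap) = expR s * kap by rewrite expRD lnK.
have x3 : kap `^ nu * expR (- ((nu - 0%:R) * (s + ln kap))) = expR (- (nu * s)).
  by rewrite /powR gt_eqF// -expRD; congr expR; ring.
rewrite /g /mellin_int x1 x2.
rewrite [RHS](_ : _ = (kap `^ nu * expR (- ((nu - 0%:R) * (s + ln kap)))) *
  expR (- expR (- s)) * expsum c k 0 (expR s * kap)); last by ring.
rewrite x3 -expRD; congr (_ * _); first by rewrite /mixd; congr expR; ring.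
rewrite /expsum pair_bigA /=; apply: eq_bigr => p _.
rewrite expr0 mulr1 /c /k sqdistE; congr (_ * expR (- _)); rewrite /kap; ring.
Qed.

(** By the scaling identity only the factor [e^(-kappa e^(-s))] depends on [n]; it
    tends to 1 boundedly. *)
Lemma matern_diff2_cvg (sigma alpha G : R) : 0 < alpha -> 0 < G ->
  (n%:R `^ (2 * nu) * \sum_(i < m.+1) \sum_(j < m.+1) diffw R m i j *
     matern sigma alpha nu (Num.sqrt (G / n%:R ^+ 2 * (i%:R - j%:R) ^+ 2))) @[n --> \oo] -->
  sigma ^+ 2 * alpha `^ (2 * nu) * Num.sqrt G `^ (2 * nu) *
  \sum_(i < m.+1) \sum_(j < m.+1)
      (-1) ^+ (i + j) * 'C(m, i)%:R * 'C(m, j)%:R * irregular_term nu `|i%:R - j%:R|.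
Proof.
move=> a0 G0; rewrite -irregular_sum.
pose kap n := alpha ^+ 2 / 4 * (G / n%:R ^+ 2).
have kap0 n : 0 <= kap n.
  by rewrite mulr_ge0 ?divr_ge0 ?sqr_ge0// ltW.
have kapc : kap n @[n --> \oo] --> (0 : R).
  rewrite -(mulr0 (alpha ^+ 2 / 4)); apply: cvgMr.
  rewrite -(mulr0 G); apply: cvgMr.
  have h := @cvg_harmonic R.
  have h2 : n%:R^-1 @[n --> \oo] --> (0 : R) by rewrite -(cvg_shiftS (fun n => n%:R^-1 : R)).
  rewrite -(mulr0 0); under eq_fun do rewrite -exprVn expr2.
  by apply: cvgM.
have Jc := mellin_int_cvg moment0 nu0 num kap0 kapc.
have a2 : alpha `^ (2 * nu) = (alpha ^+ 2) `^ nu by rewrite powRrM powR_mulrn// ltW.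
have g2 : Num.sqrt G `^ (2 * nu) = G `^ nu.
  by rewrite powRrM powR_mulrn ?sqrtr_ge0// sqr_sqrtr// ltW.
rewrite a2 g2.
rewrite (_ : _ * (4 `^ (- nu) / Gamma nu * _) = (sigma ^+ 2 / Gamma nu * ((alpha ^+ 2) `^ nu * 4 `^ (- nu) * G `^ nu)) * \int[mu]_s mellin_int c k nu 0 s); last first.
  move: (Gamma nu) (\int[mu]_s _) => x y; ring.
set K := sigma ^+ 2 / Gamma nu * _.
have JK : K * (\int[mu]_s (expR (- (kap n * expR (- s))) * mellin_int c k nu 0 s)) @[n --> \oo] -->
    K * \int[mu]_s mellin_int c k nu 0 s by apply: cvgMr.
apply: cvg_trans JK; rewrite /K.
apply: near_eq_cvg; exists 1%N => // n /= n0.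
have np : 0 < n%:R :> R by rewrite ltr0n.
rewrite matern_diff2_scaling ?divr_gt0 ?exprn_gt0//.
apply/esym; rewrite [X in X = _]mulrA; congr (_ * _).
rewrite [X in X = _]mulrCA; congr (_ * _).
have q4 : 4 `^ (- nu) = 4^-1 `^ nu :> R.
  by rewrite -[4^-1]powR_inv1// -powRrM mulN1r.
have a20 : 0 <= alpha ^+ 2 by exact: sqr_ge0.
have q0 : 0 <= 4^-1 :> R by [].
have aq : 0 <= alpha ^+ 2 * 4^-1 by rewrite mulr_ge0.
have n2 : 0 <= n%:R ^+ 2 :> R by exact: sqr_ge0.
rewrite q4 -(powRM _ a20 q0) -(powRM _ aq (ltW G0)).
have -> : n%:R `^ (2 * nu) = (n%:R ^+ 2) `^ nu :> R by rewrite powRrM powR_mulrn.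
rewrite -(powRM _ n2 (kap0 n)); congr (_ `^ _).
by rewrite /kap; field; rewrite gt_eqF.
Qed.

End variance_limit.

(** * Moments of centred normal variables *)

Section univariate_gaussian.
Variables (R : realType) (disp : measure_display) (T : measurableType disp).
Variable P : probability T R.
Notation mu := (@lebesgue_measure R).

Lemma ge0_integral_normal (a s : R) (f : R -> \bar R) : s != 0 ->
  measurable_fun setT f -> (forall x, 0 <= f x)%E ->
  (\int[normal_prob a s]_x f x = \int[mu]_x (f x * (normal_pdf a s x)%:E))%E.
Proof.
move=> s0 mf f0.
have dom := normal_prob_dominates a s.
rewrite -(Radon_Nikodym_SigmaFinite.change_of_variables dom)//.
have mpdf : measurable_fun setT (fun x => (normal_pdf a s x)%:E).
  by apply/measurable_EFinP; exact: measurable_normal_pdf.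
apply: ae_eq_integral => //.
- apply: emeasurable_funM => //.
  exact: measurable_int (Radon_Nikodym_SigmaFinite.f_integrable _).
- exact: emeasurable_funM.
- apply: ae_eqe_mul2l; apply: integral_ae_eq => //.
  + exact: Radon_Nikodym_SigmaFinite.f_integrable.
  + by move=> A _ mA; rewrite -Radon_Nikodym_SigmaFinite.f_integral.
Qed.

Lemma ge0_integral_law (X : T -> measurableTypeR R) (nuX : {measure set (measurableTypeR R) -> \bar R}) (f : measurableTypeR R -> \bar R) :
  measurable_fun setT X -> (forall A, measurable A -> pushforward P X A = nuX A) ->
  measurable_fun setT f -> (forall x, 0 <= f x)%E ->
  (\int[P]_w f (X w) = \int[nuX]_x f x)%E.
Proof.
move=> mX XP mf f0.
pose X' : {mfun T >-> measurableTypeR R} := HB.pack X (isMeasurableFun.Build _ _ _ _ _ mX).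
transitivity (\int[pushforward P X']_x f x)%E.
  by rewrite (ge0_integral_pushforward mX).
by apply: eq_measure_integral => A mA _; exact: XP.
Qed.

(** The nonnegative case is applied to [|g|] and to [|g| + g]. *)
Lemma normal_moment (X : T -> R) (a s : R) (g : R -> R) : s != 0 ->
  measurable_fun setT X ->
  (forall A, measurable A -> pushforward P X A = normal_prob a s A) ->
  continuous g -> edecay (fun x => g x * normal_pdf a s x) ->
  P.-integrable setT (EFin \o (g \o X)) /\
  \int[P]_w g (X w) = \int[mu]_x (g x * normal_pdf a s x).
Proof.
move=> s0 mX XP cg eg.
have pdf0 := normal_pdf_ge0 a s.
have h (f : R -> R) : measurable_fun setT f -> (forall x, 0 <= f x) ->
    (\int[P]_w (f (X w))%:E = \int[mu]_x (f x * normal_pdf a s x)%:E)%E.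
  move=> mf f0.
  rewrite (@ge0_integral_law X (normal_prob a s) (EFin \o f))//; last first.
    exact/measurable_EFinP.
  by rewrite ge0_integral_normal//; exact/measurable_EFinP.
have mg : measurable_fun setT g by exact: continuous_measurable_fun.
have mag : measurable_fun setT (fun x => `|g x|) by exact: measurableT_comp.
have ea := edecay_abs eg.
have eE : (fun x => `|g x| * normal_pdf a s x) = (fun x => `|g x * normal_pdf a s x|).
  by apply/funext => x; rewrite normrM (ger0_norm (pdf0 x)).
have mgX : measurable_fun setT (g \o X) by exact: measurableT_comp.
have gi : P.-integrable setT (EFin \o (g \o X)).
  apply/integrableP; split; first exact/measurable_EFinP.
  rewrite (_ : integral _ _ _ = \int[P]_w (`|g (X w)|)%:E)%E; last by apply: eq_integral.
  rewrite (h (fun x => `|g x|))//.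
  have /integrableP[_] := edecay_integrable eg; apply: le_lt_trans.
  rewrite le_eqVlt; apply/orP; left; apply/eqP; apply: eq_integral => x _ /=.
  by rewrite normrM (ger0_norm (pdf0 x)).
split=> //.
have gai : P.-integrable setT (EFin \o (fun w => `|g (X w)|)).
  exact: (integrable_abse gi).
have e1 : \int[P]_w (`|g (X w)| + g (X w)) = \int[mu]_x ((`|g x| + g x) * normal_pdf a s x).
  rewrite /Rintegral (h (fun x => `|g x| + g x))//; first exact: measurable_funD.
  by move=> x; rewrite -lerBlDr sub0r ler_normr lexx orbT.
have e2 : \int[P]_w `|g (X w)| = \int[mu]_x (`|g x| * normal_pdf a s x).
  by rewrite /Rintegral (h (fun x => `|g x|)).
move: e1; rewrite RintegralD// e2.
under [in RHS]eq_Rintegral do rewrite mulrDl.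
rewrite integral_edecayD//; last by rewrite eE.
by move/addrI.
Qed.

Lemma normal_pdf_edecay (a s : R) : s != 0 -> edecay (normal_pdf a s).
Proof.
move=> s0.
have s2 : 0 < s ^+ 2 *+ 2 by rewrite pmulrn_lgt0// exprn_even_gt0.
have e0 : edecay (fun x : R => expR (- x ^+ 2 / (s ^+ 2 *+ 2))).
  apply: (@edecay_le _ _ _ (expR (s ^+ 2 / 2)) _ (edecay_expNabs (@ltr01 R))).
    have dE (x : R) : is_derive x (1 : R) (fun x : R => expR (- x ^+ 2 / (s ^+ 2 *+ 2))) (- 2 * x / (s ^+ 2 *+ 2) * expR (- x ^+ 2 / (s ^+ 2 *+ 2))).
      by apply: is_derive_eq; rewrite /GRing.scale /=; ring.
    exact: is_derive_continuous dE.
  move=> x; rewrite !(ger0_norm (expR_ge0 _)) -expRD ler_expR.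
  rewrite -[x ^+ 2]real_normK ?num_real//; move: `|x| => y.
  rewrite -subr_ge0 (_ : _ - _ = (y - s ^+ 2) ^+ 2 / (s ^+ 2 *+ 2)).
    by rewrite divr_ge0 ?sqr_ge0// ltW.
  by rewrite -[s ^+ 2 *+ 2]mulr_natr; field.
rewrite normal_pdfE//; apply: edecayZ.
have := edecay_translate (- a) e0; by [].
Qed.

Lemma normal_pdf_derive (a s x : R) : s != 0 ->
  is_derive x (1 : R) (normal_pdf a s) (- (x - a) / s ^+ 2 * normal_pdf a s x).
Proof.
move=> s0; rewrite normal_pdfE// /normal_fun -[s ^+ 2 *+ 2]mulr_natr.
move: (normal_peak s) => c.
by apply: is_derive_eq; rewrite /GRing.scale /=; field.
Qed.

Lemma edecay_pow (f : R -> R) k : edecay f -> edecay (fun x => x ^+ k * f x).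
Proof.
move=> ef; elim: k => [|k IH].
  by under eq_fun do rewrite expr0 mul1r.
by under eq_fun do rewrite exprS -mulrA; exact: edecay_mulX.
Qed.

(** The derivative of the density integrates to zero. *)
Lemma normal_pdf_mean (a s : R) : s != 0 -> \int[mu]_x (x * normal_pdf a s x) = a.
Proof.
move=> s0; have e0 := normal_pdf_edecay a s0; have e1 := edecay_mulX e0.
have e2 : edecay (fun x => - (x - a) / s ^+ 2 * normal_pdf a s x).
  rewrite (_ : (fun _ => _) = (fun x => - (s ^+ 2)^-1 * (x * normal_pdf a s x) + a / s ^+ 2 * normal_pdf a s x)).
    by apply: edecayD; exact: edecayZ.
  by apply/funext => x; ring.
have := integral_derivative_edecay (fun x => normal_pdf_derive a x s0) e0 e2.
rewrite (_ : (fun _ => _) = (fun x => - (s ^+ 2)^-1 * (x * normal_pdf a s x) + a / s ^+ 2 * normal_pdf a s x)); last first.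
  by apply/funext => x; ring.
rewrite integral_edecayD; [|exact: edecayZ|exact: edecayZ].
rewrite !integral_edecayZ//.
rewrite [\int[mu]_x normal_pdf _ _ _](_ : _ = 1); last first.
  by rewrite /Rintegral integral_normal_pdf.
move=> h.
have s2 : s ^+ 2 != 0 by rewrite expf_neq0.
have := congr1 (fun y => s ^+ 2 * y) h; rewrite mulr0 mulr1.
rewrite (_ : s ^+ 2 * _ = a - \int[mu]_x (x * normal_pdf a s x)); last first.
  by move: (\int[mu]_x _) => z; field.
by move/eqP; rewrite subr_eq0 eq_sym => /eqP.
Qed.

(** The derivative of [x^(k+1)] times the density integrates to zero. *)
Lemma normal_pdf_rec (s : R) k : s != 0 ->
  \int[mu]_x (x ^+ k.+2 * normal_pdf 0 s x) =
  s ^+ 2 * k.+1%:R * \int[mu]_x (x ^+ k * normal_pdf 0 s x).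
Proof.
move=> s0; have e0 := normal_pdf_edecay 0 s0.
have s2 : s ^+ 2 != 0 by rewrite expf_neq0.
have fE : (fun x : R => k.+1%:R * (x ^+ k * normal_pdf 0 s x) + - (s ^+ 2)^-1 * (x ^+ k.+2 * normal_pdf 0 s x)) =
  (fun x => k.+1%:R * x ^+ k * normal_pdf 0 s x + x ^+ k.+1 * (- (x - 0) / s ^+ 2 * normal_pdf 0 s x)).
  by apply/funext => x; rewrite subr0 !exprS; ring.
have e1 := edecay_pow k e0; have e2 := edecay_pow k.+2 e0.
have dF (x : R) : is_derive x (1 : R) (fun x => x ^+ k.+1 * normal_pdf 0 s x)
   (k.+1%:R * (x ^+ k * normal_pdf 0 s x) + - (s ^+ 2)^-1 * (x ^+ k.+2 * normal_pdf 0 s x)).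
  rewrite (congr1 (fun f => f x) fE).
  have d1 := normal_pdf_derive 0 x s0.
  have d2 := is_derive_pow k.+1 (is_derive_id x (1 : R)).
  by apply: is_derive_eq; rewrite /GRing.scale /=; ring.
have := integral_derivative_edecay dF (edecay_pow k.+1 e0) (edecayD (edecayZ _ e1) (edecayZ _ e2)).
rewrite integral_edecayD; [|exact: edecayZ|exact: edecayZ].
rewrite !integral_edecayZ//.
move: (\int[mu]_x _) (\int[mu]_x _) => u v h.
have := congr1 (fun y => s ^+ 2 * y) h; rewrite mulr0.
rewrite (_ : s ^+ 2 * _ = s ^+ 2 * k.+1%:R * v - u); last by field.
by move/eqP; rewrite subr_eq0 => /eqP.
Qed.

Definition has_moments (f : T -> R) := measurable_fun setT f /\
  forall k, P.-integrable setT (EFin \o (fun w => f w ^+ k)).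

Notation Ex f := (\int[P]_w (f w)).

(** The recursion is the only property of centred normal laws used below. It also
    holds for the point mass at 0, so degenerate laws need no separate treatment
    afterwards. *)
Lemma gaussian_moments (X : T -> R) : measurable_fun setT X -> gaussian_law P X ->
  Ex X = 0 ->
  has_moments X /\ forall k, \int[P]_w (X w ^+ k.+2) = k.+1%:R * \int[P]_w (X w ^+ 2) * \int[P]_w (X w ^+ k).
Proof.
move=> mX [a [s [s0 XP]]] EX.
have cX k : continuous (fun x : R => x ^+ k) by exact: exprn_continuous.
move: XP; case: eqP => [sE|/eqP s1] XP.
  have XP' A : measurable A -> pushforward P X A = \d_a A by exact: XP.
  have Xa : {ae P, forall w, X w = a}.
    exists (X @^-1` (~` [set a])); split.
    - by rewrite -[X in measurable X]setTI; apply: mX => //; exact: measurableC.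
    - have := XP' (~` [set a]) (measurableC (measurable_set1 a)).
      by rewrite /pushforward => ->; rewrite diracE memNset//= => h; exact: h.
    - by move=> w /= h Xw; exact: h.
  have mXk k : measurable_fun setT (fun w => X w ^+ k) by exact: measurable_funX.
  have Ek k : (\int[P]_w (X w ^+ k)%:E = (a ^+ k)%:E)%E.
    rewrite (ae_eq_integral (cst (a ^+ k)%:E))//.
    - by rewrite integral_cst//= probability_setT mule1.
    - exact/measurable_EFinP.
    - by case: Xa => N [mN N0 HN]; exists N; split => // w /= h; apply: HN => /= Xw; apply: h => _; rewrite Xw.
  have a0 : a = 0.
    have h : \int[P]_w X w = a := congr1 fine (Ek 1%N).
    by rewrite -h.
  split; first split => //.
    move=> k; apply/integrableP; split; first exact/measurable_EFinP.
    rewrite (ae_eq_integral (cst (`|a ^+ k|)%:E))//.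
    - by rewrite integral_cst//= probability_setT mule1 ltry.
    - by apply/measurable_EFinP; exact: measurableT_comp.
    - by case: Xa => N [mN N0 HN]; exists N; split => // w /= h; apply: HN => /= Xw; apply: h => _; rewrite Xw.
  by move=> k; rewrite /Rintegral !Ek /= a0 !expr0n /= mulr0 mul0r.
have e0 := normal_pdf_edecay a s1.
have cid : continuous (fun x : R => x) by move=> x; exact: cvg_id.
have [_ m1] := normal_moment s1 mX XP cid (edecay_mulX e0).
have a0 : a = 0 by rewrite -(normal_pdf_mean a s1) -m1.
rewrite a0 in XP e0.
have mom k := normal_moment s1 mX XP (cX k) (edecay_pow k e0).
split; first by split => // k; have [h _] := mom k.
move=> k; rewrite (mom k.+2).2 (mom k).2 (mom 2%N).2 !normal_pdf_rec//.
rewrite [\int[mu]_x (x ^+ 0 * _)](_ : _ = 1); last first.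
  under eq_Rintegral do rewrite expr0 mul1r.
  by rewrite /Rintegral integral_normal_pdf.
by rewrite !mulr1 [k.+1%:R * _]mulrC.
Qed.

End univariate_gaussian.

(** * Integration by parts in a Gaussian space *)

Section moments.
Variables (R : realType) (disp : measure_display) (T : measurableType disp).
Variable P : probability T R.
Notation Ex f := (\int[P]_w (f w)).
Notation hm := (has_moments P).

Lemma hm_integrable_mul (f g : T -> R) a b : hm f -> hm g ->
  P.-integrable setT (EFin \o (fun w => f w ^+ a * g w ^+ b)).
Proof.
move=> [mf fi] [mg gi].
apply: (@le_integrable _ _ _ P setT _ _ (fun w => ((f w ^+ (2 * a))%:E + (g w ^+ (2 * b))%:E)%E)) => //.
- apply/measurable_EFinP; apply: measurable_funM; exact: measurable_funX.
- move=> w _ /=; rewrite lee_fin ![(2 * _)%N]mulnC !exprM normrM.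
  rewrite [leRHS]ger0_norm; last by rewrite addr_ge0// sqr_ge0.
  rewrite -[(f w ^+ a) ^+ 2]real_normK ?num_real// -[(g w ^+ b) ^+ 2]real_normK ?num_real//.
  move: (normr_ge0 (f w ^+ a)) (normr_ge0 (g w ^+ b)); move: `|_| `|_| => x y x0 y0.
  have : 0 <= (x - y) ^+ 2 by exact: sqr_ge0.
  have : 0 <= x * y by exact: mulr_ge0.
  rewrite sqrrB; lra.
- by apply: integrableD => //; [exact: fi|exact: gi].
Qed.

Lemma hm_integrable (f : T -> R) : hm f -> P.-integrable setT (EFin \o f).
Proof. by move=> [_ /(_ 1%N)]. Qed.

Lemma hmM (f g : T -> R) : hm f -> hm g -> hm (fun w => f w * g w).
Proof.
move=> hf hg; split; first by apply: measurable_funM; [case: hf|case: hg].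
move=> k; under eq_fun do rewrite exprMn.
exact: hm_integrable_mul.
Qed.

Lemma hm_cst (c : R) : hm (fun=> c).
Proof.
split; first exact: measurable_cst.
by move=> k; apply: finite_measure_integrable_cst.
Qed.

Lemma hmZ (c : R) (f : T -> R) : hm f -> hm (fun w => c * f w).
Proof. by apply: hmM; exact: hm_cst. Qed.

Lemma hmX (f : T -> R) k : hm f -> hm (fun w => f w ^+ k).
Proof.
move=> hf; elim: k => [|k IH].
  by under eq_fun do rewrite expr0; exact: hm_cst.
by under eq_fun do rewrite exprS; exact: hmM.
Qed.

Lemma ExD (f g : T -> R) : hm f -> hm g -> \int[P]_w (f w + g w) = Ex f + Ex g.
Proof. by move=> hf hg; rewrite RintegralD//; exact: hm_integrable. Qed.

Lemma ExZ (c : R) (f : T -> R) : hm f -> \int[P]_w (c * f w) = c * Ex f.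
Proof. by move=> hf; rewrite RintegralZl//; exact: hm_integrable. Qed.

Lemma Ex_cst (c : R) : \int[P]_w c = c.
Proof. by rewrite /Rintegral integral_cst//= probability_setT mule1. Qed.

Lemma integrable_sum_EFin (I : Type) (r : seq I) (F : I -> T -> R) :
  (forall i, P.-integrable setT (EFin \o F i)) ->
  P.-integrable setT (EFin \o (fun w => \sum_(i <- r) F i w)).
Proof.
move=> hF; elim: r => [|i r IH].
  by under eq_fun do rewrite big_nil; exact: (hm_integrable (hm_cst 0)).
under eq_fun do rewrite big_cons.
have := integrableD measurableT (hF i) IH; apply: eq_integrable => //.
Qed.

Lemma hmD (f g : T -> R) : hm f -> hm g -> hm (fun w => f w + g w).
Proof.
move=> hf hg; split; first by apply: measurable_funD; [case: hf|case: hg].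
move=> k; under eq_fun do rewrite exprDn.
have := @integrable_sum_EFin _ (index_enum (ordinal k.+1)) (fun i w => (f w ^+ (k - i) * g w ^+ i) *+ 'C(k, i)).
apply => i; under eq_fun do rewrite -mulr_natl.
have := hm_integrable_mul (k - i) i hf hg.
by move=> /(integrableZl measurableT ('C(k, i)%:R)); apply: eq_integrable.
Qed.

Lemma hm_sum (I : Type) (r : seq I) (F : I -> T -> R) :
  (forall i, hm (F i)) -> hm (fun w => \sum_(i <- r) F i w).
Proof.
move=> hF; elim: r => [|i r IH].
  by under eq_fun do rewrite big_nil; exact: hm_cst.
by under eq_fun do rewrite big_cons; exact: hmD.
Qed.

Lemma Ex_sum (I : Type) (r : seq I) (F : I -> T -> R) :
  (forall i, hm (F i)) -> \int[P]_w (\sum_(i <- r) F i w) = \sum_(i <- r) Ex (F i).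
Proof.
move=> hF; elim: r => [|i r IH].
  by under eq_Rintegral do rewrite big_nil; rewrite Ex_cst big_nil.
under eq_Rintegral do rewrite big_cons.
by rewrite ExD//; [rewrite IH big_cons|exact: hm_sum].
Qed.

Lemma poly_ext (p q : {poly R}) : (forall t, p.[t] = q.[t]) -> p = q.
Proof.
move=> h; apply/eqP; rewrite -subr_eq0; apply/eqP.
apply: (@roots_geq_poly_eq0 _ _ [seq i%:R | i <- iota 0 (size (p - q)%R)]).
- by apply/allP => x _; rewrite /root hornerD hornerN h subrr.
- rewrite map_inj_uniq ?iota_uniq// => i j /eqP.
  by rewrite eqr_nat => /eqP.
- by rewrite size_map size_iota.
Qed.

(** The expectation of [A (L + t f)^n] as a polynomial in [t]. *)
Definition Epoly (A L f : T -> R) n : {poly R} :=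
  \poly_(i < n.+1) (\int[P]_w (A w * L w ^+ (n - i) * f w ^+ i) *+ 'C(n, i)).

Lemma Epoly_horner (A L f : T -> R) n t : hm A -> hm L -> hm f ->
  (Epoly A L f n).[t] = \int[P]_w (A w * (L w + t * f w) ^+ n).
Proof.
move=> hA hL hf.
rewrite /Epoly horner_poly.
under [RHS]eq_Rintegral do rewrite exprDn mulr_sumr.
rewrite Ex_sum; last first.
  move=> i; apply: hmM => //.
  under eq_fun do rewrite -mulr_natl; apply: hmZ; apply: hmM; first exact: hmX.
  by apply: hmX; exact: hmZ.
apply: eq_bigr => i _.
rewrite -[X in X * _]mulr_natl mulrAC -ExZ; last first.
  by apply: hmM; [apply: hmM => //; exact: hmX|exact: hmX].
by apply: eq_Rintegral => w _; rewrite exprMn -mulr_natl; ring.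
Qed.

Lemma Epoly0 (A L f : T -> R) n : (Epoly A L f n)`_0 = \int[P]_w (A w * L w ^+ n).
Proof.
rewrite coef_poly /= bin0 mulr1n subn0.
by apply: eq_Rintegral => w _; rewrite expr0 mulr1.
Qed.

Lemma Epoly1 (A L f : T -> R) n :
  (Epoly A L f n)`_1 = n%:R * \int[P]_w (A w * L w ^+ n.-1 * f w).
Proof.
rewrite coef_poly bin1 subn1; case: n => [|n] /=; first by rewrite mul0r.
by rewrite [RHS]mulr_natl; congr (_ *+ _); apply: eq_Rintegral => w _; rewrite expr1.
Qed.

(** A centred Gaussian space, described by moments instead of laws: the moment
    recursion, required for all linear combinations, determines the mixed moments
    by polarization. *)
Definition gaussian_space (H : (T -> R) -> Prop) :=
  [/\ forall f g, H f -> H g -> H (fun w => f w + g w),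
      forall (c : R) f, H f -> H (fun w => c * f w) &
      forall f, H f -> [/\ hm f, Ex f = 0 &
        forall k, \int[P]_w (f w ^+ k.+2) = k.+1%:R * \int[P]_w (f w ^+ 2) * \int[P]_w (f w ^+ k)]].

Variable H : (T -> R) -> Prop.
Hypothesis gH : gaussian_space H.

Let HD f g : H f -> H g -> H (fun w => f w + g w). Proof. by case: gH => h _ _; exact: h. Qed.
Let HZ c f : H f -> H (fun w => c * f w). Proof. by case: gH => _ h _; exact: h. Qed.
Let Hhm f : H f -> hm f. Proof. by case: gH => _ _ h /h[]. Qed.

Definition fprod (s : seq (T -> R)) (w : T) := \prod_(f <- s) f w.

(** Leibniz rule for a product, where the derivative of [f] in the direction of
    [X] is the covariance of [X] and [f]. *)
Fixpoint dprod (X : T -> R) (s : seq (T -> R)) : T -> R :=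
  if s is f :: s' then
    fun w => \int[P]_v (X v * f v) * fprod s' w + f w * dprod X s' w
  else fun=> 0.

Lemma hm_fprod s : (forall f, List.In f s -> H f) -> hm (fprod s).
Proof.
rewrite /fprod; elim: s => [|f s IH] Hs.
  by under eq_fun do rewrite big_nil; exact: hm_cst.
under eq_fun do rewrite big_cons.
apply: hmM; first by apply: Hhm; apply: Hs; left.
by apply: IH => g gs; apply: Hs; right.
Qed.

Lemma hm_dprod X s : (forall f, List.In f s -> H f) -> hm (dprod X s).
Proof.
elim: s => [|f s IH] Hs /=; first exact: hm_cst.
have Hs' g : List.In g s -> H g by move=> gs; apply: Hs; right.
apply: hmD; first by apply: hmZ; exact: hm_fprod.
by apply: hmM; [apply: Hhm; apply: Hs; left|exact: IH].
Qed.

(** The coefficient of [t] in the moment recursion for [L + t X]. By induction the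
    moment of order two and the mixed moments of lower order recombine. *)
Lemma stein_power X L k : H X -> H L ->
  \int[P]_w (X w * L w ^+ k.+1) = k.+1%:R * \int[P]_w (X w * L w) * \int[P]_w (L w ^+ k).
Proof.
move=> HX HL; have hX := Hhm HX; have hL := Hhm HL.
elim/ltn_ind: k => -[|k] IH.
  rewrite mul1r; under [X in _ * X]eq_Rintegral do rewrite expr0.
  by rewrite Ex_cst mulr1; apply: eq_Rintegral => w _; rewrite expr1.
have h1 := hm_cst 1.
have e : Epoly (fun=> 1) L X k.+3 = k.+2%:R *: (Epoly (fun=> 1) L X 2 * Epoly (fun=> 1) L X k.+1).
  apply: poly_ext => t; rewrite hornerZ hornerM !Epoly_horner//.
  case: gH => _ _ /(_ _ (HD HL (HZ t HX)))[_ _ /(_ k.+1)].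
  rewrite mulrA; under eq_Rintegral do rewrite -[(_ + _) ^+ _]mul1r.
  move=> ->; congr (_ * _ * _); by apply: eq_Rintegral => w _; rewrite mul1r.
have := congr1 (fun p : {poly R} => p`_1) e.
rewrite coefZ coefM !big_ord_recl big_ord0 /= addr0 subn0 subnn !Epoly1 !Epoly0 /=.
have s1 n : \int[P]_w (1 * L w ^+ n * X w) = \int[P]_w (X w * L w ^+ n).
  by apply: eq_Rintegral => w _; rewrite mul1r mulrC.
have s2 n : \int[P]_w (1 * L w ^+ n) = \int[P]_w (L w ^+ n).
  by apply: eq_Rintegral => w _; rewrite mul1r.
rewrite !s1 !s2.
have -> : \int[P]_w (X w * L w ^+ 1) = \int[P]_w (X w * L w).
  by apply: eq_Rintegral => w _; rewrite expr1.
have Q : \int[P]_w (L w ^+ 2) * \int[P]_w (X w * L w ^+ k) =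
    \int[P]_w (X w * L w) * \int[P]_w (L w ^+ k.+1).
  case: gH => _ _ mom; case: k IH {e} => [|k] IH.
    have -> : \int[P]_w (L w ^+ 1) = 0 by have [_ + _] := mom _ HL; apply.
    have -> : \int[P]_w (X w * L w ^+ 0) = 0.
      transitivity (Ex X); first by apply: eq_Rintegral => w _; rewrite expr0 mulr1.
      by have [] := mom _ HX.
    by rewrite !mulr0.
  have [_ _ mL] := mom _ HL; rewrite IH// (mL k).
  ring.
move: Q; move: (\int[P]_w (X w * L w)) (\int[P]_w (L w ^+ 2)) (\int[P]_w (X w * L w ^+ k)) (\int[P]_w (L w ^+ k.+1)) => s11 v sk l Q h.
have n0 : k.+3%:R != 0 :> R by rewrite pnatr_eq0.
apply: (mulfI n0); rewrite h.
rewrite [v * _](_ : _ = k.+1%:R * (v * sk)); last by ring.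
rewrite Q -[k.+3]addn3 -[k.+2]addn2 -[k.+1]addn1 !natrD; ring.
Qed.

(** The integration by parts formula, by polarization: replacing [L] by [L + t f]
    and comparing the coefficients of [t] moves one factor [f] out of the power. *)
Lemma stein_mixed X s : (forall f, List.In f s -> H f) -> H X -> forall L k, H L ->
  \int[P]_w (X w * L w ^+ k * fprod s w) =
  k%:R * \int[P]_w (X w * L w) * \int[P]_w (L w ^+ k.-1 * fprod s w) +
  \int[P]_w (L w ^+ k * dprod X s w).
Proof.
move=> + HX; have hX := Hhm HX.
elim: s => [|f s IH] Hs L k HL.
  rewrite [X in _ + X](_ : _ = 0) ?addr0; last first.
    under eq_Rintegral do rewrite /= mulr0.
    exact: Ex_cst.
  have e n (A : T -> R) : \int[P]_w (A w * L w ^+ n * fprod [::] w) = \int[P]_w (A w * L w ^+ n).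
    by apply: eq_Rintegral => w _; rewrite /fprod big_nil mulr1.
  have e' n : \int[P]_w (L w ^+ n * fprod [::] w) = \int[P]_w (L w ^+ n).
    by apply: eq_Rintegral => w _; rewrite /fprod big_nil mulr1.
  rewrite e e'; case: k => [|k] /=; last exact: stein_power.
  rewrite !mul0r; transitivity (Ex X).
    by apply: eq_Rintegral => w _; rewrite expr0 mulr1.
  by case: gH => _ _ /(_ _ HX)[].
have Hs' g : List.In g s -> H g by move=> gs; apply: Hs; right.
have Hf : H f by apply: Hs; left.
have hL := Hhm HL; have hf := Hhm Hf.
have hp := hm_fprod Hs'; have hd := hm_dprod X Hs'.
have hXp : hm (fun w => X w * fprod s w) by exact: hmM.
pose cL := \int[P]_w (X w * L w); pose cf := \int[P]_w (X w * f w).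
have e : Epoly (fun w => X w * fprod s w) L f k.+1 =
  k.+1%:R *: ((cL%:P + cf *: 'X) * Epoly (fprod s) L f k) + Epoly (dprod X s) L f k.+1.
  apply: poly_ext => t; rewrite hornerD hornerZ hornerM !Epoly_horner//.
  rewrite hornerD hornerC hornerZ hornerX.
  have := IH Hs' _ k.+1 (HD HL (HZ t Hf)).
  rewrite (_ : \int[P]_w (X w * (L w + t * f w)) = cL + cf * t); last first.
    rewrite mulrC -ExZ; last exact: hmM.
    rewrite -ExD; [|exact: hmM|by apply: hmZ; exact: hmM].
    by apply: eq_Rintegral => w _; ring.
  rewrite mulrA => h; rewrite (_ : \int[P]_w (X w * fprod s w * _) =
    \int[P]_w (X w * (L w + t * f w) ^+ k.+1 * fprod s w)); last first.
    by apply: eq_Rintegral => w _; rewrite mulrAC.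
  by rewrite h; congr (_ * _ + _); apply: eq_Rintegral => w _; rewrite mulrC.
have := congr1 (fun p : {poly R} => p`_1) e.
rewrite coefD coefZ coefM !big_ord_recl big_ord0 /= addr0 subn0 subnn !Epoly1 !Epoly0 /=.
rewrite !coefD !coefC !coefZ !coefX /= !(mulr1, mulr0, add0r, addr0).
move=> h.
have n0 : k.+1%:R != 0 :> R by rewrite pnatr_eq0.
apply: (mulfI n0).
rewrite (_ : \int[P]_w (X w * L w ^+ k * fprod (f :: s) w) = \int[P]_w (X w * fprod s w * L w ^+ k * f w)); last first.
  by apply: eq_Rintegral => w _; rewrite /fprod big_cons; ring.
rewrite h mulrDr; rewrite -/cL.
rewrite (_ : \int[P]_w (L w ^+ k.-1 * fprod (f :: s) w) = \int[P]_w (fprod s w * L w ^+ k.-1 * f w)); last first.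
  by apply: eq_Rintegral => w _; rewrite /fprod big_cons; ring.
rewrite (_ : \int[P]_w (L w ^+ k * dprod X (f :: s) w) = cf * \int[P]_w (fprod s w * L w ^+ k) + \int[P]_w (dprod X s w * L w ^+ k * f w)); last first.
  rewrite -ExZ; last by apply: hmM => //; exact: hmX.
  rewrite -ExD; last 2 first.
  - by apply: hmZ; apply: hmM => //; exact: hmX.
  - by apply: hmM => //; apply: hmM => //; exact: hmX.
  by apply: eq_Rintegral => w _ /=; rewrite -/cf; ring.
by ring.
Qed.

Lemma stein_fprod X s : (forall f, List.In f s -> H f) -> H X ->
  \int[P]_w (X w * fprod s w) = Ex (dprod X s).
Proof.
move=> Hs HX; have := stein_mixed Hs HX 0 HX.
rewrite !mul0r add0r.
under [in LHS]eq_Rintegral do rewrite expr0 mulr1.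
by under [in RHS]eq_Rintegral do rewrite expr0 mul1r.
Qed.

Lemma dprod_cat X s t w :
  dprod X (s ++ t) w = dprod X s w * fprod t w + fprod s w * dprod X t w.
Proof.
elim: s => [|f s IH] /=; first by rewrite mul0r add0r /fprod big_nil mul1r.
by rewrite IH /fprod big_cons big_cat /=; ring.
Qed.

(** [g] is a polynomial in elements of the space and [g'] its derivative in the
    direction of [X]. This is a relation because [g'] is computed from a
    representation of [g] as a combination of products, which is not unique. *)
Definition gpoly X (g g' : T -> R) := exists r : seq (R * seq (T -> R)),
  [/\ forall p f, List.In p r -> List.In f p.2 -> H f,
      forall w, g w = \sum_(p <- r) p.1 * fprod p.2 w &
      forall w, g' w = \sum_(p <- r) p.1 * dprod X p.2 w].

Lemma hm_sum_in (I : Type) (r : seq I) (F : I -> T -> R) :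
  (forall i, List.In i r -> hm (F i)) -> hm (fun w => \sum_(i <- r) F i w).
Proof.
elim: r => [|i r IH] hF.
  by under eq_fun do rewrite big_nil; exact: hm_cst.
under eq_fun do rewrite big_cons; apply: hmD; first by apply: hF; left.
by apply: IH => j jr; apply: hF; right.
Qed.

Lemma Ex_sum_in (I : Type) (r : seq I) (F : I -> T -> R) :
  (forall i, List.In i r -> hm (F i)) -> \int[P]_w (\sum_(i <- r) F i w) = \sum_(i <- r) Ex (F i).
Proof.
elim: r => [|i r IH] hF.
  by under eq_Rintegral do rewrite big_nil; rewrite Ex_cst big_nil.
have hF' j : List.In j r -> hm (F j) by move=> jr; apply: hF; right.
under eq_Rintegral do rewrite big_cons.
by rewrite ExD; [rewrite IH// big_cons|apply: hF; left|exact: hm_sum_in].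
Qed.

(** Integration by parts for Gaussian variables, by linearity from products. *)
Lemma gpoly_stein X g g' : H X -> gpoly X g g' -> \int[P]_w (X w * g w) = Ex g'.
Proof.
move=> HX [r [Hr gE g'E]].
under eq_Rintegral do rewrite gE mulr_sumr.
under [in RHS]eq_Rintegral do rewrite g'E.
have hf p : List.In p r -> hm (fprod p.2) by move=> pr; apply: hm_fprod => f; exact: Hr.
have hd p : List.In p r -> hm (dprod X p.2) by move=> pr; apply: hm_dprod => f; exact: Hr.
rewrite Ex_sum_in; last by move=> p pr; apply: hmM; [exact: Hhm|apply: hmZ; exact: hf].
rewrite Ex_sum_in; last by move=> p pr; apply: hmZ; exact: hd.
elim: r Hr hf hd {gE g'E} => [|p r IH] Hr hf hd; first by rewrite !big_nil.
rewrite !big_cons IH; last 3 first.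
- by move=> q f qr; apply: Hr; right.
- by move=> q qr; apply: hf; right.
- by move=> q qr; apply: hd; right.
congr (_ + _).
rewrite ExZ; last by apply: hd; left.
rewrite -stein_fprod//; last by move=> f; apply: Hr; left.
rewrite -ExZ; last by apply: hmM; [exact: Hhm|apply: hf; left].
by apply: eq_Rintegral => w _; ring.
Qed.

Lemma gpoly_cst X c : gpoly X (fun=> c) (fun=> 0).
Proof.
exists [:: (c, [::])]; split.
- by move=> p f /= [<-|//].
- by move=> w; rewrite big_seq1 /fprod big_nil mulr1.
- by move=> w; rewrite big_seq1 /= mulr0.
Qed.

Lemma gpoly_var X f : H f -> gpoly X f (fun=> \int[P]_w (X w * f w)).
Proof.
move=> Hf; exists [:: (1, [:: f])]; split.
- by move=> p g /= [<-|//] /= [<-|//].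
- by move=> w; rewrite big_seq1 /fprod big_seq1 mul1r.
- by move=> w; rewrite big_seq1 /= mulr0 addr0 /fprod big_nil mulr1 mul1r.
Qed.

Lemma gpolyD X f f' g g' : gpoly X f f' -> gpoly X g g' ->
  gpoly X (fun w => f w + g w) (fun w => f' w + g' w).
Proof.
move=> [r [Hr fE f'E]] [s [Hs gE g'E]]; exists (r ++ s); split.
- by move=> p h /List.in_app_iff[]; [exact: Hr|exact: Hs].
- by move=> w; rewrite big_cat /= fE gE.
- by move=> w; rewrite big_cat /= f'E g'E.
Qed.

Lemma gpolyM X f f' g g' : gpoly X f f' -> gpoly X g g' ->
  gpoly X (fun w => f w * g w) (fun w => f' w * g w + f w * g' w).
Proof.
move=> [r [Hr fE f'E]] [s [Hs gE g'E]].
exists [seq (p.1 * q.1, p.2 ++ q.2) | p <- r, q <- s]; split.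
- move=> p h; elim: r Hr {fE f'E} => [//|a r IH] Hr /=.
  move/List.in_app_iff => [|pr]; last by apply: IH => // q k qr; apply: Hr; right.
  rewrite List.in_map_iff => -[q [<- qs]] /= /List.in_app_iff[]; last exact: Hs.
  by apply: Hr; left.
- move=> w; rewrite fE gE mulr_suml big_allpairs_dep /=; apply: eq_bigr => p _.
  rewrite mulr_sumr; apply: eq_bigr => q _.
  by rewrite /fprod big_cat /=; ring.
- move=> w; rewrite fE gE f'E g'E big_allpairs_dep /= !mulr_suml -big_split /=.
  apply: eq_bigr => p _; rewrite !mulr_sumr -big_split /=; apply: eq_bigr => q _.
  by rewrite dprod_cat; ring.
Qed.

Lemma gpolyX X f f' k : gpoly X f f' ->
  gpoly X (fun w => f w ^+ k) (fun w => k%:R * f w ^+ k.-1 * f' w).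
Proof.
move=> pf; elim: k => [|k IH].
  have := gpoly_cst X 1; rewrite /gpoly => -[r [h1 h2 h3]]; exists r; split => //.
  by move=> w; rewrite -h3 !mul0r.
have [r [h1 h2 h3]] := gpolyM pf IH; exists r; split => // w; first by rewrite exprS h2.
rewrite -h3 -natr1; case: k {IH r h1 h2 h3} => [|k] /=; first by rewrite !mul0r expr0; ring.
by rewrite exprS; ring.
Qed.

Lemma gpoly_sum X (I : Type) (r : seq I) (F F' : I -> T -> R) :
  (forall i, gpoly X (F i) (F' i)) ->
  gpoly X (fun w => \sum_(i <- r) F i w) (fun w => \sum_(i <- r) F' i w).
Proof.
move=> pF; elim: r => [|i r IH].
  under eq_fun do rewrite big_nil; under [X in gpoly _ _ X]eq_fun do rewrite big_nil.
  exact: gpoly_cst.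
under eq_fun do rewrite big_cons; under [X in gpoly _ _ X]eq_fun do rewrite big_cons.
exact: gpolyD.
Qed.

End moments.

(** * Sums of squares of Gaussian variables *)

Section cauchy_schwarz.
Variable R : realType.

(** Lagrange's identity. *)
Lemma cauchy_schwarz_seq (I : Type) (r : seq I) (a b : I -> R) :
  (\sum_(i <- r) a i * b i) ^+ 2 <= (\sum_(i <- r) a i ^+ 2) * (\sum_(i <- r) b i ^+ 2).
Proof.
have h : 0 <= \sum_(i <- r) \sum_(j <- r) (a i * b j - a j * b i) ^+ 2.
  by apply: sumr_ge0 => i _; apply: sumr_ge0 => j _; exact: sqr_ge0.
suff e : \sum_(i <- r) \sum_(j <- r) (a i * b j - a j * b i) ^+ 2 =
   2 * ((\sum_(i <- r) a i ^+ 2) * (\sum_(i <- r) b i ^+ 2) - (\sum_(i <- r) a i * b i) ^+ 2).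
  by move: h; rewrite e pmulr_rge0// subr_ge0.
have e1 : \sum_(i <- r) \sum_(j <- r) a i ^+ 2 * b j ^+ 2 = (\sum_(i <- r) a i ^+ 2) * (\sum_(i <- r) b i ^+ 2).
  by rewrite mulr_suml; apply: eq_bigr => i _; rewrite mulr_sumr.
have e2 : \sum_(i <- r) \sum_(j <- r) a j ^+ 2 * b i ^+ 2 = (\sum_(i <- r) a i ^+ 2) * (\sum_(i <- r) b i ^+ 2).
  by rewrite exchange_big /= -e1.
have e3 : \sum_(i <- r) \sum_(j <- r) (a i * b i) * (a j * b j) = (\sum_(i <- r) a i * b i) ^+ 2.
  by rewrite expr2 mulr_suml; apply: eq_bigr => i _; rewrite mulr_sumr.
transitivity (\sum_(i <- r) \sum_(j <- r) (a i ^+ 2 * b j ^+ 2 + a j ^+ 2 * b i ^+ 2 - 2 * ((a i * b i) * (a j * b j)))).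
  by apply: eq_bigr => i _; apply: eq_bigr => j _; ring.
transitivity (\sum_(i <- r) (\sum_(j <- r) a i ^+ 2 * b j ^+ 2 + \sum_(j <- r) a j ^+ 2 * b i ^+ 2 - 2 * (\sum_(j <- r) (a i * b i) * (a j * b j)))).
  by apply: eq_bigr => i _; rewrite sumrB big_split /= [in RHS]mulr_sumr.
rewrite sumrB big_split /= e1 e2 -mulr_sumr e3; ring.
Qed.

(** The operator norm of a matrix is at most its Frobenius norm. *)
Lemma quad_form_le_frobenius (I : Type) (r : seq I) (c : I -> I -> R) (x : I -> R) :
  (\sum_(i <- r) \sum_(j <- r) c i j * x i * x j) ^+ 2 <=
  (\sum_(i <- r) \sum_(j <- r) c i j ^+ 2) * (\sum_(i <- r) x i ^+ 2) ^+ 2.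
Proof.
rewrite (_ : \sum_(i <- r) \sum_(j <- r) c i j * x i * x j = \sum_(i <- r) x i * (\sum_(j <- r) c i j * x j)); last first.
  by apply: eq_bigr => i _; rewrite mulr_sumr; apply: eq_bigr => j _; ring.
apply: (le_trans (cauchy_schwarz_seq _ _ _)).
rewrite mulrC expr2 mulrA ler_wpM2r//; first by apply: sumr_ge0 => i _; exact: sqr_ge0.
rewrite mulr_suml; apply: ler_sum => i _; exact: cauchy_schwarz_seq.
Qed.

End cauchy_schwarz.

Section quadratic_form.
Variables (R : realType) (disp : measure_display) (T : measurableType disp).
Variable P : probability T R.
Notation Ex f := (\int[P]_w (f w)).
Notation hm := (has_moments P).
Variable H : (T -> R) -> Prop.
Hypothesis gH : gaussian_space P H.
Variables (I : Type) (r : seq I) (X : I -> T -> R).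
Hypothesis HX : forall i, H (X i).

Let hX i : hm (X i). Proof. by case: gH => _ _ /(_ _ (HX i))[]. Qed.

Definition cov_fun i j := \int[P]_w (X i w * X j w).
Definition trace_cov := \sum_(i <- r) cov_fun i i.
Definition frobenius_cov := \sum_(i <- r) \sum_(j <- r) cov_fun i j ^+ 2.
Definition sumsq (w : T) := \sum_(i <- r) X i w ^+ 2.
Definition sumsqc (w : T) := sumsq w - trace_cov.
Definition cov_form (w : T) := \sum_(i <- r) \sum_(j <- r) cov_fun i j * X i w * X j w.

Lemma hm_sumsq : hm sumsq.
Proof. by apply: hm_sum => i; exact: hmX. Qed.

Lemma hm_sumsqc : hm sumsqc.
Proof. by apply: hmD; [exact: hm_sumsq|exact: hm_cst]. Qed.

Lemma hm_cov_form : hm cov_form.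
Proof.
apply: hm_sum => i; apply: hm_sum => j.
by apply: hmM => //; exact: hmZ.
Qed.

Lemma Ex_sumsqc : Ex sumsqc = 0.
Proof.
rewrite /sumsqc ExD; [|exact: hm_sumsq|exact: hm_cst].
rewrite Ex_cst Ex_sum; last by move=> i; exact: hmX.
apply/eqP; rewrite subr_eq0; apply/eqP; apply: eq_bigr => i _.
by apply: eq_Rintegral => w _; rewrite expr2.
Qed.

Lemma sumsqc_gpoly i : gpoly P H (X i) sumsqc (fun w => \sum_(j <- r) (2 * cov_fun i j * X j w)).
Proof.
have h : gpoly P H (X i) sumsqc (fun w => \sum_(j <- r) (2%:R * X j w ^+ 1 * cov_fun i j) + 0).
  apply: gpolyD; last exact: gpoly_cst.
  by apply: gpoly_sum => j; apply: gpolyX; exact: gpoly_var.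
have [s [h1 h2 h3]] := h; exists s; split => // w.
by rewrite -h3 addr0; apply: eq_bigr => j _; rewrite expr1; ring.
Qed.

(** Integrate by parts in one factor [X i] of each square. The derivative of
    [X i] itself gives the trace, which the centring removes. *)
Lemma sumsqc_moment_rec p :
  \int[P]_w (sumsqc w ^+ p.+2) = 2 * p.+1%:R * \int[P]_w (sumsqc w ^+ p * cov_form w).
Proof.
have hZ := hm_sumsqc; have hW := hm_cov_form.
have st i : \int[P]_w (X i w ^+ 2 * sumsqc w ^+ p.+1) =
   cov_fun i i * \int[P]_w (sumsqc w ^+ p.+1) +
   2 * p.+1%:R * \int[P]_w (sumsqc w ^+ p * \sum_(j <- r) cov_fun i j * X i w * X j w).
  have g1 := gpolyM (gpoly_var P (X i) (HX i)) (gpolyX p.+1 (sumsqc_gpoly i)).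
  have := gpoly_stein gH (HX i) g1.
  rewrite (_ : \int[P]_w (X i w * _) = \int[P]_w (X i w ^+ 2 * sumsqc w ^+ p.+1)); last first.
    by apply: eq_Rintegral => w _; rewrite mulrA expr2.
  move=> ->; rewrite -ExZ; last exact: hmX.
  rewrite -ExZ; last first.
    apply: hmM; first exact: hmX.
    by apply: hm_sum => j; apply: hmM => //; exact: hmZ.
  rewrite -ExD; last 2 first.
  - by apply: hmZ; exact: hmX.
  - apply: hmZ; apply: hmM; first exact: hmX.
    by apply: hm_sum => j; apply: hmM => //; exact: hmZ.
  apply: eq_Rintegral => w _ /=; congr (_ + _).
  rewrite !mulr_sumr; apply: eq_bigr => j _; ring.
transitivity (\sum_(i <- r) \int[P]_w (X i w ^+ 2 * sumsqc w ^+ p.+1) + - trace_cov * \int[P]_w (sumsqc w ^+ p.+1)).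
  rewrite -ExZ; last exact: hmX.
  rewrite -Ex_sum; last by move=> i; apply: hmM; exact: hmX.
  rewrite -ExD; last 2 first.
  - by apply: hm_sum => i; apply: hmM; exact: hmX.
  - by apply: hmZ; exact: hmX.
  apply: eq_Rintegral => w _; rewrite -mulr_suml -mulrDl exprS; congr (_ * _).
under eq_bigr do rewrite st.
rewrite big_split /= -mulr_suml -/trace_cov -mulr_sumr.
rewrite -Ex_sum; last first.
  move=> i; apply: hmM; first exact: hmX.
  by apply: hm_sum => j; apply: hmM => //; exact: hmZ.
rewrite addrAC mulNr subrr add0r; congr (_ * _).
by apply: eq_Rintegral => w _; rewrite -mulr_sumr.
Qed.

Lemma sumsqc_variance : \int[P]_w (sumsqc w ^+ 2) = 2 * frobenius_cov.
Proof.
rewrite sumsqc_moment_rec mulr1; congr (_ * _).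
under eq_Rintegral do rewrite expr0 mul1r.
rewrite Ex_sum; last first.
  by move=> i; apply: hm_sum => j; apply: hmM => //; exact: hmZ.
apply: eq_bigr => i _; rewrite Ex_sum; last first.
  by move=> j; apply: hmM => //; exact: hmZ.
apply: eq_bigr => j _; under eq_Rintegral do rewrite -mulrA.
by rewrite ExZ; [rewrite expr2|exact: hmM].
Qed.

Lemma cov_form_le (e : R) w : 0 <= e -> frobenius_cov <= e ^+ 2 -> `|cov_form w| <= e * sumsq w.
Proof.
move=> e0 Fe.
have S0 : 0 <= sumsq w by apply: sumr_ge0 => i _; exact: sqr_ge0.
apply: ler_norm_of_sqr; first exact: mulr_ge0.
apply: (le_trans (quad_form_le_frobenius r cov_fun (fun i => X i w))).
by rewrite exprMn ler_wpM2r// sqr_ge0.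
Qed.

Lemma trace_cov_ge0 : 0 <= trace_cov.
Proof.
apply: sumr_ge0 => i _; apply: Rintegral_ge0 => w _.
by rewrite -expr2 sqr_ge0.
Qed.

(** The recursion expresses the moment of order [2 q + 2] by that of [sumsqc^(2 q)]
    times [cov_form], and [cov_form] is at most [e * sumsq]. With
    [sumsq = sumsqc + trace_cov] and [z <= (z^2 + 1) / 2], half of the moment of order
    [2 q + 2] is absorbed on the left when [e] is small. *)
Lemma sumsqc_moment_le (e : R) q : 0 <= e -> frobenius_cov <= e ^+ 2 -> 4 * q%:R * e <= 1 ->
  \int[P]_w (sumsqc w ^+ (2 * q)) <=
  \prod_(i < q) (2 * (2 * i + 1)%:R * (1 + 2 * trace_cov)) * e ^+ q.
Proof.
move=> e0 Fe; have A0 := trace_cov_ge0.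
have hZ := hm_sumsqc; have hW := hm_cov_form.
elim: q => [|q IH] qe.
  by rewrite muln0 big_ord0 mul1r; under eq_Rintegral do rewrite expr0; rewrite Ex_cst expr0.
have qe' : 4 * q%:R * e <= 1.
  by apply: le_trans qe; rewrite ler_wpM2r// ler_wpM2l// ler_nat.
have {}IH := IH qe'.
set A := trace_cov in A0 IH *.
pose m0 := \int[P]_w (sumsqc w ^+ (2 * q)).
pose m2 := \int[P]_w (sumsqc w ^+ (2 * q).+2).
pose a : R := (2 * q + 1)%:R.
have ae : 2 * (a * e) <= 1.
  apply: le_trans qe; rewrite mulrA ler_wpM2r// /a natrD natrM -natr1; lra.
have Z0 w : 0 <= sumsqc w ^+ (2 * q) by rewrite exprM exprn_ge0// sqr_ge0.
have a0 : 0 <= a by [].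
have key : m2 <= 2 * a * (e * (2^-1 * m2 + (2^-1 + A) * m0)).
  rewrite {1}/m2 sumsqc_moment_rec -[(2 * q).+1]addn1 -/a; apply: ler_wpM2l; first by rewrite mulr_ge0.
  rewrite /m2 /m0 -ExZ; last exact: hmX.
  rewrite -[X in _ + X]ExZ; last exact: hmX.
  rewrite -ExD; [|by apply: hmZ; exact: hmX|by apply: hmZ; exact: hmX].
  rewrite -ExZ; last by apply: hmD; apply: hmZ; exact: hmX.
  apply: le_Rintegral => //.
  - by apply: hm_integrable; apply: hmM => //; exact: hmX.
  - by apply: hm_integrable; apply: hmZ; apply: hmD; apply: hmZ; exact: hmX.
  move=> w _.
  apply: (@le_trans _ _ (sumsqc w ^+ (2 * q) * (e * sumsq w))).
    apply: ler_wpM2l => //; apply: le_trans (cov_form_le w e0 Fe); exact: ler_norm.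
  rewrite mulrCA ler_wpM2l//.
  rewrite (_ : sumsq w = sumsqc w + A); last by rewrite /sumsqc subrK.
  have := Z0 w; rewrite [_ ^+ (2 * q).+2]exprSr exprSr.
  move: (sumsqc w) (_ ^+ _) => z y y0.
  have : 0 <= y * (z - 1) ^+ 2 by rewrite mulr_ge0// sqr_ge0.
  rewrite sqrrB expr1n mulr1; lra.
have m00 : 0 <= m0 by apply: Rintegral_ge0 => w _; exact: Z0.
have m20 : 0 <= m2.
  by apply: Rintegral_ge0 => w _; rewrite -addn2 exprD mulr_ge0// sqr_ge0.
have ae0 : 0 <= a * e by rewrite mulr_ge0.
have k2 : m2 <= 2 * a * (1 + 2 * A) * e * m0.
  have : (2 * (a * e)) * m2 <= 1 * m2 by rewrite ler_wpM2r.
  have : 2 * a * (e * (2^-1 * m2 + (2^-1 + A) * m0)) = 2^-1 * ((2 * (a * e)) * m2) + (a * (1 + 2 * A) * e) * m0 by field.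
  lra.
rewrite mulnS add2n -/m2; apply: (le_trans k2).
rewrite big_ord_recr /= exprS -/a.
have c0 : 0 <= 2 * a * (1 + 2 * A) * e by rewrite !mulr_ge0// addr_ge0// mulr_ge0.
apply: (le_trans (ler_wpM2l c0 IH)).
by rewrite le_eqVlt; apply/orP; left; apply/eqP; ring.
Qed.

End quadratic_form.

(** * Points of a lattice in balls and domains *)

Section lattice.
Variables (R : realType) (d : nat).
Implicit Types (s x : 'cV[R]_d) (n r : nat).

Lemma mx_norm_coord_le x (e : R) : 0 <= e -> (`|x| <= e) = [forall i, `|x i 0| <= e].
Proof.
move=> e0; have xE : `|x| = mx_norm x by [].
apply/idP/forallP => [xe i|h].
  apply: le_trans xe; rewrite xE mx_normrE.
  exact: (le_bigmax _ (fun ij : 'I_d * 'I_1 => `|x ij.1 ij.2|) (i, ord0)).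
rewrite xE; have [->|/mx_norm_neq0[[i j] /= ->]] := eqVneq (mx_norm x) 0 => //.
by rewrite ord1.
Qed.

Lemma coord_le_norm x i : `|x i 0| <= `|x|.
Proof. by have := mx_norm_coord_le x (normr_ge0 x); rewrite lexx => /esym/forallP. Qed.

Definition lattice n : set 'cV[R]_d :=
  [set s | exists z : 'cV[int]_d, s = n%:R^-1 *: map_mx intr z].

Lemma lattice_diff n s x i : (0 < n)%N -> lattice n s -> lattice n x ->
  exists z : int, n%:R * (s - x) i 0 = z%:~R.
Proof.
move=> n0 [z ->] [y ->]; exists (z i 0 - y i 0); rewrite !mxE -mulrBr mulrA divff ?mul1r ?rmorphB//.
by rewrite pnatr_eq0 -lt0n.
Qed.

(** Membership in the integer box of radius [r] around [x] is recorded by the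
    shifted integer coordinates, which lie in ['I_(2 r + 1)]. *)
Let code n r x s : {ffun 'I_d -> 'I_(2 * r).+1} :=
  [ffun i => inord (absz (Num.floor (n%:R * (s - x) i 0 + r%:R)))].

Let codeP n r x s i : (0 < n)%N -> lattice n x -> lattice n s -> n%:R * `|s - x| <= r%:R ->
  ((code n r x s i : nat)%:R : R) = n%:R * (s - x) i 0 + r%:R.
Proof.
move=> n0 lx ls dsx.
have := lattice_diff i n0 ls lx => -[z zE].
have zr : `|z%:~R : R| <= r%:R.
  rewrite -zE normrM ger0_norm//; apply: le_trans dsx.
  by rewrite ler_pM2l ?ltr0n// coord_le_norm.
rewrite /code ffunE zE -[r%:R]/((Posz r)%:~R) -rmorphD/= intrKfloor.
move: zr; rewrite -[r%:R]/((Posz r)%:~R) ler_norml -rmorphN/= !ler_int => /andP[h1 h2].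
have h3 : Posz (absz (z + Posz r)) = z + Posz r by lia.
rewrite inordK; last by lia.
by rewrite -[LHS]/((Posz _)%:~R) h3.
Qed.

Let code_inj n r x s t : (0 < n)%N -> lattice n x ->
  lattice n s -> n%:R * `|s - x| <= r%:R -> lattice n t -> n%:R * `|t - x| <= r%:R ->
  code n r x s = code n r x t -> s = t.
Proof.
move=> n0 lx ls ds lt dt e; apply/colP => i.
have := codeP i n0 lx ls ds; rewrite e (codeP i n0 lx lt dt) => /addIr.
move=> /mulfI; rewrite pnatr_eq0 -lt0n => /(_ n0); rewrite !mxE => /addIr; exact: esym.
Qed.

Lemma lattice_ball_card n r x (S : {fset 'cV[R]_d}) : (0 < n)%N -> lattice n x ->
  (forall s, s \in S -> lattice n s /\ n%:R * `|s - x| <= r%:R) ->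
  (#|` S| <= (2 * r).+1 ^ d)%N.
Proof.
move=> n0 lx hS.
rewrite cardfE -[leqLHS](@card_codom _ _ (fun s : S => code n r x (val s))).
  by apply: leq_trans (max_card _) _; rewrite card_ffun !card_ord.
move=> [s ss] [t tt] /= e; apply: val_inj => /=.
have [? ?] := hS _ ss; have [? ?] := hS _ tt.
exact: (@code_inj n r x).
Qed.

Lemma lattice0 n : lattice n 0.
Proof. by exists 0; apply/colP => i; rewrite !mxE mulr0. Qed.

Lemma lattice_ball_finite n (r : nat) : (0 < n)%N ->
  finite_set [set s | lattice n s /\ n%:R * `|s| <= r%:R].
Proof.
move=> n0.
pose dec (u : {ffun 'I_d -> 'I_(2 * r).+1}) : 'cV[R]_d := \col_i (n%:R^-1 * ((u i : nat)%:R - r%:R)).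
apply: (@sub_finite_set _ _ (dec @` setT)); last exact/finite_image/finite_finset.
move=> s [ls ds]; exists (code n r 0 s) => //.
apply/colP => i; rewrite mxE codeP ?subr0//; last exact: lattice0.
by rewrite addrK mulrA mulVf ?mul1r// pnatr_eq0 -lt0n.
Qed.

Lemma bounded_set_le (Omega : set 'cV[R]_d) : bounded_set Omega ->
  exists D : nat, forall x, Omega x -> `|x| <= D%:R.
Proof.
move=> [D [_ hD]]; exists (Num.truncn D).+1 => x Ox.
by apply: hD => //; rewrite truncnS_gt.
Qed.

Lemma grid_finite (Omega : set 'cV[R]_d) n : bounded_set Omega -> (0 < n)%N ->
  finite_set (grid Omega n).
Proof.
move=> /bounded_set_le[D hD] n0.
apply: sub_finite_set (lattice_ball_finite (n * D) n0) => s [Os ls]; split => //.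
by rewrite natrM ler_pM2l ?ltr0n// hD.
Qed.

(** The domain contains a cube of side [e], which in turn contains about [(e n)^d]
    lattice points. *)
Lemma grid_card_ge (Omega : set 'cV[R]_d) : open Omega -> Omega !=set0 -> bounded_set Omega ->
  exists2 c : R, 0 < c & \forall n \near \oo,
    c * n%:R ^+ d <= (#|` fset_set (grid Omega n)|)%:R.
Proof.
move=> oO [x0 Ox0] bO.
have /nbhs_ballP[e /= e0 he] : nbhs x0 Omega by apply: open_nbhs_nbhs.
exists ((e / 4) ^+ d); first by rewrite exprn_gt0// divr_gt0.
near=> n.
have n0 : (0 < n)%N by near: n; exists 1%N.
have n0R : 0 < n%:R :> R by rewrite ltr0n.
have en : 4 <= e * n%:R.
  have : 4 / e <= n%:R by near: n; exact: nbhs_infty_ger.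
  by rewrite ler_pdivrMr// mulrC.
rewrite -exprMn.
pose k := Num.truncn (e * n%:R / 2).
have k1 : k%:R <= e * n%:R / 2 by rewrite truncn_le divr_ge0// mulr_ge0// ltW.
have k2 : e * n%:R / 2 < k.+1%:R by rewrite truncnS_gt.
have k3 : e / 4 * n%:R <= k%:R by rewrite -[k.+1%:R]natr1 in k2; lra.
apply: (@le_trans _ _ ((k ^ d)%:R)).
  by rewrite natrX lerXn2r// nnegrE// mulr_ge0// ltW// divr_gt0.
rewrite ler_nat.
pose f (u : {ffun 'I_d -> 'I_k}) : 'cV[R]_d :=
  \col_i (n%:R^-1 * (Num.floor (n%:R * x0 i 0) + 1 + (u i : nat)%:Z)%:~R).
have finj : injective f.
  move=> u v /colP uv; apply/ffunP => i; apply: val_inj => /=.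
  have := uv i; rewrite !mxE => /mulfI; rewrite invr_eq0 gt_eqF// => /(_ isT)/eqP.
  by rewrite eqr_int (inj_eq (addrI _)) => /eqP[].
rewrite (_ : (k ^ d)%N = #|{ffun 'I_d -> 'I_k}|); last by rewrite card_ffun !card_ord.
rewrite cardE -(size_map f).
apply: uniq_leq_size; first by rewrite map_inj_uniq// enum_uniq.
move=> _ /mapP[u _ ->]; rewrite -[_ \in _]/(_ \in fset_set _) in_fset_set; last exact: grid_finite.
rewrite inE; split; last first.
  exists (\col_i (Num.floor (n%:R * x0 i 0) + 1 + (u i : nat)%:Z)).
  by apply/colP => i; rewrite !mxE.
apply: he; split => // i j; rewrite ord1 /ball /= mxE.
have f1 := floor_le_tmp (n%:R * x0 i 0); have f2 := floorD1_gt (n%:R * x0 i 0).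
have u1 : (u i : nat)%:R + 1 <= k%:R :> R by rewrite natr1 ler_nat.
rewrite rmorphD/= -[((u i : nat)%:Z)%:~R]/((u i : nat)%:R).
rewrite -(ltr_pM2l n0R) -[X in X * `|_| < _](ger0_norm (ltW n0R)) -normrM mulrBr mulrA divff ?gt_eqF// mul1r.
have u0 : 0 <= (u i : nat)%:R :> R by [].
move: f1 f2; rewrite !rmorphD/= => f1 f2.
rewrite ler0_norm; lra.
Unshelve. all: by end_near.
Qed.

End lattice.

(** * Dyadic summation over the lattice *)

Section dyadic.
Variable R : realType.

(** The sum contains the term of the least [p] with [rho <= 2^p], which is within a
    factor [2^g] of the left-hand side. *)
Lemma dyadic_weight (g rho : R) K : 0 <= g -> rho <= 2 ^+ K ->
  Num.max 1 rho `^ (- g) <= 2 `^ g * \sum_(p < K.+1) (rho <= 2 ^+ p)%R%:R * (2 `^ (- g)) ^+ p.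
Proof.
move=> g0 rK.
have [p rp pmin] := ex_minnP (ex_intro (fun p => rho <= 2 ^+ p) K rK).
have pK : (p < K.+1)%N by rewrite ltnS pmin.
have t0 : 0 <= 2 `^ (- g) :> R by rewrite powR_ge0.
apply: (@le_trans _ _ (2 `^ g * (2 `^ (- g)) ^+ p)); last first.
  apply: ler_wpM2l; first by rewrite powR_ge0.
  by rewrite (bigD1 (Ordinal pK))//= rp mul1r lerDl sumr_ge0.
have g2 : 1 <= 2 `^ g :> R by rewrite -[leLHS](powRr0 (2:R)) ler_powR// ler1n.
case: p rp pmin pK => [|p] rp pmin _.
  by rewrite expr0 mulr1 max_l ?powR1.
have rp' : 2 ^+ p < rho.
  by rewrite ltNge; apply/negP => /pmin; rewrite ltnn.
have p2 : 0 < 2 ^+ p :> R by rewrite exprn_gt0.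
have -> : 2 `^ g * (2 `^ (- g)) ^+ p.+1 = (2 ^+ p) `^ (- g) :> R.
  rewrite exprS mulrA -powRD ?subrr ?powRr0 ?mul1r; last by rewrite pnatr_eq0 implybT.
  by rewrite -(powR_mulrn p t0) -(powR_mulrn p (ler0n R 2)) -!powRrM mulrC.
rewrite !powRN lef_pV2 ?posrE ?powR_gt0// ?lt_max ?ltr01//.
apply: ge0_ler_powR; rewrite ?nnegrE// ?le_max ?ler01//.
by rewrite (ltW rp') orbT.
Qed.

Lemma geometric_sum_lt1 (x : R) K : 0 <= x < 1 -> \sum_(p < K) x ^+ p <= (1 - x)^-1.
Proof.
move=> /andP[x0 x1]; have y0 : 0 < 1 - x by rewrite subr_gt0.
rewrite -(ler_pM2l y0) divff ?gt_eqF// -opprB mulNr -subrX1 opprB.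
by rewrite lerBlDr lerDl exprn_ge0.
Qed.

Lemma geometric_sum_gt1 (x : R) K : 1 < x -> \sum_(p < K.+1) x ^+ p <= x / (x - 1) * x ^+ K.
Proof.
move=> x1; have y0 : 0 < x - 1 by rewrite subr_gt0.
rewrite -(ler_pM2l y0) -subrX1 mulrA [_ * (x / _)]mulrCA divff ?gt_eqF// mulr1 -exprS.
by rewrite lerBlDr lerDl.
Qed.

End dyadic.

Section lattice_sum.
Variables (R : realType) (d : nat) (nu : R) (m D : nat).
Hypotheses (hnu : nu < m%:R) (D0 : (0 < D)%N).

Let g := 4 * (m%:R - nu).
Let x := 2 `^ (d%:R - g).

Let g_gt0 : 0 < g. Proof. by rewrite mulr_gt0// subr_gt0. Qed.
Let x_gt0 : 0 < x. Proof. by rewrite powR_gt0. Qed.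

Let xE : x = expR ((d%:R - g) * ln 2).
Proof. by rewrite /x /powR pnatr_eq0. Qed.

Let ln2_gt0 : 0 < ln 2 :> R. Proof. by rewrite ln_gt0// ltr1n. Qed.

Let rateE n : variance_rate d nu m n =
  if g < d%:R then n%:R `^ (- g) else if g == d%:R then n%:R ^- d * ln n%:R else n%:R ^- d.
Proof.
rewrite /variance_rate.
have -> : 4 * (nu - m%:R) = - g by rewrite /g; ring.
by rewrite ltrN2 eqr_opp.
Qed.

(** The dyadic shells up to scale [D n] contribute a geometric sum of ratio
    [2^(d - g)], whose three regimes are those of the rate. *)
Let dyadic_rate : exists2 C : R, 0 <= C & forall n, (1 < n)%N ->
  \sum_(p < (up_log 2 (D * n)).+1) x ^+ p <= C * (n%:R ^+ d * variance_rate d nu m n).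
Proof.
have pos n : (1 < n)%N -> 0 < n%:R :> R by move=> n1; rewrite ltr0n (ltn_trans _ n1).
have Dn n : (1 < n)%N -> (2 ^ up_log 2 (D * n))%:R <= (2 * D)%:R * n%:R :> R.
  move=> n1; rewrite -natrM ler_nat.
  have Dn1 : (1 < D * n)%N by rewrite (leq_trans n1)// leq_pmull.
  have := up_log_gtn (isT : 1 < 2)%N Dn1; have := up_log_gt0 2 (D * n); rewrite Dn1 /=.
  by case: (up_log 2 _) => // k _ /= kD; rewrite expnS -mulnA leq_mul2l/= ltnW.
have [gd|gd|gd] := ltgtP g d%:R.
- have x1 : 1 < x.
    by rewrite xE expR_gt1 mulr_gt0// subr_gt0.
  exists (x / (x - 1) * (2 * D)%:R `^ (d%:R - g)).
    by rewrite mulr_ge0 ?powR_ge0// divr_ge0 ?ltW// subr_gt0.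
  move=> n n1; rewrite rateE gd; apply: le_trans (geometric_sum_gt1 _ x1) _.
  rewrite -[leRHS]mulrA; apply: ler_wpM2l; first by rewrite divr_ge0 ?ltW// subr_gt0.
  have -> : n%:R ^+ d * n%:R `^ (- g) = n%:R `^ (d%:R - g) :> R.
    by rewrite -powR_mulrn ?ler0n// -powRD// (gt_eqF (pos _ n1)) implybT.
  rewrite -powRM ?ler0n// -(powR_mulrn _ (ltW x_gt0)) -powRrM mulrC powRrM powR_mulrn ?ler0n//.
  by rewrite -natrX; apply: ge0_ler_powR; rewrite ?nnegrE ?mulr_ge0 ?ler0n ?subr_ge0 ?(ltW gd)// Dn.
- have x1 : x < 1 by rewrite xE expR_lt1 pmulr_llt0// subr_lt0.
  exists (1 - x)^-1; first by rewrite invr_ge0 subr_ge0 ltW.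
  move=> n n1; rewrite rateE ltNge (ltW gd) gt_eqF//= divff ?mulr1.
    by apply: geometric_sum_lt1; rewrite x1 ltW.
  by rewrite expf_neq0// gt_eqF// pos.
- have lD : 0 <= ln (2 * D)%:R :> R by rewrite ln_ge0// ler1n muln_gt0.
  exists ((ln (2 * D)%:R / ln 2 + 1 + 1) / ln 2).
    by rewrite divr_ge0 ?(ltW ln2_gt0)// !addr_ge0// divr_ge0// ltW.
  move=> n n1; rewrite rateE gd ltxx eqxx [n%:R ^+ d * _]mulrA divff ?mul1r; last by rewrite expf_neq0// gt_eqF// pos.
  have -> : x = 1 by rewrite /x gd subrr powRr0.
  under eq_bigr do rewrite expr1n; rewrite sumr_const card_ord -[_ *+ _]mulr_natr mul1r.
  have := Dn _ n1; rewrite natrX -ler_ln ?posrE ?exprn_gt0 ?mulr_gt0 ?ltr0n ?muln_gt0 ?(ltnW n1)//.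
  rewrite lnXn// lnM ?posrE ?ltr0n ?muln_gt0 ?(ltnW n1)// -[_ *+ _]mulr_natr => K1.
  have ln2 : ln 2 <= ln n%:R :> R by rewrite ler_ln ?posrE ?pos// ler_nat.
  rewrite -natr1 mulrAC ler_pdivlMr//.
  have h1 : ln (2 * D)%:R <= ln (2 * D)%:R / ln 2 * ln n%:R :> R.
    by rewrite mulrAC ler_pdivlMr// ler_wpM2l.
  rewrite mulrC !mulrDl mul1r; lra.
Qed.

(** Exchange the sum with the dyadic one: at most [(3 * 2^p)^d] lattice points are
    within distance [2^p / n] of [x0]. *)
Lemma lattice_sum : exists2 C : R, 0 <= C & forall n (x0 : 'cV[R]_d) (S : {fset 'cV[R]_d}),
  (1 < n)%N -> lattice n x0 ->
  (forall s, s \in S -> lattice n s /\ `|s - x0| <= D%:R) ->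
  \sum_(s <- S) Num.max 1 (n%:R * `|s - x0|) `^ (4 * (nu - m%:R))
    <= C * (n%:R ^+ d * variance_rate d nu m n).
Proof.
have [C C0 hC] := dyadic_rate.
exists (2 `^ g * 3 ^+ d * C); first by rewrite !mulr_ge0 ?powR_ge0.
move=> n x0 S n1 lx0 hS.
have n0 : (0 < n)%N := ltnW n1.
pose K := up_log 2 (D * n).
have -> : 4 * (nu - m%:R) = - g by rewrite /g; ring.
apply: (@le_trans _ _ (\sum_(s <- S) 2 `^ g * \sum_(p < K.+1)
    (n%:R * `|s - x0| <= 2 ^+ p)%R%:R * (2 `^ (- g)) ^+ p)).
  rewrite big_seq [leRHS]big_seq; apply: ler_sum => s sS.
  apply: dyadic_weight; first exact: ltW.
  apply: (@le_trans _ _ (D * n)%:R); last by rewrite -natrX ler_nat up_logP.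
  by rewrite mulnC natrM ler_pM2l ?ltr0n//; have [] := hS _ sS.
rewrite -mulr_sumr -!mulrA; apply: ler_wpM2l; first by rewrite powR_ge0.
rewrite exchange_big/=.
apply: (@le_trans _ _ (\sum_(p < K.+1) 3 ^+ d * x ^+ p)); last first.
  by rewrite -mulr_sumr; apply: ler_wpM2l; [rewrite exprn_ge0|exact: hC].
apply: ler_sum => p _; rewrite -mulr_suml.
have -> : 3 ^+ d * x ^+ p = (3 * 2 ^+ p) ^+ d * (2 `^ (- g)) ^+ p.
  rewrite /x powRD; last by rewrite pnatr_eq0 implybT.
  by rewrite powR_mulrn// !exprMn mulrA -!exprM [(d * p)%N]mulnC.
apply: ler_wpM2r; first by rewrite exprn_ge0// powR_ge0.
rewrite -natrX -natrM -natrX -natr_sum ler_nat.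
rewrite (eq_bigr (fun s => if (n%:R * `|s - x0| <= (2 ^ p)%:R)%R then 1%N else 0%N)); last first.
  by move=> s _; case: (_ <= _).
rewrite -big_mkcond big_fset_condE/= -card_fset_sum1.
have := @lattice_ball_card R d n (2 ^ p) x0 [fset s in S | (n%:R * `|s - x0| <= (2 ^ p)%:R)%R]%fset n0 lx0.
move=> /(_ _)/leq_trans; apply.
  by move=> s; rewrite !inE/= => /andP[sS sp]; split => //; have [] := hS _ sS.
have [E|E] := posnP d; first by rewrite [in leqLHS]E [in leqRHS]E.
by rewrite leq_exp2r// -addn1 -[X in (_ <= X * _)%N]/(2 + 1)%N mulnDl mul1n leq_add2l expn_gt0.
Qed.
End lattice_sum.

(** * Almost sure convergence from moments *)

Section borel_cantelli_moments.
Variables (R : realType) (disp : measure_display) (T : measurableType disp).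
Variable P : probability T R.
Notation Ex f := (\int[P]_w (f w)).

Lemma telescoping_sum_le1 N : \sum_(k < N) (k.+1%:R * k.+2%:R)^-1 <= 1 :> R.
Proof.
suff -> : \sum_(k < N) (k.+1%:R * k.+2%:R)^-1 = 1 - N.+1%:R^-1 :> R.
  by rewrite lerBlDr lerDl invr_ge0.
elim: N => [|N IH]; first by rewrite big_ord0 invr1 subrr.
rewrite big_ord_recr IH /= -[N.+2%:R]natr1.
have h1 : N.+1%:R != 0 :> R by rewrite pnatr_eq0.
have h2 : N.+1%:R + 1 != 0 :> R by rewrite natr1 pnatr_eq0.
by move: (N.+1%:R : R) h1 h2 => x h1 h2; field; rewrite h1 h2.
Qed.

(** The sum of the [Z n ^+ p] is integrable, hence finite almost everywhere, and
    the terms of a convergent series tend to 0. *)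
Lemma ae_cvg0_of_summable_moments (Z : nat -> T -> R) (p : nat) (K : R) : (0 < p)%N -> ~~ odd p ->
  (forall n, has_moments P (Z n)) ->
  (\forall n \near \oo, \int[P]_w (Z n w ^+ p) <= K * (n%:R ^+ 2)^-1) ->
  {ae P, forall w, Z n w @[n --> \oo] --> 0}.
Proof.
move=> p0 pe hZ [N _ hN].
pose f k (w : T) := (Z (k + N.+2)%N w ^+ p)%:E.
have f0 k w : (0 <= f k w)%E by rewrite lee_fin real_exprn_even_ge0 ?num_real.
have If k : P.-integrable setT (f k).
  by have [_ /(_ p)] := hZ (k + N.+2)%N.
have mf k : measurable_fun setT (f k) by have /integrableP[] := If k.
have Ef k : (\int[P]_w f k w <= (K * (k.+1%:R * k.+2%:R)^-1)%:E)%E.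
  rewrite -[X in (X <= _)%E]fineK; last exact: integrable_fin_num.
  rewrite lee_fin; apply: (le_trans (hN (k + N.+2)%N _)).
    by rewrite /= !addnS -addSn leqW// leqW// leq_addl.
  have K0 : 0 <= K.
    have := hN N.+1; rewrite /= => /(_ (leqnSn _)) /le_trans h.
    have : 0 <= K * (N.+1%:R ^+ 2)^-1.
      apply: le_trans (hN N.+1 (leqnSn _)); apply: Rintegral_ge0 => w _.
      by rewrite real_exprn_even_ge0 ?num_real.
    by rewrite pmulr_lge0// invr_gt0 exprn_gt0.
  apply: ler_wpM2l => //; rewrite lef_pV2 ?posrE ?mulr_gt0 ?exprn_gt0 ?ltr0n ?addnS//.
  by rewrite -natrM -natrX ler_nat; nia.
pose S w := (\sum_(0 <= k <oo) f k w)%E.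
have ES : (\int[P]_w S w < +oo)%E.
  rewrite integral_nneseries//; apply: (@le_lt_trans _ _ `|K|%:E); last exact: ltry.
  apply: lime_le; first by apply: is_cvg_nneseries => k _ _; exact: integral_ge0.
  near=> n.
  apply: (@le_trans _ _ (\sum_(0 <= k < n) (K * (k.+1%:R * k.+2%:R)^-1)%:E)%E).
    by apply: lee_sum => k _; exact: Ef.
  rewrite sumEFin lee_fin -mulr_sumr big_mkord.
  apply: (@le_trans _ _ (`|K| * \sum_(k < n) (k.+1%:R * k.+2%:R)^-1)).
    by apply: ler_wpM2r; [exact: sumr_ge0|exact: ler_norm].
  by rewrite -[leRHS]mulr1; apply: ler_wpM2l => //; exact: telescoping_sum_le1.
have S0 w : (0 <= S w)%E by apply: nneseries_ge0.
have mS : measurable_fun setT S by apply: ge0_emeasurable_sum.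
have IS : P.-integrable setT S.
  by apply/integrableP; split => //; under eq_integral => w _ do rewrite gee0_abs//.
have [A [mA A0 hA]] := integrable_ae measurableT IS.
exists A; split => //; apply: subset_trans hA; apply: subsetC => w /= /(_ I) Sw.
have Slt : (S w < +oo)%E by rewrite ltey_eq Sw.
have tail := nneseries_tail_cvg Slt (fun k _ => f0 k w).
apply/cvgrPdist_lt => e e0.
have ep0 : 0 < e ^+ p by rewrite exprn_gt0.
have [[M1 _ h1] /cvgrPdist_lt/(_ _ ep0)[M2 _ h2]] := (fine_cvgP _ _).1 tail.
exists (M1 + M2 + N.+2)%N => // n /= Mn.
have k1 : (M1 <= n - N.+2)%N by lia.
have k2 : (M2 <= n - N.+2)%N by lia.
have := h1 _ k1; have := h2 _ k2 => /=.
set s := (\sum_(_ <= _ <oo) _)%E => sd sf.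
have fs : (f (n - N.+2)%N w <= s)%E.
  rewrite /s (nneseries_split (n - N.+2)%N 1)//; rewrite addn1 big_nat1 leeDl//.
  exact: nneseries_ge0.
have s0 : (0 <= s)%E := le_trans (f0 _ _) fs.
have nN : (n - N.+2 + N.+2)%N = n by rewrite subnK// (leq_trans _ Mn)// leq_addl.
move: fs; rewrite /f nN -(fineK sf) lee_fin => fs.
rewrite sub0r normrN in sd; rewrite sub0r normrN.
rewrite -(ltr_pXn2r p0) ?nnegrE ?(ltW e0)//.
rewrite -normrX ger0_norm ?real_exprn_even_ge0 ?num_real//.
by apply: le_lt_trans fs _; apply: le_lt_trans sd; exact: ler_norm.
Unshelve. all: by end_near.
Qed.
End borel_cantelli_moments.

(** * Increments of the field *)

Section gaussian_field_span.
Variables (R : realType) (disp : measure_display) (T : measurableType disp).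
Variables (P : probability T R) (d : nat).
Variable Y : 'cV[R]_d -> {RV P >-> R}.
Hypothesis gY : gaussian_field Y.
Hypothesis Y0 : forall s, ('E_P[Y s] = 0)%E.
Notation Ex f := (\int[P]_w (f w)).
Notation hm := (has_moments P).

Definition field_span (f : T -> R) :=
  exists l : seq ('cV[R]_d * R), f = fun w => \sum_(p <- l) p.2 * Y p.1 w.

Lemma hm_field s : hm (Y s).
Proof.
have := gY (fun _ : 'I_1 => s) (fun=> 1).
under eq_fun do rewrite big_ord1 mul1r.
move=> /(@gaussian_moments _ _ _ P (Y s)) []//.
by have := Y0 s; rewrite unlock /Rintegral => ->.
Qed.

Lemma Ex_field s : Ex (Y s) = 0.
Proof. by have := Y0 s; rewrite unlock /Rintegral => ->. Qed.

Lemma field_span_field s : field_span (Y s).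
Proof. by exists [:: (s, 1)]; apply/funext => w; rewrite big_seq1 mul1r. Qed.

Lemma field_span_gaussian : gaussian_space P field_span.
Proof.
split.
- move=> _ _ [l1 ->] [l2 ->]; exists (l1 ++ l2).
  by apply/funext => w; rewrite big_cat.
- move=> c _ [l ->]; exists [seq (p.1, c * p.2) | p <- l].
  by apply/funext => w; rewrite big_map mulr_sumr; apply: eq_bigr => p _; rewrite mulrA.
- move=> _ [l ->].
  have hl p : hm (fun w => p.2 * Y p.1 w) by apply: hmZ; exact: hm_field.
  have hs := hm_sum l hl.
  have E0 : \int[P]_w (\sum_(p <- l) p.2 * Y p.1 w) = 0.
    rewrite Ex_sum//; apply: big1 => p _.
    by rewrite ExZ ?Ex_field ?mulr0//; exact: hm_field.
  suff law : gaussian_law P (fun w => \sum_(p <- l) p.2 * Y p.1 w).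
    by have [_ rec] := gaussian_moments hs.1 law E0.
  have := gY (fun i : 'I_(size l) => (tnth (in_tuple l) i).1) (fun i => (tnth (in_tuple l) i).2).
  congr gaussian_law; apply/funext => w.
  by rewrite [RHS]big_tnth.
Qed.

Lemma field_span_sum (I : Type) (r : seq I) (F : I -> T -> R) :
  (forall i, field_span (F i)) -> field_span (fun w => \sum_(i <- r) F i w).
Proof.
have [hD hZ _] := field_span_gaussian.
move=> hF; elim: r => [|i r IH].
  by exists [::]; apply/funext => w; rewrite !big_nil.
by under eq_fun do rewrite big_cons; exact: hD.
Qed.

End gaussian_field_span.

Section increments.
Variables (R : realType) (disp : measure_display) (T : measurableType disp).
Variables (P : probability T R) (d : nat) (sigma alpha nu : R) (M : 'M[R]_d).
Variable Y : 'cV[R]_d -> {RV P >-> R}.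
Hypothesis hY : matern_field sigma alpha nu M Y.
Notation Ex f := (\int[P]_w (f w)).

Lemma matern_cov s t : \int[P]_w (Y s w * Y t w) = matern sigma alpha nu (enorm (M *m s - M *m t)).
Proof.
have [_ Y0 /(_ s t)] := hY.
rewrite covariance.unlock !Y0 /= /Rintegral => E.
rewrite (_ : (\int[P]_w (Y s w * Y t w)%:E)%E = (matern sigma alpha nu (enorm (M *m s - M *m t)))%:E)//.
rewrite -E [in RHS]unlock; apply: eq_integral => w _.
by rewrite -{1}(subr0 (Y s w)) -{1}(subr0 (Y t w)).
Qed.

Definition dotp (x y : 'cV[R]_d) := \sum_(i < d) x i 0 * y i 0.

Lemma enorm_addZ (z g : 'cV[R]_d) (t : R) :
  enorm (z + t *: g) = Num.sqrt (dotp z z + 2 * dotp z g * t + dotp g g * t ^+ 2).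
Proof.
rewrite /enorm /dotp; congr Num.sqrt.
rewrite mulr_sumr !mulr_suml -!big_split/=; apply: eq_bigr => i _.
by rewrite !mxE; ring.
Qed.

Lemma dotp_ge0 x : 0 <= dotp x x.
Proof. by apply: sumr_ge0 => i _; rewrite -expr2 sqr_ge0. Qed.

Lemma enormE x : enorm x = Num.sqrt (dotp x x).
Proof. by rewrite /enorm /dotp; congr Num.sqrt; apply: eq_bigr => i _; rewrite expr2. Qed.

Lemma dotpZ a x : dotp (a *: x) (a *: x) = a ^+ 2 * dotp x x.
Proof. by rewrite /dotp mulr_sumr; apply: eq_bigr => i _; rewrite !mxE; ring. Qed.

Lemma dotp_cauchy_schwarz x y : dotp x y ^+ 2 <= dotp x x * dotp y y.
Proof.
have := cauchy_schwarz_seq (index_enum 'I_d) (fun i => x i 0) (fun i => y i 0).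
have dE z : dotp z z = \sum_(i < d) z i 0 ^+ 2 by apply: eq_bigr => i _; rewrite expr2.
by rewrite !dE.
Qed.

Definition incr_var m (h : 'cV[R]_d) j (w : T) : R :=
  iter m (increment h) (fun s => Y s w) j.

Lemma incr_varE m h j w :
  incr_var m h j w = \sum_(i < m.+1) (-1) ^+ (m + i) * 'C(m, i)%:R * Y (j + h *+ i) w.
Proof. exact: iter_fdiff. Qed.

Lemma incr_var_span m h j : field_span Y (incr_var m h j).
Proof.
have [gY Y0 _] := hY; have [hD hZ _] := field_span_gaussian gY Y0.
rewrite (_ : incr_var m h j = fun w => \sum_(i < m.+1) (-1) ^+ (m + i) * 'C(m, i)%:R * Y (j + h *+ i) w).
  by apply: field_span_sum => // i; apply: hZ; exact: field_span_field.
by apply/funext => w; exact: incr_varE.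
Qed.

Lemma incr_var_cov m h j k :
  \int[P]_w (incr_var m h j w * incr_var m h k w) =
  \sum_(i < m.+1) \sum_(i' < m.+1) diffw R m i i' *
    matern sigma alpha nu (Num.sqrt (dotp (M *m (j - k)) (M *m (j - k))
      + 2 * dotp (M *m (j - k)) (M *m h) * (i%:R - i'%:R) + dotp (M *m h) (M *m h) * (i%:R - i'%:R) ^+ 2)).
Proof.
have [gY Y0 _] := hY.
have hmY s : has_moments P (Y s) by exact: hm_field.
under eq_Rintegral do rewrite !incr_varE mulr_suml.
rewrite Ex_sum; last first.
  move=> i; apply: hmM; first exact: hmZ.
  by apply: hm_sum => i'; exact: hmZ.
apply: eq_bigr => i _; under eq_Rintegral do rewrite mulr_sumr.
rewrite Ex_sum; last by move=> i'; apply: hmM; exact: hmZ.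
apply: eq_bigr => i' _.
rewrite -enorm_addZ.
have -> : M *m (j - k) + (i%:R - i'%:R) *: (M *m h) = M *m (j + h *+ i) - M *m (k + h *+ i').
  rewrite -mulmxBr scalemxAr -mulmxDr; congr (_ *m _).
  by rewrite scalerBl !scaler_nat opprD addrACA.
rewrite -matern_cov -ExZ; last exact: hmM.
apply: eq_Rintegral => w _; rewrite /diffw.
have -> : (-1) ^+ (i + i') = (-1) ^+ (m + i) * (-1) ^+ (m + i') :> R.
  by rewrite -exprD -signr_odd [in RHS]addnACA addnn -muln2 mulnC exprD exprM sqrrN expr1n expr1n mul1r signr_odd.
by ring.
Qed.

End increments.

(** * Decay of the covariance of increments *)

Section covariance_decay.
Variables (R : realType) (disp : measure_display) (T : measurableType disp).
Variables (P : probability T R) (d : nat) (sigma alpha nu : R).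
Hypotheses (halpha : 0 < alpha) (hnu : 0 < nu).
Variable M : 'M[R]_d.
Hypothesis hM : \det M = 1.
Variable Y : 'cV[R]_d -> {RV P >-> R}.
Hypothesis hY : matern_field sigma alpha nu M Y.
Variable h : 'cV[R]_d.
Hypothesis hh : h != 0.
Variable m : nat.
Hypothesis hnum : nu < m%:R.
Notation Ex f := (\int[P]_w (f w)).

Lemma coord_sqr_le_dotp (x : 'cV[R]_d) i : x i 0 ^+ 2 <= dotp x x.
Proof.
rewrite /dotp (bigD1 i)//= -expr2 lerDl; apply: sumr_ge0 => j _.
by rewrite -expr2 sqr_ge0.
Qed.

(** [M] is invertible; [k] is the inverse of a bound for the norm of its inverse. *)
Lemma mulmx_norm_ge : exists2 k : R, 0 < k & forall z : 'cV[R]_d,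
  (k * `|z|) ^+ 2 <= dotp (M *m z) (M *m z).
Proof.
pose N := invmx M.
pose B := 1 + \sum_(i < d) \sum_(j < d) `|N i j|.
have B0 : 0 < B by rewrite ltr_wpDr// sumr_ge0// => i _; exact: sumr_ge0.
exists B^-1; first by rewrite invr_gt0.
move=> z; set y := M *m z.
have zE : z = N *m y by rewrite mulKmx// unitmxE hM unitr1.
have s0 := sqrtr_ge0 (dotp y y).
rewrite -[leRHS](sqr_sqrtr (dotp_ge0 y)) lerXn2r ?nnegrE ?mulr_ge0 ?invr_ge0 ?(ltW B0)//.
rewrite mulrC ler_pdivrMr// mx_norm_coord_le ?mulr_ge0 ?(ltW B0)//.
apply/forallP => i; rewrite {1}zE mxE.
apply: (le_trans (ler_norm_sum _ _ _)).
apply: (@le_trans _ _ (\sum_(j < d) `|N i j| * Num.sqrt (dotp y y))).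
  apply: ler_sum => j _; rewrite normrM; apply: ler_wpM2l => //.
  by apply: ler_norm_of_sqr => //; rewrite sqr_sqrtr ?dotp_ge0// coord_sqr_le_dotp.
rewrite -mulr_suml mulrC; apply: ler_wpM2l => //.
rewrite /B [X in _ <= 1 + X](bigD1 i)//= addrCA lerDl addr_ge0// sumr_ge0// => j _.
exact: sumr_ge0.
Qed.

Let G := dotp (M *m h) (M *m h).

Lemma dotp_Mh_gt0 : 0 < G.
Proof.
have [k k0 hk] := mulmx_norm_ge.
by apply: lt_le_trans (hk h); rewrite exprn_gt0// mulr_gt0// normr_gt0.
Qed.

Definition incr_cov n j k := \int[P]_w (incr_var Y m (n%:R^-1 *: h) j w * incr_var Y m (n%:R^-1 *: h) k w).

Lemma incr_cov_diag n j : incr_cov n j j = \sum_(i < m.+1) \sum_(i' < m.+1) diffw R m i i' *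
    matern sigma alpha nu (Num.sqrt (G / n%:R ^+ 2 * (i%:R - i'%:R) ^+ 2)).
Proof.
rewrite /incr_cov (incr_var_cov hY); apply: eq_bigr => i _; apply: eq_bigr => i' _.
rewrite subrr mulmx0.
have d0 x : dotp (0 : 'cV[R]_d) x = 0 by apply: big1 => l _; rewrite mxE mul0r.
by rewrite !d0 -scalemxAr dotpZ mulr0 mul0r !add0r exprVn -/G [_^-1 * _]mulrC.
Qed.

Lemma incr_var_scaled_cvg j : n%:R `^ (2 * nu) * incr_cov n j j @[n --> \oo] -->
  quad_var_limit sigma alpha nu M h m.
Proof.
under eq_cvg do rewrite incr_cov_diag.
rewrite /quad_var_limit enormE -/G.
have := @matern_diff2_cvg R m nu hnu hnum sigma alpha G halpha dotp_Mh_gt0.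
by apply.
Qed.

Lemma incr_var_hm n j : has_moments P (incr_var Y m (n%:R^-1 *: h) j).
Proof.
have [gY Y0 _] := hY; have [_ _ /(_ _ (incr_var_span hY m (n%:R^-1 *: h) j))[]//] :=
  field_span_gaussian gY Y0.
Qed.

(** All increments have the same variance; expand the variances of the sum and of
    the difference of two of them. *)
Lemma incr_cov_le_diag n j k : `|incr_cov n j k| <= incr_cov n 0 0.
Proof.
have E l : incr_cov n l l = incr_cov n 0 0 by rewrite !incr_cov_diag.
pose f := incr_var Y m (n%:R^-1 *: h) j; pose g := incr_var Y m (n%:R^-1 *: h) k.
have hf : has_moments P f := incr_var_hm n j.
have hg : has_moments P g := incr_var_hm n k.
have p c : 0 <= \int[P]_w ((f w + c * g w) * (f w + c * g w)).
  by apply: Rintegral_ge0 => w _; rewrite -expr2 sqr_ge0.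
have pE c : \int[P]_w ((f w + c * g w) * (f w + c * g w)) =
    incr_cov n 0 0 + 2 * c * incr_cov n j k + c ^+ 2 * incr_cov n 0 0.
  rewrite -{1}(E j) -(E k) /incr_cov -/f -/g.
  rewrite -!ExZ//; try exact: hmM.
  rewrite -!ExD//; do ?[apply: hmD|apply: hmZ|apply: hmM] => //.
  by apply: eq_Rintegral => w _; ring.
have := p 1; have := p (-1); rewrite !pE sqrrN expr1n => h1 h2.
by rewrite ler_norml; apply/andP; split; lra.
Qed.

(** At distance at least [r0 / n] this is the derivative-type bound for the
    covariance; the powers of [n] cancel. At smaller distance the covariance is at
    most the variance, which is bounded after scaling because it converges. *)
Lemma incr_cov_decay : exists2 C : R, 0 <= C & \forall n \near \oo, forall j k,
  `|n%:R `^ (2 * nu) * incr_cov n j k| <= C * Num.max 1 (n%:R * `|j - k|) `^ (2 * (nu - m%:R)).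
Proof.
have [k0 k00 hk] := mulmx_norm_ge.
have nu_bounds : 0 < nu < m%:R by rewrite hnu.
have [C C0 hC] := matern_diff2_bound sigma halpha nu_bounds.
have G0 := dotp_Mh_gt0.
pose r0 := Num.max 1 (2 * m%:R * Num.sqrt G / k0).
have r01 : 1 <= r0 by rewrite le_max lexx.
pose e := 2 * (m%:R - nu).
have e0 : 0 <= e by rewrite mulr_ge0// subr_ge0 ltW.
have eE : 2 * (nu - m%:R) = - e by rewrite /e; ring.
pose tau := `|quad_var_limit sigma alpha nu M h m| + 1.
have tau0 : 0 <= tau by rewrite addr_ge0.
pose C' := C * G ^+ m * k0 `^ (- e) + tau * r0 `^ e.
have C'0 : 0 <= C' by rewrite addr_ge0// mulr_ge0 ?powR_ge0// mulr_ge0// exprn_ge0// ltW.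
exists C' => //.
have near1 : \forall n \near \oo, n%:R `^ (2 * nu) * incr_cov n 0 0 <= tau.
  have /cvgrPdist_lt/(_ _ ltr01) := incr_var_scaled_cvg 0.
  apply: filterS => n; rewrite distrC => hn.
  have := ler_norm (quad_var_limit sigma alpha nu M h m).
  by move: (ler_norm (n%:R `^ (2 * nu) * incr_cov n 0 0 - quad_var_limit sigma alpha nu M h m)) hn; rewrite /tau; lra.
near=> n => i j.
have n0 : 0 < n%:R :> R by rewrite ltr0n; near: n; exists 1%N.
rewrite eE.
pose z := i - j; set rho := n%:R * `|i - j|.
have m0 : 0 < Num.max 1 rho by rewrite lt_max ltr01.
have [far|near] := leP r0 rho.
  have rho1 : 1 <= rho by apply: le_trans far.
  rewrite (max_r rho1).
  have rho0 : 0 < rho by exact: lt_le_trans rho1.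
  pose A := dotp (M *m z) (M *m z).
  have Ale : (k0 * rho / n%:R) ^+ 2 <= A.
    apply: le_trans (hk z); rewrite /rho -/z [n%:R * _]mulrC !mulrA mulfK ?gt_eqF//.
  have kr0 : 0 < k0 * rho / n%:R by rewrite divr_gt0// mulr_gt0.
  have A0 : 0 < A by apply: lt_le_trans Ale; rewrite exprn_gt0.
  rewrite normrM (ger0_norm (powR_ge0 _ _)).
  have main : `|incr_cov n i j| <= C * (G / n%:R ^+ 2) ^+ m * A `^ (nu - m%:R).
    rewrite /incr_cov (incr_var_cov hY) -/z.
    have -> : dotp (M *m (n%:R^-1 *: h)) (M *m (n%:R^-1 *: h)) = G / n%:R ^+ 2.
      by rewrite -scalemxAr dotpZ exprVn mulrC.
    apply: hC.
    - by rewrite divr_gt0// exprn_gt0.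
    - have := dotp_cauchy_schwarz (M *m z) (M *m (n%:R^-1 *: h)).
      by rewrite -[in X in _ <= _ * X -> _]scalemxAr [in X in _ <= _ * X -> _]dotpZ exprVn [_^-1 * _]mulrC.
    - apply: le_trans Ale.
      rewrite expr_div_n mulrA ler_pM2r ?invr_gt0 ?exprn_gt0//.
      have -> : 4 * m%:R ^+ 2 * G = (2 * m%:R * Num.sqrt G) ^+ 2.
        by rewrite exprMn sqr_sqrtr ?(ltW G0)// exprMn; ring.
      rewrite lerXn2r ?nnegrE ?mulr_ge0 ?sqrtr_ge0 ?(ltW k00) ?(ltW rho0)//.
      rewrite -(ler_pdivrMl _ _ k00) [k0^-1 * _]mulrC; apply: le_trans far.
      by rewrite le_max lexx orbT.
  have step : A `^ (nu - m%:R) <= k0 `^ (- e) * rho `^ (- e) * n%:R `^ e.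
    have -> : k0 `^ (- e) * rho `^ (- e) * n%:R `^ e = ((k0 * rho / n%:R) ^+ 2) `^ (nu - m%:R).
      rewrite -(powR_mulrn 2 (ltW kr0)) -powRrM eE.
      have ni0 : 0 <= n%:R^-1 :> R by rewrite invr_ge0 ltW.
      rewrite (powRM _ (mulr_ge0 (ltW k00) (ltW rho0)) ni0) (powRM _ (ltW k00) (ltW rho0)).
      by rewrite -(powR_inv1 (ltW n0)) -powRrM mulN1r opprK.
    have -> : nu - m%:R = - (m%:R - nu) by rewrite opprB.
    rewrite !powRN lef_pV2 ?posrE ?powR_gt0// ?exprn_gt0//.
    by apply: ge0_ler_powR; rewrite ?nnegrE ?(ltW A0) ?sqr_ge0// subr_ge0 ltW.
  apply: (@le_trans _ _ (n%:R `^ (2 * nu) * (C * (G / n%:R ^+ 2) ^+ m * (k0 `^ (- e) * rho `^ (- e) * n%:R `^ e)))).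
    apply: ler_wpM2l; first exact: powR_ge0.
    apply: (le_trans main); apply: ler_wpM2l => //.
    by rewrite mulr_ge0// exprn_ge0// divr_ge0 ?(ltW G0)// exprn_ge0// ltW.
  have -> : n%:R `^ (2 * nu) * (C * (G / n%:R ^+ 2) ^+ m * (k0 `^ (- e) * rho `^ (- e) * n%:R `^ e))
     = C * G ^+ m * k0 `^ (- e) * rho `^ (- e).
    have -> : n%:R `^ e = (n%:R ^+ 2) ^+ m / n%:R `^ (2 * nu).
      rewrite -exprM -(powR_mulrn _ (ltW n0)) natrM -powRB /e; last by rewrite (gt_eqF n0) implybT.
      by congr (_ `^ _); ring.
    have a0 : (n%:R ^+ 2) ^+ m != 0 :> R by rewrite gt_eqF ?exprn_gt0.
    have b0 : n%:R `^ (2 * nu) != 0 :> R by rewrite gt_eqF ?powR_gt0.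
    rewrite expr_div_n; move: (_ `^ (2 * nu)) ((n%:R ^+ 2) ^+ m) a0 b0 => b a a0 b0.
    by field; rewrite a0 b0.
  by apply: ler_wpM2r; rewrite ?powR_ge0// /C' lerDl mulr_ge0// powR_ge0.
apply: (@le_trans _ _ tau).
  rewrite normrM (ger0_norm (powR_ge0 _ _)).
  apply: (@le_trans _ _ (n%:R `^ (2 * nu) * incr_cov n 0 0)); last by near: n.
  by apply: ler_wpM2l; [exact: powR_ge0|exact: incr_cov_le_diag].
have h1 : 1 <= r0 `^ e * Num.max 1 rho `^ (- e).
  rewrite powRN ler_pdivlMr ?powR_gt0// mul1r.
  have r00 : 0 <= r0 := le_trans ler01 r01.
  apply: ge0_ler_powR => //; first by rewrite nnegrE ltW.
  by rewrite ge_max r01 ltW.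
apply: (@le_trans _ _ (tau * (r0 `^ e * Num.max 1 rho `^ (- e)))).
  by rewrite ler_peMr.
rewrite mulrA; apply: ler_wpM2r; first exact: powR_ge0.
by rewrite lerDr !mulr_ge0 ?powR_ge0// exprn_ge0// ltW.
Unshelve. all: by end_near.
Qed.

End covariance_decay.

(** * The quadratic variation *)

Section variance_rate_power.
Variable R : realType.

(** Crude but uniform in the three regimes: since [d >= 1], the exponent [1/2] leaves
    room for the logarithm. *)
Lemma variance_rate_le_powR (d : nat) (nu : R) m : (0 < d)%N -> nu < m%:R ->
  exists2 e : R, 0 < e & forall n, (0 < n)%N -> variance_rate d nu m n <= 2 * n%:R `^ (- e).
Proof.
move=> d0 hnu; set g := 4 * (m%:R - nu).
have g0 : 0 < g by rewrite mulr_gt0// subr_gt0.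
exists (Num.min g 2^-1); first by rewrite lt_min g0 invr_gt0 ltr0n.
move=> n n0; set e := Num.min g 2^-1.
have n1 : 1 <= n%:R :> R by rewrite ler1n.
have n0R : 0 < n%:R :> R by rewrite ltr0n.
have p0 a : 0 <= n%:R `^ a :> R by exact: powR_ge0.
have eg : e <= g by rewrite ge_min lexx.
have eh : e <= 2^-1 by rewrite ge_min lexx orbT.
have half : 2^-1 <= 1 :> R by lra.
have dR : 1 <= d%:R :> R by rewrite ler1n.
have nd : n%:R ^- d = n%:R `^ (- d%:R) :> R by rewrite powRN powR_mulrn// ltW.
have dbl a : a <= - e -> n%:R `^ a <= 2 * n%:R `^ (- e).
  move=> ae; apply: (@le_trans _ _ (n%:R `^ (- e))); first exact: ler_powR.
  by rewrite mulr_natl mulr2n lerDl.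
rewrite /variance_rate; case: ifP => _.
  apply: dbl; rewrite (_ : 4 * (nu - m%:R) = - g) ?lerN2//.
  by rewrite /g; ring.
case: ifP => _; last by rewrite nd; apply: dbl; rewrite lerN2; lra.
(* [ln n] is twice [ln (sqrt n)], hence at most [2 sqrt n] *)
have lnn : ln n%:R <= 2 * n%:R `^ 2^-1 :> R.
  have := ln_sublinear (powR_gt0 2^-1 n0R); rewrite ln_powR => /ltW h.
  by rewrite -[leLHS](mulKf (_ : 2^-1 != 0)) ?invr_eq0 ?pnatr_eq0// invrK; apply: ler_wpM2l.
rewrite nd; apply: (@le_trans _ _ (n%:R `^ (- d%:R) * (2 * n%:R `^ 2^-1))).
  by apply: ler_wpM2l.
rewrite mulrCA -powRD; last by rewrite (gt_eqF n0R) implybT.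
by apply: ler_wpM2l => //; apply: ler_powR => //; lra.
Qed.

Lemma near_powR_ge (A s : R) : 0 < s -> \forall n \near \oo, A <= n%:R `^ s.
Proof.
move=> s0; have [A0|A0] := leP A 0.
  by near=> n; apply: le_trans A0 _; exact: powR_ge0.
near=> n.
have : A `^ s^-1 <= n%:R by near: n; exact: nbhs_infty_ger.
move=> /(ge0_ler_powR (ltW s0)); rewrite !nnegrE powR_ge0 ler0n => /(_ isT isT).
by rewrite -powRrM mulVf ?gt_eqF// powRr1// ltW.
Unshelve. all: by end_near.
Qed.

End variance_rate_power.

Section quadratic_variation.
Variables (R : realType) (disp : measure_display) (T : measurableType disp).
Variables (P : probability T R) (d : nat) (sigma alpha nu : R).
Hypotheses (hd : (0 < d)%N) (halpha : 0 < alpha) (hnu : 0 < nu).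
Variable M : 'M[R]_d.
Hypothesis hM : \det M = 1.
Variable Y : 'cV[R]_d -> {RV P >-> R}.
Hypothesis hY : matern_field sigma alpha nu M Y.
Variable Omega : set 'cV[R]_d.
Hypotheses (hO0 : Omega !=set0) (hOb : bounded_set Omega) (hOo : open Omega).
Variable h : 'cV[R]_d.
Hypothesis hh : h != 0.
Variable m : nat.
Hypothesis hnum : nu < m%:R.

Let S n := fset_set (grid Omega n).
Let N n := #|` S n|.

(** The increments, normalized so that their sum of squares is the quadratic
    variation. *)
Let X n j (w : T) : R := n%:R `^ nu / Num.sqrt (N n)%:R * incr_var Y m (n%:R^-1 *: h) j w.

Let spanX n j : field_span Y (X n j).
Proof.
have [gY Y0 _] := hY; have [_ hZ _] := field_span_gaussian gY Y0.
by apply: hZ; exact: (incr_var_span hY).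
Qed.

Let gH : gaussian_space P (field_span Y).
Proof. by have [gY Y0 _] := hY; exact: field_span_gaussian. Qed.

Let scale_sqr n : (n%:R `^ nu / Num.sqrt (N n)%:R) ^+ 2 = n%:R `^ (2 * nu) / (N n)%:R :> R.
Proof.
by rewrite expr_div_n sqr_sqrtr// -(powR_mulrn 2 (powR_ge0 _ _)) -powRrM [nu * _]mulrC.
Qed.

Let quad_varE n : quad_var nu Omega h m Y n = sumsq (S n) (X n).
Proof.
apply/funext => w; rewrite /quad_var /sumsq mulr_sumr; apply: eq_bigr => j _.
by rewrite /X exprMn scale_sqr mulrA [_^-1 * _]mulrC.
Qed.

Let covX n j k : cov_fun P (X n) j k = n%:R `^ (2 * nu) * incr_cov Y h m n j k / (N n)%:R.
Proof.
rewrite /cov_fun /incr_cov mulrAC -scale_sqr -ExZ.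
  by apply: eq_Rintegral => w _; rewrite /X; ring.
by apply: hmM; exact: (incr_var_hm hY).
Qed.

Let trace_covX n : (0 < N n)%N -> trace_cov P (S n) (X n) = n%:R `^ (2 * nu) * incr_cov Y h m n 0 0.
Proof.
move=> N0; rewrite /trace_cov.
under eq_bigr do rewrite covX (incr_cov_diag hY) -(incr_cov_diag hY _ _ _ 0).
rewrite big_const_seq count_predT iter_addr_0 -[_ *+ size _]mulr_natr -[size _]/(N n) divfK//.
by rewrite pnatr_eq0 -lt0n.
Qed.

Let card_gt0 : \forall n \near \oo, (0 < N n)%N.
Proof.
have [c c0 hc] := grid_card_ge hOo hO0 hOb.
near=> n; have n0 : (0 < n)%N by near: n; exists 1%N.
rewrite -(ltr0n R); apply: (@lt_le_trans _ _ (c * n%:R ^+ d)).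
  by rewrite mulr_gt0// exprn_gt0// ltr0n.
by near: n.
Unshelve. all: by end_near.
Qed.

Let trace_cvg : trace_cov P (S n) (X n) @[n --> \oo] --> quad_var_limit sigma alpha nu M h m.
Proof.
apply: cvg_trans (incr_var_scaled_cvg halpha hnu hM hY hh hnum 0).
by apply: near_eq_cvg; apply: filterS card_gt0 => n N0; rewrite trace_covX.
Qed.

(** Each row of the covariance matrix is a lattice sum, and the number of rows is at
    least a multiple of [n^d]. *)
Let frobenius_rate : exists2 C : R, 0 < C & \forall n \near \oo,
  frobenius_cov P (S n) (X n) <= C * variance_rate d nu m n.
Proof.
have [C C0 hC] := incr_cov_decay halpha hnu hM hY hh hnum.
have [c c0 hc] := grid_card_ge hOo hO0 hOb.
have [D hD] := bounded_set_le hOb.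
have [L L0 hL] := lattice_sum d hnum (isT : 0 < (2 * D).+1)%N.
exists (C ^+ 2 * L / c + 1); first by rewrite ltr_wpDl// divr_ge0 ?(ltW c0)// mulr_ge0// sqr_ge0.
near=> n.
have n1 : (1 < n)%N by near: n; exists 2%N.
have n0 : (0 < n)%N := ltnW n1.
have n0R : 0 < n%:R :> R by rewrite ltr0n.
have N0 : (0 < N n)%N by near: n.
have N0R : 0 < (N n)%:R :> R by rewrite ltr0n.
have rate0 : 0 <= variance_rate d nu m n.
  rewrite /variance_rate; case: ifP => _; first exact: powR_ge0.
  by case: ifP => _; rewrite ?mulr_ge0// ?invr_ge0 ?exprn_ge0// ln_ge0// ler1n.
have hCn j k : `|n%:R `^ (2 * nu) * incr_cov Y h m n j k| <=
    C * Num.max 1 (n%:R * `|j - k|) `^ (2 * (nu - m%:R)).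
  by move: j k; near: n.
have inS s : s \in S n -> Omega s /\ lattice n s.
  by rewrite in_fset_set; [rewrite inE|exact: grid_finite].
have row j : j \in S n -> \sum_(k <- S n) cov_fun P (X n) j k ^+ 2 <=
    C ^+ 2 / (N n)%:R ^+ 2 * (L * (n%:R ^+ d * variance_rate d nu m n)).
  move=> /inS[Oj lj].
  apply: (@le_trans _ _ (\sum_(k <- S n) C ^+ 2 / (N n)%:R ^+ 2 *
      Num.max 1 (n%:R * `|k - j|) `^ (4 * (nu - m%:R)))).
    apply: ler_sum => k _; rewrite covX expr_div_n [leRHS]mulrAC.
    apply: ler_wpM2r; first by rewrite invr_ge0 sqr_ge0.
    rewrite (_ : 4 * (nu - m%:R) = 2 * (nu - m%:R) * 2%:R); last by ring.
    rewrite [Num.max _ _ `^ _]powRrM powR_mulrn ?powR_ge0// -exprMn.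
    rewrite -[leLHS]real_normK ?num_real// lerXn2r ?nnegrE ?mulr_ge0 ?powR_ge0//.
    by rewrite [ `|k - j|]distrC; exact: hCn.
  rewrite -mulr_sumr; apply: ler_wpM2l; first by rewrite divr_ge0// ?exprn_ge0// sqr_ge0.
  apply: hL => // s /inS[Os ls]; split => //.
  apply: le_trans (ler_normB _ _) _; apply: (@le_trans _ _ (D%:R + D%:R)).
    by apply: lerD; exact: hD.
  by rewrite -natrD ler_nat addnn -mul2n leqnSn.
rewrite /frobenius_cov.
apply: (@le_trans _ _ (\sum_(j <- S n) C ^+ 2 / (N n)%:R ^+ 2 * (L * (n%:R ^+ d * variance_rate d nu m n)))).
  by rewrite big_seq [leRHS]big_seq; apply: ler_sum => j; exact: row.
rewrite big_const_seq count_predT iter_addr_0 -[_ *+ size _]mulr_natr -[size _]/(N n).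
have -> : C ^+ 2 / (N n)%:R ^+ 2 * (L * (n%:R ^+ d * variance_rate d nu m n)) * (N n)%:R =
   C ^+ 2 * L * variance_rate d nu m n * (n%:R ^+ d / (N n)%:R).
  have : (N n)%:R != 0 :> R by rewrite gt_eqF.
  by move: ((N n)%:R) (n%:R ^+ d) (variance_rate _ _ _ _) => a b r a0; field.
apply: (@le_trans _ _ (C ^+ 2 * L * variance_rate d nu m n * c^-1)).
  apply: ler_wpM2l; first by rewrite !mulr_ge0// sqr_ge0.
  rewrite ler_pdivrMr// ler_pdivlMl//; near: n; exact: hc.
by rewrite mulrAC; apply: ler_wpM2r => //; rewrite lerDl.
Unshelve. all: by end_near.
Qed.

Lemma quad_var_variance : exists2 c : R, 0 < c &
  \forall n \near \oo,
    ('V_P[quad_var nu Omega h m Y n] <= (c * variance_rate d nu m n)%:E)%E.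
Proof.
have [C C0 hC] := frobenius_rate.
exists (2 * C); first by rewrite mulr_gt0.
apply: filterS hC => n hn.
suff -> : ('V_P[quad_var nu Omega h m Y n] = (2 * frobenius_cov P (S n) (X n))%:E)%E.
  by rewrite lee_fin -mulrA; apply: ler_wpM2l.
rewrite quad_varE -(sumsqc_variance gH (S n) (spanX n)).
have hs : has_moments P (sumsq (S n) (X n)) by exact: (hm_sumsq gH).
have mean : fine 'E_P[sumsq (S n) (X n)] = trace_cov P (S n) (X n).
  rewrite unlock -[fine _]/(\int[P]_w sumsq (S n) (X n) w).
  have := Ex_sumsqc gH (S n) (spanX n).
  rewrite /sumsqc (_ : \int[P]_w _ = \int[P]_w sumsq (S n) (X n) w - trace_cov P (S n) (X n)).
    by move/eqP; rewrite subr_eq0 => /eqP.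
  by rewrite ExD ?Ex_cst//; exact: hm_cst.
rewrite /variance covariance.unlock mean [in LHS]unlock.
have hc : has_moments P (sumsqc P (S n) (X n)) by exact: (hm_sumsqc gH).
have i2 : P.-integrable setT (EFin \o (fun w => sumsqc P (S n) (X n) w ^+ 2)) by exact: (hc.2 2).
rewrite /Rintegral fineK; last exact: integrable_fin_num.
by apply: eq_integral => w _; rewrite expr2.
Qed.

(** The moments of order [2 q] of the centred quadratic variation are of order
    [n^(-e q / 2)]; [q] is chosen to make them summable. The mean converges. *)
Lemma quad_var_ae_cvg :
  {ae P, forall w, quad_var nu Omega h m Y n w @[n --> \oo] -->
                   quad_var_limit sigma alpha nu M h m}.
Proof.
have [C C0 hC] := frobenius_rate.
have [e e0 he] := variance_rate_le_powR hd hnum.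
set a := quad_var_limit sigma alpha nu M h m.
pose B := Num.sqrt (C * 2).
pose q := (Num.truncn (4 / e)).+1.
have qe : 4 <= e * q%:R.
  by rewrite -ler_pdivrMl// mulrC ltW// truncnS_gt.
pose u n := B * n%:R `^ (- (e / 2)) : R.
have u0 n : 0 <= u n by rewrite mulr_ge0 ?sqrtr_ge0 ?powR_ge0.
pose K := \prod_(i < q) (2 * (2 * i + 1)%:R * (1 + 2 * (`|a| + 1))) : R.
have K0 : 0 <= K.
  by apply: prodr_ge0 => i _; rewrite !mulr_ge0// !addr_ge0// mulr_ge0// addr_ge0.
have Z0 : {ae P, forall w, sumsqc P (S n) (X n) w @[n --> \oo] --> 0}.
  apply: (@ae_cvg0_of_summable_moments _ _ _ _ _ (2 * q) (K * B ^+ q)) => //.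
  - by rewrite mul2n odd_double.
  - by move=> n; exact: (hm_sumsqc gH).
  near=> n.
  have n0 : (0 < n)%N by near: n; exists 1%N.
  have n0R : 0 < n%:R :> R by rewrite ltr0n.
  have n1 : 1 <= n%:R :> R by rewrite ler1n.
  have ta : trace_cov P (S n) (X n) <= `|a| + 1.
    have : `|a - trace_cov P (S n) (X n)| < 1.
      by near: n; move/cvgrPdist_lt: trace_cvg; apply.
    have := ler_norm a; rewrite distrC.
    by move: (ler_norm (trace_cov P (S n) (X n) - a)); lra.
  have uu : frobenius_cov P (S n) (X n) <= u n ^+ 2.
    apply: (@le_trans _ _ (C * variance_rate d nu m n)); first by near: n.
    rewrite exprMn sqr_sqrtr ?mulr_ge0 ?(ltW C0)// -(powR_mulrn 2 (powR_ge0 _ _)) -powRrM.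
    rewrite -mulrA; apply: ler_wpM2l; first exact: ltW.
    by rewrite mulNr divfK ?pnatr_eq0//; exact: he.
  have u1 : 4 * q%:R * u n <= 1.
    rewrite /u powRN mulrA ler_pdivrMr ?powR_gt0// mul1r; near: n.
    by apply: near_powR_ge; rewrite divr_gt0.
  apply: (le_trans (sumsqc_moment_le gH (spanX n) (u0 n) uu u1)).
  rewrite -[leRHS]mulrA; apply: ler_pM.
  - apply: prodr_ge0 => i _; rewrite !mulr_ge0// addr_ge0// mulr_ge0//.
    exact: trace_cov_ge0.
  - exact: exprn_ge0.
  - apply: ler_prod => i _; apply/andP; split.
      by rewrite !mulr_ge0// addr_ge0// mulr_ge0//; exact: trace_cov_ge0.
    by apply: ler_wpM2l; [exact: mulr_ge0|lra].
  rewrite exprMn; apply: ler_wpM2l; first by rewrite exprn_ge0// sqrtr_ge0.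
  rewrite -(powR_mulrn q (powR_ge0 _ _)) -powRrM -(powR_mulrn 2 (ltW n0R)) -powRN.
  by apply: ler_powR => //; lra.
apply: filterS Z0 => w Zw.
rewrite (_ : (fun n => quad_var nu Omega h m Y n w) =
  (fun n => sumsqc P (S n) (X n) w + trace_cov P (S n) (X n))).
  by rewrite -[a]add0r; apply: cvgD => //; exact: trace_cvg.
by apply/funext => n; rewrite quad_varE /sumsqc subrK.
Unshelve. all: by end_near.
Qed.

End quadratic_variation.

Theorem theorem1 (R : realType) (disp : measure_display)
    (T : measurableType disp) (P : probability T R)
    (d : nat) (hd : (0 < d)%N)
    (sigma alpha nu : R) (hsigma : 0 < sigma) (halpha : 0 < alpha)
    (hnu : 0 < nu)
    (M : 'M[R]_d) (hM : \det M = 1)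
    (Y : 'cV[R]_d -> {RV P >-> R}) (hY : matern_field sigma alpha nu M Y)
    (Omega : set 'cV[R]_d) (hOmega0 : Omega !=set0)
    (hOmega_bounded : bounded_set Omega) (hOmega_open : open Omega)
    (h : 'cV[R]_d) (hh : h != 0)
    (m : nat) (hm : (0 < m)%N) (hnum : nu < m%:R) :
  {ae P, forall w, quad_var nu Omega h m Y n w @[n --> \oo] -->
                   quad_var_limit sigma alpha nu M h m}
  /\
  exists2 c : R, 0 < c &
    \forall n \near \oo,
      ('V_P[quad_var nu Omega h m Y n] <= (c * variance_rate d nu m n)%:E)%E.
Proof.
split.
  exact: (quad_var_ae_cvg hd halpha hnu hM hY hOmega0 hOmega_bounded hOmega_open hh hnum).
exact: (quad_var_variance halpha hnu hM hY hOmega0 hOmega_bounded hOmega_open hh hnum).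
Qed.
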